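(* Let $F$ be a finitely generated free group of rank at least two. The monolith of the group $\mathrm{Comm}(F)$ is equal to the kernel of $d^F : \mathrm{Comm}(F) \to \mathbb{Z}^{(\mathcal{FS})}$. In particular every proper quotient of $\mathrm{Comm}(F)$ is abelian.
   Context: The monolith of a group $C$ is $\mathrm{Mon}(C) = \bigcap_{N\neq 1} N$, the intersection of all non-trivial normal subgroups of $C$, when this intersection is non-trivial (in which case $C$ is called monolithic). A proper quotient of a group is a quotient by a non-trivial normal subgroup. A virtual isomorphism of a group $\Gamma$ is an isomorphism $\varphi: A \to B$ between finite index subgroups $A,B$ of $\Gamma$. Two virtual isomorphisms are equivalent if they agree on a common finite index subgroup of their domains; $[\varphi]$ denotes the equivalence class. The composition of $\varphi: A\to B$ followed by $\psi: C \to D$ is the isomorphism $\varphi^{-1}(B\cap C) \to \psi(B\cap C)$, $x \mapsto \psi(\varphi(x))$. Equivalence classes form a group under composition, the abstract commensurator $\mathrm{Comm}(\Gamma)$. A virtual isomorphism $\varphi : A\to B$ is $\Gamma$-subnormal if both $A$ and $B$ are subnormal in $\Gamma$; every element of $\mathrm{Comm}(\Gamma)$ has a $\Gamma$-subnormal representative. $\mathcal{FS}$ is the collection of isomorphism classes of finite simple groups (including cyclic groups of prime order). $\mathbb{Z}^{(\mathcal{FS})}$ is the free abelian group with basis $\mathcal{FS}$ (finitely supported functions $\mathcal{FS}\to\mathbb{Z}$), and $\delta_S$ is the Dirac function at $S$. If $A$ is a finite index subnormal subgroup of $\Gamma$, a composition series going from $A$ to $\Gamma$ is a finite series $(A_\ell,\dots,A_0)$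 with $A_\ell = A$, $A_0=\Gamma$, each $A_{i+1}$ normal in $A_i$ and $A_i/A_{i+1}$ finite simple. For $S \in \mathcal{FS}$, $n_S^\Gamma(A)$ is the number of indices $i$ with $A_i/A_{i+1} \simeq S$ (independent of the series). The map $d^\Gamma : \mathrm{Comm}(\Gamma)\to \mathbb{Z}^{(\mathcal{FS})}$ is the (well-defined) group homomorphism $d^\Gamma(c) = \sum_{S} (n_S^\Gamma(B)-n_S^\Gamma(A))\delta_S$, where $\varphi : A\to B$ is any $\Gamma$-subnormal representative of $c$. *)

(* Defs.v *)
From HB Require Import structures.
From mathcomp Require Import all_boot all_order all_algebra all_fingroup all_solvable.
From mathcomp Require Import all_classical.
From mathcomp Require Import freeg generic_quotient.

Set Implicit Arguments.
Unset Strict Implicit.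
Unset Printing Implicit Defensive.

Import GRing.Theory.

Local Open Scope group_scope.
Local Open Scope classical_set_scope.
Local Open Scope quotient_scope.

Identity Coercion fun_of_set : set >-> Funclass.

Record subgroup (G : groupType) := Subgroup {
  sg_set :> set G;
  sg1 : sg_set 1;
  sgF : forall x y, sg_set x -> sg_set y -> sg_set (x * y^-1)
}.

HB.instance Definition _ (G : groupType) := gen_eqMixin (subgroup G).
HB.instance Definition _ (G : groupType) := gen_choiceMixin (subgroup G).

Section SubgroupTheory.
Variable G : groupType.
Implicit Types (H K : subgroup G) (x y : G).

Lemma subgroup_eq H K : (H : set G) = K -> H = K.
Proof.
case: H K => [A A1 AF] [B B1 BF] /= eAB; case: B / eAB B1 BF => B1 BF.
by congr Subgroup; apply: Prop_irrelevance.
Qed.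

Lemma sgV H x : H x -> H x^-1.
Proof. by move=> Hx; rewrite -[x^-1]mul1g; apply: sgF => //; apply: sg1. Qed.

Lemma sgM H x y : H x -> H y -> H (x * y).
Proof. by move=> Hx /sgV Hy; rewrite -[y]invgK; apply: sgF. Qed.

Program Definition sgtop : subgroup G := @Subgroup G setT _ _.
Next Obligation. by []. Qed.
Next Obligation. by []. Qed.

Program Definition sgcap H K : subgroup G := @Subgroup G (H `&` K) _ _.
Next Obligation. by move=> H K; split; apply: sg1. Qed.
Next Obligation. by move=> H K x y [? ?] [? ?]; split; apply: sgF. Qed.

End SubgroupTheory.

Arguments sgtop {G}.

Definition sgtype (G : groupType) (H : subgroup G) : Type :=
  {x : G | x \in (H : set G)}.

Section SubgroupType.
Variables (G : groupType) (H : subgroup G).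

HB.instance Definition _ := SubChoice.on (sgtype H).

Lemma sgtype_closed : group_closed (fun x => x \in (H : set G)).
Proof.
split=> [|x y]; first by rewrite unfold_in /= inE; apply: sg1.
by rewrite !unfold_in /= !inE; apply: sgF.
Qed.

HB.instance Definition _ :=
  SubChoice_isSubGroup.Build G _ (sgtype H) sgtype_closed.

End SubgroupType.

Definition is_normal (G : groupType) (N : subgroup G) : Prop :=
  forall x g, N x -> N (x ^ g).

Record normal_subgroup (G : groupType) := NormalSubgroup {
  nsg :> subgroup G;
  nsgP : is_normal nsg
}.

Section Quotient.
Variables (G : groupType) (N : normal_subgroup G).

Definition coset_rel (x y : G) : bool := `[< N (x^-1 * y) >].

Lemma coset_rel_refl : reflexive coset_rel.
Proof. by move=> x; apply/asboolP; rewrite mulVg; apply: sg1. Qed.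

Lemma coset_rel_symm : symmetric coset_rel.
Proof.
move=> x y; apply/asboolP/asboolP => /sgV; by rewrite invgM invgK.
Qed.

Lemma coset_rel_trans : transitive coset_rel.
Proof.
move=> y x z /asboolP Nxy /asboolP Nyz; apply/asboolP.
by have := sgM Nxy Nyz; rewrite mulgA mulgK.
Qed.

Definition coset_equiv : equiv_rel G :=
  EquivRel coset_rel coset_rel_refl coset_rel_symm coset_rel_trans.

Definition quotient_group := {eq_quot coset_equiv}.

HB.instance Definition _ := EqQuotient.on quotient_group.
HB.instance Definition _ := Choice.on quotient_group.

Definition quo_mul (a b : quotient_group) : quotient_group :=
  \pi_quotient_group (repr a * repr b).
Definition quo_inv (a : quotient_group) : quotient_group :=
  \pi_quotient_group (repr a)^-1.
Definition quo_one : quotient_group := \pi_quotient_group 1.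

Lemma quoP (x y : G) :
  reflect (N (x^-1 * y)) (\pi_quotient_group x == \pi_quotient_group y).
Proof. by rewrite eqmodE /=; apply: asboolP. Qed.

Lemma pi_repr_quo (x : G) : N ((repr (\pi_quotient_group x))^-1 * x).
Proof. by apply/quoP; rewrite reprK. Qed.

Lemma pi_quoM (x y : G) :
  quo_mul (\pi_quotient_group x) (\pi_quotient_group y) = \pi_quotient_group (x * y).
Proof.
apply/eqP/quoP; set x' := repr _; set y' := repr _.
have Nx : N (x'^-1 * x) by apply: pi_repr_quo.
have Ny : N (y'^-1 * y) by apply: pi_repr_quo.
have -> : (x' * y')^-1 * (x * y) = (x'^-1 * x) ^ y' * (y'^-1 * y).
  by rewrite /conjg invgM !mulgA mulgK.
by apply: sgM => //; apply: nsgP.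
Qed.

Lemma pi_quoV (x : G) : quo_inv (\pi_quotient_group x) = \pi_quotient_group x^-1.
Proof.
apply/eqP/quoP; set x' := repr _.
have Nx : N (x'^-1 * x) by apply: pi_repr_quo.
have := nsgP x'^-1 (sgV Nx).
by rewrite /conjg invgM !invgK !mulgA mulgK.
Qed.

Lemma quo_mulA : associative quo_mul.
Proof.
move=> x y z; rewrite -[x]reprK -[y]reprK -[z]reprK.
by rewrite (pi_quoM (repr y)) (pi_quoM (repr x) (repr y)) !pi_quoM mulgA.
Qed.
Lemma quo_mul1 : left_id quo_one quo_mul.
Proof. by move=> x; rewrite -[x]reprK pi_quoM mul1g. Qed.
Lemma quo_mulr1 : right_id quo_one quo_mul.
Proof. by move=> x; rewrite -[x]reprK pi_quoM mulg1. Qed.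
Lemma quo_mulV : left_inverse quo_one quo_inv quo_mul.
Proof. by move=> x; rewrite -[x]reprK pi_quoV pi_quoM mulVg. Qed.
Lemma quo_mulrV : right_inverse quo_one quo_inv quo_mul.
Proof. by move=> x; rewrite -[x]reprK pi_quoV pi_quoM mulgV. Qed.

HB.instance Definition _ :=
  isGroup.Build quotient_group quo_mulA quo_mul1 quo_mulr1 quo_mulV quo_mulrV.

End Quotient.

Definition isomorphic (G H : groupType) : Prop :=
  exists f : {multiplicative G -> H}, bijective f.

Definition is_abelian (G : groupType) : Prop := forall x y : G, x * y = y * x.

Definition monolith (G : groupType) : set G :=
  \bigcap_(N in [set N : normal_subgroup G | (N : set G) <> [set 1]]) (N : set G).

Arguments monolith : clear implicits.

Definition monolithic (G : groupType) : Prop := monolith G <> [set 1].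

Definition free_basis (I : Type) (F : groupType) (x : I -> F) : Prop :=
  forall (H : groupType) (h : I -> H),
    exists f : {multiplicative F -> H},
      (forall i, f (x i) = h i) /\
      (forall f' : {multiplicative F -> H},
         (forall i, f' (x i) = h i) -> f' =1 f).

Definition finite_index (G : groupType) (H : subgroup G) : Prop :=
  finite_set (range (fun x : G => [set x * h | h in (H : set G)])).

Section FiniteIndex.
Variable G : groupType.
Implicit Types H K : subgroup G.

Lemma finite_indexP H : finite_index H <->
  exists (T : finType) (f : G -> T), forall x y, f x = f y -> H (x^-1 * y).
Proof.
pose c (x : G) := [set x * h | h in (H : set G)].
have cP x y : c x = c y -> H (x^-1 * y).
  move=> exy; have : c y y by exists 1; [exact: sg1 | rewrite mulg1].
  by rewrite -exy => -[h Hh <-]; rewrite mulKg.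
split=> [/finite_seqP [s es]|[T [f fP]]].
  pose f (x : G) := index (c x) s.
  have fs x : (f x < size s)%N.
    rewrite index_mem; have : range c (c x) by exists x.
    by rewrite es.
  exists 'I_(size s), (fun x => Ordinal (fs x)) => x y [] exy; apply: cP.
  have cs z : c z \in s by rewrite -index_mem; apply: fs.
  rewrite -(nth_index set0 (cs x)) -(nth_index set0 (cs y)).
  exact: (congr1 (nth set0 s) exy).
pose r (t : T) := xget 1 [set x | f x = t].
apply: (@sub_finite_set _ _ ((fun t => c (r t)) @` [set: T])); last first.
  exact/finite_image/finite_finset.
move=> _ [x _ <-]; exists (f x) => //.
have fr : f (r (f x)) = f x.
  by rewrite /r; case: xgetP => [y _ //|/(_ x)]; rewrite /= => /(_ erefl).
have Hr := fP _ _ fr; rewrite /c; apply/seteqP; split=> _ [h Hh <-].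
  exists (x^-1 * (r (f x) * h)); last by rewrite mulVKg.
  by rewrite mulgA; apply: sgM => //; have := sgV Hr; rewrite invgM invgK.
exists ((r (f x))^-1 * (x * h)); last by rewrite mulVKg.
by rewrite mulgA; apply: sgM.
Qed.

Lemma finite_index_top : finite_index (@sgtop G).
Proof. by apply/finite_indexP; exists unit, (fun=> tt). Qed.

Lemma finite_index_cap H K :
  finite_index H -> finite_index K -> finite_index (sgcap H K).
Proof.
move=> /finite_indexP [T [f fP]] /finite_indexP [U [g gP]].
apply/finite_indexP; exists (T * U)%type, (fun x => (f x, g x)) => x y.
by case=> /fP ? /gP ?; split.
Qed.

End FiniteIndex.

(* [vmap] is a total function; only its values on [vdom] matter. *)
Record virtual_iso (G : groupType) := VirtualIso {
  vdom : subgroup G;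
  vcod : subgroup G;
  vmap :> G -> G;
  vdom_fi : finite_index vdom;
  vcod_fi : finite_index vcod;
  vmapM : forall x y, vdom x -> vdom y -> vmap (x * y) = vmap x * vmap y;
  vmap_bij : set_bij vdom vcod vmap
}.

HB.instance Definition _ (G : groupType) := gen_eqMixin (virtual_iso G).
HB.instance Definition _ (G : groupType) := gen_choiceMixin (virtual_iso G).

Section VirtualIso.
Variable G : groupType.
Implicit Types (H K : subgroup G) (f g h : virtual_iso G) (x y : G).

Lemma vmap_cod f x : vdom f x -> vcod f (f x).
Proof. by case: (vmap_bij f) => fH _ _; apply: fH. Qed.

Lemma vmap_inj f x y : vdom f x -> vdom f y -> f x = f y -> x = y.
Proof. by case: (vmap_bij f) => _ fI _ Dx Dy; apply: fI; rewrite inE. Qed.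

Lemma vmap_surj f y : vcod f y -> exists2 x, vdom f x & f x = y.
Proof. by case: (vmap_bij f) => _ _ fS /fS. Qed.

Lemma vmap1 f : f 1 = 1.
Proof.
have D1 := sg1 (vdom f).
by apply: (mulgI (f 1)); rewrite -vmapM // !mulg1.
Qed.

Lemma vmapV f x : vdom f x -> f x^-1 = (f x)^-1.
Proof.
move=> Dx; apply: (mulgI (f x)); rewrite -vmapM //; last exact: sgV.
by rewrite !mulgV vmap1.
Qed.

Lemma vmapF f x y : vdom f x -> vdom f y -> f (x * y^-1) = f x * (f y)^-1.
Proof. by move=> Dx Dy; rewrite vmapM ?vmapV //; apply: sgV. Qed.

Program Definition vpreim f H : subgroup G :=
  @Subgroup G [set x | vdom f x /\ H (f x)] _ _.
Next Obligation. by move=> f H; split; rewrite ?vmap1; apply: sg1. Qed.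
Next Obligation.
by move=> f H x y [Dx Hx] [Dy Hy]; split; rewrite ?vmapF //; apply: sgF.
Qed.

Lemma vpreim_fi f H : finite_index H -> finite_index (vpreim f H).
Proof.
move=> /finite_indexP [T [a aP]]; have /finite_indexP [U [b bP]] := vdom_fi f.
pose r u := xget 1 [set x | b x = u].
have br x : b (r (b x)) = b x.
  by rewrite /r; case: xgetP => [y _ //|/(_ x)]; rewrite /= => /(_ erefl).
apply/finite_indexP.
exists (U * T)%type, (fun x => (b x, a (f ((r (b x))^-1 * x)))) => x y [exy].
have Dx := bP _ _ (br x); have Dy := bP _ _ (br y).
rewrite -exy in Dy *.
have -> : x^-1 * y = ((r (b x))^-1 * x)^-1 * ((r (b x))^-1 * y).
  by rewrite invgM invgK mulgA mulgK.
move=> /aP; rewrite -vmapV // -vmapM //; last exact: sgV.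
by move=> Hxy; split=> //; apply: sgM => //; apply: sgV.
Qed.

Program Definition vid : virtual_iso G :=
  @VirtualIso G sgtop sgtop id _ _ _ _.
Next Obligation. exact: finite_index_top. Qed.
Next Obligation. exact: finite_index_top. Qed.
Next Obligation. by []. Qed.
Next Obligation. by split=> // y _; exists y. Qed.

Definition vinv_map f y := xget 1 [set x | vdom f x /\ f x = y].

Lemma vinv_mapP f y : vcod f y -> vdom f (vinv_map f y) /\ f (vinv_map f y) = y.
Proof.
move=> /vmap_surj [x Dx fx]; rewrite /vinv_map.
by case: xgetP => [z -> //|/(_ x)]; case.
Qed.

Lemma vinv_mapK f x : vdom f x -> vinv_map f (f x) = x.
Proof.
move=> Dx; have [Dy fy] := vinv_mapP (vmap_cod Dx).
exact: vmap_inj fy.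
Qed.

Program Definition vinv f : virtual_iso G :=
  @VirtualIso G (vcod f) (vdom f) (vinv_map f) _ _ _ _.
Next Obligation. by move=> f; apply: vcod_fi. Qed.
Next Obligation. by move=> f; apply: vdom_fi. Qed.
Next Obligation.
move=> f x y Cx Cy; have [Dx fx] := vinv_mapP Cx; have [Dy fy] := vinv_mapP Cy.
rewrite -{1}fx -{1}fy -vmapM // vinv_mapK //; exact: sgM.
Qed.
Next Obligation.
move=> f; split.
- by move=> y Cy; case: (vinv_mapP Cy).
- move=> x y; rewrite !inE => Cx Cy exy.
  by have [_ <-] := vinv_mapP Cx; have [_ <-] := vinv_mapP Cy; rewrite exy.
- by move=> x Dx; exists (f x); rewrite ?vinv_mapK //; apply: vmap_cod.
Qed.

Program Definition vimage f H : subgroup G :=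
  @Subgroup G [set f x | x in vdom f `&` H] _ _.
Next Obligation. by move=> f H; exists 1; [split; apply: sg1 | apply: vmap1]. Qed.
Next Obligation.
move=> f H _ _ [x [Dx Hx] <-] [y [Dy Hy] <-]; exists (x * y^-1); last exact: vmapF.
by split; apply: sgF.
Qed.

Lemma vimage_fi f H : finite_index H -> finite_index (vimage f H).
Proof.
move=> /(vpreim_fi (vinv f)); congr finite_index; apply: subgroup_eq.
apply/seteqP; split=> [y [Cy Hy]|_ [x [Dx Hx] <-]].
  by have [Dx fx] := vinv_mapP Cy; exists (vinv_map f y).
by split; [apply: vmap_cod | rewrite /= vinv_mapK].
Qed.

(* [f : A -> B] followed by [g : C -> D], with domain [f^-1(B cap C)] and
   codomain [g(B cap C)]. *)
Program Definition vcomp g f : virtual_iso G :=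
  @VirtualIso G (vpreim f (sgcap (vcod f) (vdom g)))
                (vimage g (sgcap (vcod f) (vdom g))) (g \o f) _ _ _ _.
Next Obligation.
by move=> g f; apply/vpreim_fi/finite_index_cap; [apply: vcod_fi|apply: vdom_fi].
Qed.
Next Obligation.
by move=> g f; apply/vimage_fi/finite_index_cap; [apply: vcod_fi|apply: vdom_fi].
Qed.
Next Obligation.
by move=> g f x y [? [? ?]] [? [? ?]] /=; rewrite vmapM // vmapM.
Qed.
Next Obligation.
move=> g f; split.
- by move=> x [Dx [Cx Dfx]]; exists (f x).
- move=> x y; rewrite !inE => -[Dx [Cx Dfx]] [Dy [Cy Dfy]] /= e.
  exact: vmap_inj (vmap_inj Dfx Dfy e).
- move=> _ [y [_ [Cy Dy]] <-]; have [x Dx fx] := vmap_surj Cy.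
  by exists x; rewrite /= ?fx.
Qed.

Definition vequiv f g : bool :=
  `[< exists2 D : subgroup G, finite_index D &
        forall x, D x -> [/\ vdom f x, vdom g x & f x = g x] >].

Lemma vequivP f g : vequiv f g <->
  exists2 D : subgroup G, finite_index D &
    forall x, D x -> [/\ vdom f x, vdom g x & f x = g x].
Proof. by split=> /asboolP. Qed.

Lemma vequiv_refl : reflexive vequiv.
Proof. by move=> f; apply/vequivP; exists (vdom f) => //; apply: vdom_fi. Qed.

Lemma vequiv_symm : symmetric vequiv.
Proof.
by move=> f g; apply/idP/idP => /vequivP [D Df DP]; apply/vequivP; exists D => //;
  move=> x /DP [].
Qed.

Lemma vequiv_trans : transitive vequiv.
Proof.
move=> g f h /vequivP [D Df DP] /vequivP [E Ef EP]; apply/vequivP.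
exists (sgcap D E); first exact: finite_index_cap.
by move=> x [/DP [? ? e] /EP [? ? <-]].
Qed.

Definition vequiv_rel : equiv_rel (virtual_iso G) :=
  EquivRel vequiv vequiv_refl vequiv_symm vequiv_trans.

Definition Comm := {eq_quot vequiv_rel}.

HB.instance Definition _ := EqQuotient.on Comm.
HB.instance Definition _ := Choice.on Comm.

Definition comm_mul (a b : Comm) : Comm := \pi_Comm (vcomp (repr a) (repr b)).
Definition comm_inv (a : Comm) : Comm := \pi_Comm (vinv (repr a)).
Definition comm_one : Comm := \pi_Comm vid.

Lemma commP f g : \pi_Comm f = \pi_Comm g <-> vequiv f g.
Proof. by split=> [/eqP|e]; [rewrite eqmodE|apply/eqP; rewrite eqmodE]. Qed.

Lemma repr_comm f : vequiv (repr (\pi_Comm f)) f.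
Proof. by apply/commP; rewrite reprK. Qed.

Lemma vequiv_comp g g' f f' :
  vequiv g g' -> vequiv f f' -> vequiv (vcomp g f) (vcomp g' f').
Proof.
move=> /vequivP [D Df DP] /vequivP [E Ef EP]; apply/vequivP.
exists (sgcap E (vpreim f D)); first exact/finite_index_cap/vpreim_fi.
move=> x [/EP [Dx Dx' e] [_ /DP [Dy Dy' e']]].
split; last by rewrite /= -e.
  by do !split => //; apply: vmap_cod.
by split=> //; split; [apply: vmap_cod | rewrite /= -e].
Qed.

Lemma vequiv_inv f f' : vequiv f f' -> vequiv (vinv f) (vinv f').
Proof.
move=> /vequivP [D Df DP]; apply/vequivP.
exists (vimage f D); first exact: vimage_fi.
move=> _ [x [_ /DP [Dx Dx' e]] <-]; split=> /=.
- exact: vmap_cod.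
- by rewrite e; apply: vmap_cod.
- by rewrite {2}e !vinv_mapK.
Qed.

Lemma pi_commM g f : comm_mul (\pi_Comm g) (\pi_Comm f) = \pi_Comm (vcomp g f).
Proof. by apply/commP; apply: vequiv_comp; apply: repr_comm. Qed.

Lemma pi_commV f : comm_inv (\pi_Comm f) = \pi_Comm (vinv f).
Proof. by apply/commP/vequiv_inv/repr_comm. Qed.

Lemma comm_mulA : associative comm_mul.
Proof.
move=> h g f; rewrite -[h]reprK -[g]reprK -[f]reprK.
rewrite (pi_commM (repr g)) (pi_commM (repr h) (repr g)) !pi_commM.
move: (repr h) (repr g) (repr f) => {}h {}g {}f.
apply/commP/vequivP; exists (vpreim (vcomp g f) (vdom h)).
  exact/vpreim_fi/vdom_fi.
move=> x [/= [Dx [Cx Dg]] Dh]; have Cg := vmap_cod Dg.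
by do !split => //; exists (f x).
Qed.

Lemma comm_mul1 : left_id comm_one comm_mul.
Proof.
move=> f; rewrite -[f]reprK pi_commM; move: (repr f) => {}f; apply/commP/vequivP.
by exists (vdom f) => [|x Dx]; [apply: vdom_fi|do !split => //; apply: vmap_cod].
Qed.

Lemma comm_mulr1 : right_id comm_one comm_mul.
Proof.
move=> f; rewrite -[f]reprK pi_commM; move: (repr f) => {}f; apply/commP/vequivP.
by exists (vdom f) => [|x Dx]; [apply: vdom_fi|do !split].
Qed.

Lemma comm_mulV : left_inverse comm_one comm_inv comm_mul.
Proof.
move=> f; rewrite -[f]reprK pi_commV pi_commM; move: (repr f) => {}f; apply/commP/vequivP.
exists (vdom f) => [|x Dx]; first exact: vdom_fi.
by have Cx := vmap_cod Dx; do !split => //=; rewrite vinv_mapK.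
Qed.

Lemma comm_mulrV : right_inverse comm_one comm_inv comm_mul.
Proof.
move=> f; rewrite -[f]reprK pi_commV pi_commM; move: (repr f) => {}f; apply/commP/vequivP.
exists (vcod f) => [|x Cx]; first exact: vcod_fi.
by have [Dx e] := vinv_mapP Cx; do !split => //=; rewrite e.
Qed.

HB.instance Definition _ :=
  isGroup.Build Comm comm_mulA comm_mul1 comm_mulr1 comm_mulV comm_mulrV.

End VirtualIso.

Definition normal_in (G : groupType) (N H : subgroup G) : Prop :=
  (N : set G) `<=` H /\ forall x h, N x -> H h -> N (x ^ h).

Section Factor.
Variables (G : groupType) (H N : subgroup G).

Program Definition sg_restrict : subgroup (sgtype H) :=
  @Subgroup (sgtype H) [set x | N (val x)] _ _.
Next Obligation. exact: sg1. Qed.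
Next Obligation. by move=> x y; apply: sgF. Qed.

Lemma sg_restrict_normal : normal_in N H -> is_normal sg_restrict.
Proof.
move=> [_ nNH] x g Nx; apply: nNH => //.
by have := valP g; rewrite inE.
Qed.

Definition factor (nNH : normal_in N H) : groupType :=
  quotient_group (NormalSubgroup (sg_restrict_normal nNH)).

End Factor.

Inductive subnormal (G : groupType) : subgroup G -> Prop :=
| subnormal_top : subnormal sgtop
| subnormal_step H N : subnormal H -> normal_in N H -> subnormal N.

(* By Cayley's theorem every finite group is isomorphic to a permutation
   group, so isomorphism classes of finite simple groups are isomorphism
   classes of simple permutation groups on some 'I_n. *)
Definition simple_perm_group :=
  {H : {n : nat & {group 'S_n}} | simple (tagged H)}.

Definition spg_isog (S T : simple_perm_group) : bool :=
  tagged (val S) \isog tagged (val T).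

Lemma spg_isog_refl : reflexive spg_isog.
Proof. by move=> S; apply: isog_refl. Qed.
Lemma spg_isog_sym : symmetric spg_isog.
Proof. by move=> S T; apply: isog_sym. Qed.
Lemma spg_isog_trans : transitive spg_isog.
Proof. by move=> T S U; apply: isog_trans. Qed.

Definition spg_equiv : equiv_rel simple_perm_group :=
  EquivRel spg_isog spg_isog_refl spg_isog_sym spg_isog_trans.

Definition FS := {eq_quot spg_equiv}.

HB.instance Definition _ := EqQuotient.on FS.
HB.instance Definition _ := Choice.on FS.

Definition FS_group (S : FS) : groupType :=
  subg_of (tagged (val (repr S))).

Lemma FS_group_inj (S T : FS) : isomorphic (FS_group S) (FS_group T) -> S = T.
Proof.
move=> [f bf]; rewrite -[S]reprK -[T]reprK; apply/eqP; rewrite eqmodE /=.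
rewrite /spg_isog.
set A := tagged (val (repr S)); set B := tagged (val (repr T)).
suff AB : [set: subg_of A]%G \isog [set: subg_of B]%G.
  apply: isog_trans (isog_subg A) _.
  by apply: isog_trans AB _; rewrite isog_sym; apply: isog_subg.
have fM : {in [set: subg_of A]%G &, {morph f : x y / x * y}}.
  by move=> x y _ _; apply: gmulfM.
apply/isogP; exists (Morphism fM).
  by apply/injmP => x y _ _ /=; apply: bij_inj.
apply/setP => y; rewrite !inE; have [g _ fg] := bf.
by apply/morphimP; exists (g y); rewrite ?inE //= fg.
Qed.

Section CompositionSeries.
Variable G : groupType.
Implicit Types (A N H : subgroup G) (S : FS).

Definition factor_is H N S : Prop :=
  exists nNH : normal_in N H, isomorphic (factor nNH) (FS_group S).

(* [s] lists the series downwards, from [A_0 = G] to [A_l = A]. *)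
Definition composition_series A (s : seq (subgroup G)) : Prop :=
  [/\ (0 < size s)%N, nth sgtop s 0 = sgtop, nth sgtop s (size s).-1 = A &
      forall i, (i.+1 < size s)%N ->
        exists S, factor_is (nth sgtop s i) (nth sgtop s i.+1) S].

Definition series_mult (s : seq (subgroup G)) S : nat :=
  \sum_(i < (size s).-1) `[< factor_is (nth sgtop s i) (nth sgtop s i.+1) S >].

(* By Jordan-Hoelder the multiplicity does not depend on the series; one of
   them is chosen. *)
Definition nmult A S : nat :=
  series_mult (xget [::] [set s | composition_series A s]) S.

Lemma factor_is_inj H N S S' : factor_is H N S -> factor_is H N S' -> S = S'.
Proof.
move=> [n1 [f bf]] [n2]; rewrite (Prop_irrelevance n2 n1) => -[g bg].
apply: FS_group_inj; have [f' fK f'K] := bf.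
have f'M : {morph f' : x y / x * y}.
  by move=> x y; apply: (can_inj fK); rewrite gmulfM !f'K.
pose f'_mul := isMultiplicative.Build _ _ f' f'M.
pose F' : {multiplicative FS_group S -> factor n1} := HB.pack f' f'_mul.
exists (g \o F' : {multiplicative _ -> _}).
by apply: bij_comp => //; exists f.
Qed.

Lemma nmult_fin A : finite_set [set S | nmult A S != 0%N].
Proof.
rewrite /nmult; set s := xget _ _.
pose B (i : 'I_(size s).-1) :=
  [set S | factor_is (nth sgtop s i) (nth sgtop s i.+1) S].
apply: (@sub_finite_set _ _ (\bigcup_(i in [set: 'I_(size s).-1]) B i)); last first.
  apply: bigcup_finite => // i _; have [[S BS]|nB] := pselect (exists S, B i S).
    by apply: (@sub_finite_set _ _ [set S]) => // T BT; apply: factor_is_inj BT BS.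
  by apply: (@sub_finite_set _ _ set0) => // T BT; case: nB; exists T.
move=> S /=; rewrite /series_mult sum_nat_eq0 negb_forall => /existsP [i].
by rewrite /= eqb0 negbK => /asboolP BS; exists i.
Qed.

Definition subnormal_repr (c : Comm G) (f : virtual_iso G) : Prop :=
  [/\ \pi_(Comm G) f = c, subnormal (vdom f) & subnormal (vcod f)].

(* Likewise, the value does not depend on the subnormal representative. *)
Definition dcomm (c : Comm G) : {freeg FS} :=
  let f := xget (vid G) [set f | subnormal_repr c f] in
  (\sum_(S \in [set: FS])
     << ((nmult (vcod f) S)%:Z - (nmult (vdom f) S)%:Z) *g S >>)%R.

(* The sum above has finite support, so its coefficients are as expected. *)
Lemma coeff_dcomm (c : Comm G) :
  let f := xget (vid G) [set f | subnormal_repr c f] in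
  forall S, coeff S (dcomm c) =
    ((nmult (vcod f) S)%:Z - (nmult (vdom f) S)%:Z)%R.
Proof.
rewrite /dcomm; set f := xget _ _ => /= S.
set F := (fun T : FS => _).
have finF : finite_set [set T | F T != 0%R].
  apply: (@sub_finite_set _ _ ([set T | nmult (vcod f) T != 0%N] `|`
                               [set T | nmult (vdom f) T != 0%N])).
    move=> T /=; rewrite /F; have [->|] := eqVneq (nmult (vcod f) T) 0%N; last by left.
    have [->|] := eqVneq (nmult (vdom f) T) 0%N; last by right.
    by rewrite subrr freegU0 eqxx.
  by rewrite finite_setU; split; apply: nmult_fin.
have /finite_seqP [s es] := finF.
have sP T : (T \in undup s) = (F T != 0%R).
  by rewrite mem_undup; apply/idP/idP => [sT|FT];
    [have : [set` s] T by []; rewrite -es | have : [set` s] T by rewrite -es].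
rewrite (fsbigE (undup s)) ?undup_uniq //; last first.
  by move=> T _; rewrite sP negbK => /eqP.
rewrite raddf_sum /=; under eq_bigr do rewrite coeffU.
rewrite (eq_bigl xpredT) => [|T]; last by rewrite in_setT.
have [Ss|nSs] := boolP (S \in undup s).
  rewrite (bigD1_seq S) ?undup_uniq //= eqxx mulr1 big1 ?addr0 //.
  by move=> T /negbTE ->; rewrite mulr0.
rewrite big1_seq; last first.
  move=> T /andP [_ Ts]; have [eTS|_] := eqVneq T S; last by rewrite mulr0.
  by rewrite eTS (negbTE nSs) in Ts.
by move: nSs; rewrite sP negbK /F freegU_eq0 => /eqP ->.
Qed.

End CompositionSeries.

(* Main.v *)
From HB Require Import structures.
From mathcomp Require Import all_boot all_order all_algebra all_fingroup all_solvable.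
From mathcomp Require Import all_classical.
From mathcomp Require Import freeg generic_quotient zify.
Require Import Defs.

(** Let [F] be free of rank at least two, [N] a non-trivial normal subgroup of
    [Comm F], and [K] the kernel of [d]. Since [K] is itself normal (it is the kernel of a
    homomorphism) and non-trivial (it contains the conjugations by elements of [F]),
    everything follows from [K <= N]; the quotients are abelian because [d] takes
    its values in an abelian group.

    Identify an element of [F] with the class of the conjugation by it.

    - [N] contains a finite-index subgroup [A] of [F]. The commutator of a non-trivial
      class [f] in [N] with [a] is the element [f a * a^-1] of [F], so [N] meets [F]
      non-trivially. By Marshall Hall's theorem an element of minimal length in
      this intersection belongs to a basis of a finite-index subgroup [A]; as [N] is
      normalised by the automorphisms of [A], it contains that basis
      ([innN_finite_index]).

    - If [C <= A] has finite index and rank at least three, [N] contains [Aut C].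
      The automorphism group is generated by Nielsen moves ([nielsen_bases]),
      and these are handled in a subgroup [D] of index two in [C]: conjugation
      by an element of [C] outside [D] lies in [N] and carries a transvection of
      [D] to one on disjoint basis elements. Two such transvections are
      then equal modulo [N], and a commutator of transvections is again a
      transvection; hence [N] contains all of them ([nrel_tv]). A Nielsen
      move of [C] restricts to a product of two Nielsen moves of [D] ([nrel_nielsen]).

    - Let [A'], [B'] be subnormal in such a [C] with the same composition factors,
      of orders small compared with the rank of [C]. Then some element of
      [N] maps [A'] onto [B'] ([comp_conj]). Two surjections of [C] onto the same simple
      group differ by Nielsen moves, because a group of order [k] has a single
      Nielsen class of generating tuples of each length at least [3k]
      ([nl_transitive]). This settles the case of equal first factors;
      two different first factors can be exchanged, the surjections of [C] onto
      them being independent.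

    - If [d] vanishes on the class of [f : A -> B], the composition factors of [A]
      and [B] agree. Passing through index two only enlarges the set
      of factors by the group of order two, so there is a subnormal [C] of rank as
      large as desired compared with the factors that occur; after restriction
      the domain and the range of [f] lie in [C], and by the Jordan--Hoelder theorem
      ([comp_unique]) they have the same factors in [C]. An
      element [g] of [N] has the same effect on the domain as [f], so [g^-1 * f] is an
      automorphism of the domain, hence in [N] ([ker_d_minimal]).

    The same theorem shows that [d] is a homomorphism ([dcommM]). *)

Set Implicit Arguments.
Unset Strict Implicit.
Unset Printing Implicit Defensive.

Local Open Scope group_scope.
Local Open Scope classical_set_scope.
Local Open Scope quotient_scope.

(* Left-associated normal form of a product, with adjacent inverses cancelled. *)
Ltac gsimp := rewrite ?(invgM, invgK, mulgA, mulgK, mulgVK, mulgV, mulVg, mul1g, mulg1, invg1).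

(** * Bases of subgroups *)

(** Permutations of an arbitrary type, composed as functions. The inverse is part
    of the data, so that group laws hold without choice. Mapping a free group into
    such groups is how its universal property is exploited below. *)
Record Sym (T : Type) := MkSym {
  sfun :> T -> T;
  sbwd : T -> T;
  sfunK : cancel sfun sbwd;
  sbwdK : cancel sbwd sfun
}.

HB.instance Definition _ (T : Type) := gen_eqMixin (Sym T).
HB.instance Definition _ (T : Type) := gen_choiceMixin (Sym T).

Section SymGroup.
Variable T : Type.
Implicit Types s t : Sym T.

Lemma sym_eq s t : s =1 t -> s = t.
Proof.
case: s t => [f f' fK f'K] [g g' gK g'K] /= /funext efg.
rewrite -{}efg in gK g'K *.
have e : f' = g' by apply: funext => x; rewrite -{1}[x]g'K fK.
by rewrite -{}e in gK g'K *; congr MkSym; apply: Prop_irrelevance.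
Qed.

Definition sym_mul s t : Sym T :=
  MkSym (can_comp (sfunK s) (sfunK t)) (can_comp (sbwdK t) (sbwdK s)).
Definition sym_inv s : Sym T := MkSym (sbwdK s) (sfunK s).
Definition sym_one : Sym T := @MkSym T id id (frefl _) (frefl _).

Lemma sym_mulA : associative sym_mul.
Proof. by move=> s t u; apply: sym_eq. Qed.
Lemma sym_mul1 : left_id sym_one sym_mul.
Proof. by move=> s; apply: sym_eq. Qed.
Lemma sym_mulr1 : right_id sym_one sym_mul.
Proof. by move=> s; apply: sym_eq. Qed.
Lemma sym_mulV : left_inverse sym_one sym_inv sym_mul.
Proof. by move=> s; apply: sym_eq => x /=; apply: sfunK. Qed.
Lemma sym_mulrV : right_inverse sym_one sym_inv sym_mul.
Proof. by move=> s; apply: sym_eq => x /=; apply: sbwdK. Qed.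

HB.instance Definition _ :=
  isGroup.Build (Sym T) sym_mulA sym_mul1 sym_mulr1 sym_mulV sym_mulrV.

Lemma symM s t x : (s * t) x = s (t x). Proof. by []. Qed.
Lemma sym1 x : (1 : Sym T) x = x. Proof. by []. Qed.

End SymGroup.

(** Homomorphisms from a subgroup are total functions that are multiplicative on it:
    domains can then be shrunk without changing the function. *)
Definition mult_on (G H : groupType) (A : set G) (f : G -> H) :=
  forall x y, A x -> A y -> f (x * y) = f x * f y.

Section MultOn.
Variables (G H : groupType) (A : subgroup G) (f : G -> H).
Hypothesis fM : mult_on A f.

Lemma mult_on1 : f 1 = 1.
Proof. by apply: (mulgI (f 1)); rewrite -fM ?mulg1 //; apply: sg1. Qed.

Lemma mult_onV x : A x -> f x^-1 = (f x)^-1.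
Proof.
move=> Ax; apply: (mulgI (f x)); rewrite -fM //; last exact: sgV.
by rewrite !mulgV mult_on1.
Qed.

Lemma mult_onF x y : A x -> A y -> f (x * y^-1) = f x * (f y)^-1.
Proof. by move=> Ax Ay; rewrite fM ?mult_onV //; apply: sgV. Qed.

Program Definition sgpreim (K : subgroup H) : subgroup G :=
  @Subgroup G [set x | A x /\ K (f x)] _ _.
Next Obligation. by split; rewrite ?mult_on1; apply: sg1. Qed.
Next Obligation. by move=> K x y [Ax Kx] [Ay Ky]; split; rewrite ?mult_onF //; apply: sgF. Qed.

Program Definition sgimage : subgroup H :=
  @Subgroup H [set f x | x in (A : set G)] _ _.
Next Obligation. by exists 1; [apply: sg1 | apply: mult_on1]. Qed.
Next Obligation. by move=> _ _ [x Ax <-] [y Ay <-]; exists (x * y^-1); [apply: sgF | apply: mult_onF]. Qed.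

Definition sgker := sgpreim (@Subgroup H [set 1] erefl
  (fun x y (e1 : x = 1) (e2 : y = 1) => etrans (congr2 (fun a b => a * b^-1) e1 e2) (mulgV 1))).

Lemma sgkerP x : sgker x <-> A x /\ f x = 1. Proof. by []. Qed.

End MultOn.

Lemma mult_on_sub (G H : groupType) (A B : set G) (f : G -> H) :
  B `<=` A -> mult_on A f -> mult_on B f.
Proof. by move=> BA fM x y /BA Ax /BA Ay; apply: fM. Qed.

Definition gens (G : groupType) (A : set G) (I : Type) (x : I -> G) :=
  forall K : subgroup G, (forall i, K (x i)) -> A `<=` K.

(** Freeness of a subgroup on a family. Uniqueness of the extension is
    replaced by generation, which is equivalent ([mult_on_eq]). *)
Record sbasis (G : groupType) (A : subgroup G) (I : Type) (x : I -> G) : Prop := SBasis {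
  sb_in : forall i, A (x i);
  sb_gen : gens A x;
  sb_ext : forall (H : groupType) (h : I -> H),
    exists2 f : G -> H, mult_on A f & forall i, f (x i) = h i
}.

Lemma mult_on_eq (G H : groupType) (A : subgroup G) (I : Type) (x : I -> G) (f g : G -> H) :
  gens A x -> (forall i, A (x i)) -> mult_on A f -> mult_on A g ->
  (forall i, f (x i) = g (x i)) -> forall a, A a -> f a = g a.
Proof.
move=> gx Ax fM gM e.
pose K := @Subgroup G [set a | A a /\ f a = g a].
have K1 : A 1 /\ f 1 = g 1 by rewrite (mult_on1 fM) (mult_on1 gM); split=> //; apply: sg1.
have KF a b : A a /\ f a = g a -> A b /\ f b = g b -> A (a * b^-1) /\ f (a * b^-1) = g (a * b^-1).
  move=> [Aa ea] [Ab eb]; split; first exact: sgF.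
  by rewrite (mult_onF fM) // (mult_onF gM) // ea eb.
by move=> a /(gx (K K1 KF)) [].
Qed.

(** Generation comes from uniqueness: the retraction of [F] onto a subgroup
    containing the basis extends the inclusion of the basis, as the identity does. *)
Lemma sbasis_free (F : groupType) (I : Type) (x : I -> F) :
  free_basis x -> sbasis sgtop x.
Proof.
move=> xb; split=> // [K Kx g _|H h]; last first.
  by have [f [fx _]] := xb H h; exists f => // a b _ _; apply: gmulfM.
pose y i : sgtype K := exist (fun a => a \in (K : set F)) (x i) (mem_set (Kx i)).
have [f [fx _]] := xb _ y.
have [f0 [_ f0u]] := xb F x.
pose p : {multiplicative sgtype K -> F} := val.
have e1 := f0u (p \o f : {multiplicative F -> F}).
have e2 := f0u (idfun : {multiplicative F -> F}).
have <- : val (f g) = g.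
  by rewrite -[RHS]/(idfun g) e2 // -e1 // => i /=; rewrite fx.
by have := valP (f g); rewrite inE.
Qed.

Section Words.
Variables (I : eqType).
Definition letter := (I * bool)%type.
Implicit Types (a b : letter) (w : seq letter).

Definition linv a : letter := (a.1, ~~ a.2).
Definition winv w := rev (map linv w).

Lemma linvK : involutive linv.
Proof. by case=> i e; rewrite /linv /= negbK. Qed.

Lemma linv_neq a : linv a != a.
Proof. by case: a => i [] ; apply/eqP; case. Qed.

Definition adm a w := if w is b :: _ then b != linv a else true.
Fixpoint reduced w := if w is a :: w' then adm a w' && reduced w' else true.

Lemma reduced_catE w w' : reduced (w ++ w') = [&& reduced w, reduced w' &
  if w is a :: v then adm (last a v) w' else true].
Proof.
elim: w => [|a w IH] /=; first by rewrite andbT.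
rewrite IH; case: w {IH} => [|b w] /=; first by rewrite andbT andbC.
by rewrite !andbA.
Qed.

Lemma reduced_inv w : reduced (winv w) = reduced w.
Proof.
elim: w => [|a w IH] //=.
rewrite /winv /= rev_cons -cats1 reduced_catE IH /= andbC.
case: w {IH} => [|b w] //=.
rewrite rev_cons; case E: (rcons _ _) => [|d v]; first by move: (congr1 size E); rewrite size_rcons.
have -> : last d v = linv b by rewrite -[LHS]/(last d (d :: v)) -E last_rcons.
by rewrite linvK eq_sym.
Qed.

Lemma reduced_drop k w : reduced w -> reduced (drop k w).
Proof. by rewrite -{1}[w](cat_take_drop k) reduced_catE => /and3P []. Qed.

Section Eval.
Variables (G : groupType) (x : I -> G).

Definition leval a := if a.2 then x a.1 else (x a.1)^-1.
Definition weval w := foldr (fun a g => leval a * g) 1 w.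

Lemma weval_cat w w' : weval (w ++ w') = weval w * weval w'.
Proof. by elim: w => [|a w IH] /=; rewrite ?mul1g // IH mulgA. Qed.

Lemma leval_inv a : leval (linv a) = (leval a)^-1.
Proof. by case: a => i [] //=; rewrite /leval /= invgK. Qed.

Lemma weval_inv w : weval (winv w) = (weval w)^-1.
Proof.
elim: w => [|a w IH]; first by rewrite invg1.
by rewrite /winv /= rev_cons -cats1 weval_cat IH /= mulg1 leval_inv invgM.
Qed.

Lemma weval_in (A : subgroup G) w : (forall i, A (x i)) -> A (weval w).
Proof.
move=> Ax; elim: w => [|a w IH]; first exact: sg1.
by apply: sgM IH; case: a => i []; rewrite /leval /= ?Ax //; apply: sgV.
Qed.

Lemma gens_weval (A : subgroup G) g : gens A x -> A g -> exists w, g = weval w.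
Proof.
move=> gx Ag; pose K := @Subgroup G [set g | exists w, g = weval w].
have K1 : exists w, 1 = weval w by exists [::].
have KF (a b : G) : (exists w, a = weval w) -> (exists w, b = weval w) -> exists w, a * b^-1 = weval w.
  by move=> [w ->] [v ->]; exists (w ++ winv v); rewrite weval_cat weval_inv.
by apply: (gx (K K1 KF)) => // i; exists [:: (i, true)]; rewrite /= mulg1.
Qed.

End Eval.

End Words.

(** * Normal forms *)

Section NormalForm.
Variables (G : groupType) (C : subgroup G) (I : eqType) (x : I -> G).
Hypothesis xb : sbasis C x.
Let Cx := sb_in xb.

Definition redword := {w : seq (letter I) | reduced w}.

Definition wpush (a : letter I) w := if w is b :: w' then
  if b == linv a then w' else a :: w else [:: a].

Lemma wpush_reduced a w : reduced w -> reduced (wpush a w).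
Proof.
case: w => [|b w] //= /andP [abw rw]; case: ifP => // /negbT nba /=.
by rewrite nba abw rw.
Qed.

Definition rpush a (w : redword) : redword :=
  exist _ (wpush a (val w)) (wpush_reduced a (valP w)).

Lemma rpushK a : cancel (rpush a) (rpush (linv a)).
Proof.
move=> w; apply: val_inj => /=; case: w => -[|b w] //= => [_|/andP [abw _]].
  by rewrite linvK eqxx.
case: ifP => [/eqP eb|nba] /=; last by rewrite linvK eqxx.
case: w abw => [_|d w /=]; first by rewrite -eb.
by rewrite eb !linvK => /negbTE ->.
Qed.

Lemma rpushVK a : cancel (rpush (linv a)) (rpush a).
Proof. by move=> w; rewrite -{1}[a]linvK rpushK. Qed.

Definition psym i : Sym redword := MkSym (@rpushK (i, true)) (@rpushVK (i, true)).

(** The action of the free group on reduced words, a letter acting by prefixing it and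
    cancelling if necessary. The normal form of [g] is the image of the empty word. *)
Definition nfact : G -> Sym redword := xget (fun=> 1)
  [set f | mult_on C f /\ forall i, f (x i) = psym i].

Lemma nfactP : mult_on C nfact /\ forall i, nfact (x i) = psym i.
Proof.
have [f fM fx] := sb_ext xb psym.
by rewrite /nfact; case: xgetP => [g _ []|/(_ f)] //; case.
Qed.

Definition rnil : redword := exist _ [::] isT.
Definition nf g : seq (letter I) := val (nfact g rnil).

Lemma nf_reduced g : reduced (nf g). Proof. exact: valP. Qed.

Lemma nfact_weval w r : val (nfact (weval x w) r) = foldr wpush (val r) w.
Proof.
have [fM fx] := nfactP.
elim: w => [|a w IH] /=; first by rewrite (mult_on1 fM).
have Ca : C (leval x a) by case: a => i []; rewrite /leval /= ?Cx //; apply/sgV/Cx.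
rewrite fM //; last exact: weval_in.
rewrite symM -IH; case: a {Ca} => i []; rewrite /leval /= ?fx // (mult_onV fM) ?fx //.
Qed.

Lemma nf_weval w : reduced w -> nf (weval x w) = w.
Proof.
rewrite /nf nfact_weval /=; elim: w => [|a w IH] //= /andP [aw rw]; rewrite IH //.
by case: w aw {IH rw} => [|b w] //= /negbTE ->.
Qed.

Lemma weval_wpush a w : weval x (wpush a w) = leval x a * weval x w.
Proof.
case: w => [|b w] //=; case: ifP => // /eqP ->.
by rewrite leval_inv mulgA mulgV mul1g.
Qed.

Lemma nfK g : C g -> weval x (nf g) = g.
Proof.
move=> Cg; have [w ->] := gens_weval (sb_gen xb) Cg.
by rewrite /nf nfact_weval /=; elim: w => //= a w IH; rewrite weval_wpush IH.
Qed.

Lemma weval_reduced_inj v w : reduced v -> reduced w -> weval x v = weval x w -> v = w.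
Proof. by move=> rv rw e; rewrite -(nf_weval rv) e nf_weval. Qed.

Lemma nf1 : nf 1 = [::]. Proof. exact: (@nf_weval [::]). Qed.

Lemma nfV g : C g -> nf g^-1 = winv (nf g).
Proof.
move=> Cg; rewrite -{1}(nfK Cg) -weval_inv nf_weval // reduced_inv.
exact: nf_reduced.
Qed.

End NormalForm.
(** * Bases of finite-index subgroups *)

Section Schreier.
Variables (G : groupType) (C A : subgroup G) (I Om : finType) (x : I -> G).
Variables (k : G -> Om) (t : Om -> G) (par : Om -> I * Om) (rk : Om -> nat).
Hypothesis xb : sbasis C x.
Hypothesis AC : (A : set G) `<=` C.
Hypothesis kP : forall g h, C g -> C h -> (k g = k h <-> A (g^-1 * h)).
Hypothesis tC : forall v, C (t v).
Hypothesis tK : forall v, k (t v) = v.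
Hypothesis t1 : t (k 1) = 1.

(** The Schreier graph: its vertices are the left cosets, labelled by [Om], with
    representatives [t]; the edge [(i, v)] goes from [v] to the coset of [x i * t v]. *)
Definition edge_end (e : I * Om) := k (x e.1 * t e.2).
Definition edge_elt (e : I * Om) := (t (edge_end e))^-1 * x e.1 * t e.2.

Hypothesis parP : forall v, v != k 1 ->
  (edge_end (par v) = v /\ t v = x (par v).1 * t (par v).2
     /\ (rk (par v).2 < rk v)%N) \/
  ((par v).2 = v /\ t v = (x (par v).1)^-1 * t (edge_end (par v))
     /\ (rk (edge_end (par v)) < rk v)%N).

(** [par v] is the edge joining [v] to its parent in a spanning tree; it may be
    oriented towards [v] or away from it. *)
Definition tree_edges : {set I * Om} := par @: [set v | v != k 1].
Definition cotree : finType := {e : I * Om | e \notin tree_edges}.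
Definition cotree_elt (e : cotree) : G := edge_elt (sval e).

Let Cx := sb_in xb.
Let gx := sb_gen xb.

Let kE g h : C g -> C h -> k g = k h -> A (g^-1 * h).
Proof. by move=> Cg Ch /kP; apply. Qed.

Let kM g v h : C g -> C h -> k h = v -> k (g * h) = k (g * t v).
Proof.
move=> Cg Ch e; apply/kP; [exact: sgM|exact: sgM|].
have -> : (g * h)^-1 * (g * t v) = h^-1 * t v by gsimp.
by apply/kP; rewrite ?tK.
Qed.

Lemma edge_elt_in e : A (edge_elt e).
Proof.
rewrite /edge_elt -mulgA; apply: kE; rewrite ?tK //.
exact: sgM.
Qed.

Lemma tree_edge1 e : e \in tree_edges -> edge_elt e = 1.
Proof.
case/imsetP => v; rewrite inE => /parP [[ev [tv _]]|[ev [tv _]]] ->; rewrite /edge_elt.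
  by rewrite ev tv; gsimp.
by rewrite ev tv; gsimp.
Qed.

(** The elements [g] for which all the [t v] can be moved across [g], up to the
    given subgroup [K], form a subgroup containing the [x i]. *)
Lemma schreier_gen : gens A cotree_elt.
Proof.
move=> K Ke.
have Kall e : K (edge_elt e).
  have [eT|eT] := boolP (e \in tree_edges); first by rewrite tree_edge1 //; apply: sg1.
  exact: (Ke (exist _ e eT)).
pose Rel g := forall v, K ((t (k (g * t v)))^-1 * g * t v).
have stp g v : C g -> A ((t (k (g * t v)))^-1 * g * t v).
  by move=> Cg; rewrite -mulgA; apply: kE; rewrite ?tK //; apply: sgM.
have R1 : C 1 /\ Rel 1.
  by split=> [|v]; [apply: sg1 | rewrite mul1g tK mulg1 mulVg; apply: sg1].
have RM g h : C g -> C h -> Rel g -> Rel h -> Rel (g * h).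
  move=> Cg Ch Rg Rh v; set u := k (h * t v).
  have -> : k (g * h * t v) = k (g * t u) by rewrite -mulgA; apply: kM => //; apply: sgM.
  by have := sgM (Rg u) (Rh v); rewrite -/u; gsimp.
have RV g : C g -> Rel g -> Rel g^-1.
  move=> Cg Rg v; have Cg' := sgV Cg; set u := k (g^-1 * t v).
  have := sgV (Rg u); have -> : k (g * t u) = v.
    by rewrite -[RHS]tK -(@kM g u (g^-1 * t v)) ?mulKVg //; apply: sgM.
  by gsimp.
pose L := @Subgroup G [set g | C g /\ Rel g].
have LF a b : C a /\ Rel a -> C b /\ Rel b -> C (a * b^-1) /\ Rel (a * b^-1).
  move=> [Ca Ra] [Cb Rb]; split; first exact: sgF.
  by apply: RM => //; [apply: sgV | apply: RV].
have Lall : (C : set G) `<=` (L R1 LF : set G).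
  apply: gx => i; split=> // v; exact: Kall (i, v).
move=> a Aa; have [_ /(_ (k 1))] := Lall a (AC Aa).
rewrite t1 !mulg1.
have -> : k a = k 1.
  apply/kP; rewrite ?mulg1; [exact: AC|exact: sg1|exact: sgV].
by rewrite t1 invg1 !mul1g.
Qed.

Section Extension.
Variables (H : groupType) (h : cotree -> H).

(** A function on the cotree is extended by [1] to the tree; the labels of edges
    define an action of the free group on [Om * H] commuting with right translations
    of [H]. The stabiliser of the base vertex then acts on the fibre through a homomorphism. *)
Definition edge_label (e : I * Om) : H := if insub e is Some e' then h e' else 1.

Let actx_fun i (p : Om * H) := (edge_end (i, p.1), edge_label (i, p.1) * p.2).

Lemma edge_end_inj i u v : edge_end (i, u) = edge_end (i, v) -> u = v.
Proof.
rewrite /edge_end /= => /kE e; rewrite -[u]tK -[v]tK; apply/kP => //.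
have := e (sgM (Cx i) (tC u)) (sgM (Cx i) (tC v)).
by gsimp.
Qed.

Let actx_bwd i (p : Om * H) : Om * H :=
  let u := k ((x i)^-1 * t p.1) in (u, (edge_label (i, u))^-1 * p.2).

Let end_bwd i v : edge_end (i, k ((x i)^-1 * t v)) = v.
Proof.
rewrite /edge_end /= -[RHS]tK -(@kM (x i) _ ((x i)^-1 * t v)) ?mulKVg //.
by apply: sgM => //; apply: sgV.
Qed.

Let actxK i : cancel (actx_fun i) (actx_bwd i).
Proof.
move=> [v y]; rewrite /actx_bwd /=.
have -> : k ((x i)^-1 * t (edge_end (i, v))) = v by apply: (@edge_end_inj i).
by rewrite mulKg.
Qed.

Let actxVK i : cancel (actx_bwd i) (actx_fun i).
Proof. by move=> [v y]; rewrite /actx_fun /= end_bwd mulKVg. Qed.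

Definition actx i : Sym (Om * H) := MkSym (@actxK i) (@actxVK i).

(** [c g v] is the translation between the fibres over [v] and [g * v] induced by [g].
    It is trivial for [g = t v] and the base vertex, since the path goes
    through the tree, so it sends a cotree element to the label of its edge. *)
Lemma schreier_ext : exists2 f : G -> H, mult_on A f & forall e, f (cotree_elt e) = h e.
Proof.
have [phi pM px] := sb_ext xb actx.
pose c g v := (phi g (v, 1)).2.
pose Rel g := forall v y, phi g (v, y) = (k (g * t v), c g v * y).
have R1 : C 1 /\ Rel 1.
  split=> [|v y]; first exact: sg1.
  by rewrite /c (mult_on1 pM) !sym1 /= !mul1g tK.
have RM a b : C a -> C b -> Rel a -> Rel b -> Rel (a * b).
  move=> Ca Cb Ra Rb v y; pose u := k (b * t v).
  have E z : phi (a * b) (v, z) = (k (a * b * t v), c a u * c b v * z).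
    rewrite pM // symM Rb Ra -!mulgA (@kM a u (b * t v)) //.
    exact: sgM.
  by rewrite {1}/c !E /= mulg1.
have RV a : C a -> Rel a -> Rel a^-1.
  move=> Ca Ra v y; have Ca' := sgV Ca; set u := k (a^-1 * t v).
  have ev : k (a * t u) = v.
    by rewrite -[RHS]tK -(@kM a u (a^-1 * t v)) ?mulKVg //; apply: sgM.
  have E z : phi a^-1 (v, z) = (u, (c a u)^-1 * z).
    rewrite (mult_onV pM) // -[(v, z)](_ : phi a (u, (c a u)^-1 * z) = _).
      exact: sfunK.
    by rewrite Ra ev mulKVg.
  by rewrite /c !E /= mulg1.
pose L := @Subgroup G [set g | C g /\ Rel g].
have LF a b : C a /\ Rel a -> C b /\ Rel b -> C (a * b^-1) /\ Rel (a * b^-1).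
  move=> [Ca Ra] [Cb Rb]; split; first exact: sgF.
  by apply: RM => //; [apply: sgV | apply: RV].
have Lall g : C g -> Rel g.
  move=> Cg; suff /(_ g Cg) [] : (C : set G) `<=` (L R1 LF : set G) by [].
  by apply: gx => i; split=> // v y; rewrite /c px /= mulg1.
have cM a b v : C a -> C b -> c (a * b) v = c a (k (b * t v)) * c b v.
  by move=> Ca Cb; rewrite {1}/c pM // symM !Lall //= mulg1.
have c1 v : c 1 v = 1 by rewrite /c (mult_on1 pM).
have cx i v : c (x i) v = edge_label (i, v) by rewrite /c px /= mulg1.
have lab1 e : e \in tree_edges -> edge_label e = 1.
  by rewrite /edge_label => eT; rewrite insubF // eT.
have ct v : c (t v) (k 1) = 1.
  have [n] := ubnP (rk v); elim: n v => // n IH v rv.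
  have [->|nv] := eqVneq v (k 1); first by rewrite t1 c1.
  have pT : par v \in tree_edges by apply/imsetP; exists v; rewrite ?inE.
  have t1g g : g * t (k 1) = g by rewrite t1 mulg1.
  case: (parP nv) => [[_ [-> lr]]|[e2 [tv lr]]].
    rewrite cM // IH ?(leq_trans lr) // t1g tK cx mulg1 -surjective_pairing; exact: lab1.
  rewrite tv cM //; last exact: sgV.
  rewrite IH ?(leq_trans lr) // mulg1 t1g tK.
  have Cp := Cx (par v).1.
  have := c1 (par v).2; rewrite -{1}(mulVg (x (par v).1)) cM //; last exact: sgV.
  rewrite cx -surjective_pairing (lab1 _ pT) mulg1.
  by rewrite -[k (_ * _)]/(edge_end (_, _)) -surjective_pairing.
exists (fun a => c a (k 1)).
  move=> a b Aa Ab; rewrite cM; try exact: AC.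
  rewrite t1 mulg1; suff -> : k b = k 1 by [].
  apply/kP; [exact: AC|exact: sg1|by rewrite mulg1; apply: sgV].
move=> e; rewrite /cotree_elt /edge_elt; set i := (sval e).1; set v := (sval e).2.
have Ct := tC (edge_end (sval e)).
rewrite !cM //; try by [apply: sgV|apply: sgM => //; apply: sgV].
rewrite t1 mulg1 tK cx ct mulg1 -[k (x i * t v)]/(edge_end (sval e)).
have := c1 (k 1); rewrite -{1}(mulVg (t (edge_end (sval e)))) cM //; last exact: sgV.
rewrite t1 mulg1 tK ct mulg1 => ->; rewrite mul1g -surjective_pairing /edge_label.
by case: insubP => [e' _ /val_inj -> //|]; rewrite (svalP e).
Qed.

End Extension.

Lemma schreier : sbasis A cotree_elt.
Proof.
split=> [e||H h]; [exact: edge_elt_in|exact: schreier_gen|exact: schreier_ext].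
Qed.

(** Each vertex other than the base contributes at most one tree edge. *)
Lemma card_cotree : (#|I| * #|Om| <= #|{: cotree}| + #|Om|.-1)%N.
Proof.
rewrite card_sig -card_prod -(cardC (mem tree_edges)) addnC leq_add //.
apply: leq_trans (leq_imset_card _ _) _.
by rewrite -(cardC1 (k 1)) subset_leq_card //; apply/fintype.subsetP => v; rewrite !inE.
Qed.

End Schreier.

(** A function separating cosets can be replaced by one that is constant on them,
    by evaluating it at chosen representatives. *)
Lemma coset_label (G : groupType) (C A : subgroup G) (T : Type) (f : G -> T) :
  (A : set G) `<=` C -> (forall g h, C g -> C h -> f g = f h -> A (g^-1 * h)) ->
  exists k : G -> T, forall g h, C g -> C h -> (k g = k h <-> A (g^-1 * h)).
Proof.
move=> AC fP; pose S g := [set h | C h /\ A (g^-1 * h)].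
pose rep g := xget 1 (S g).
have repP g : C g -> S g (rep g).
  by move=> Cg; apply: xgetPex; exists g; split=> //; rewrite mulVg; apply: sg1.
exists (f \o rep) => g h Cg Ch; have [Crg Ag] := repP g Cg; have [Crh Ah] := repP h Ch.
split=> [/= /(fP _ _ Crg Crh) Agh|Agh].
  by have := sgM (sgM Ag Agh) (sgV Ah); gsimp.
congr (f (xget 1 _)); apply/seteqP; split=> z [Cz Az]; split=> //.
  by have := sgM (sgV Agh) Az; gsimp.
by have := sgM Agh Az; gsimp.
Qed.

Section SchreierTree.
Variables (G : groupType) (C A : subgroup G) (I Om : finType) (x : I -> G).
Variables (k : G -> Om) (i0 : I).
Hypothesis xb : sbasis C x.
Hypothesis AC : (A : set G) `<=` C.
Hypothesis kP : forall g h, C g -> C h -> (k g = k h <-> A (g^-1 * h)).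
Hypothesis k_surj : forall v, exists2 g, C g & k g = v.

Let Cw w : C (weval x w). Proof. exact/weval_in/(sb_in xb). Qed.

Let Cl a : C (leval x a).
Proof. by have := Cw [:: a]; rewrite /= mulg1. Qed.

Let kM a g h : C g -> C h -> k g = k h -> k (leval x a * g) = k (leval x a * h).
Proof.
move=> Cg Ch /kP e; apply/kP; [exact: sgM|exact: sgM|].
have -> : (leval x a * g)^-1 * (leval x a * h) = g^-1 * h by gsimp.
exact: e.
Qed.

Let reach v n := `[< exists2 w : seq (letter I), size w = n & k (weval x w) = v >].

Let reachP v : exists n, reach v n.
Proof.
have [g Cg <-] := k_surj v; have [w ->] := gens_weval (sb_gen xb) Cg.
by exists (size w); apply/asboolP; exists w.
Qed.

Let dist v := ex_minn (reachP v).

Let dist_le w : (dist (k (weval x w)) <= size w)%N.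
Proof. by rewrite /dist; case: ex_minnP => n _; apply; apply/asboolP; exists w. Qed.

Let dist_word v : exists2 w, size w = dist v & k (weval x w) = v.
Proof. by rewrite /dist; case: ex_minnP => n /asboolP. Qed.

Let dist_step v : exists p : letter I * Om, v != k 1 ->
  dist v = (dist p.2).+1 /\ forall g, C g -> k g = p.2 -> k (leval x p.1 * g) = v.
Proof.
have [w sw kw] := dist_word v; case: w sw kw => [|a w] /= sw kw.
  by exists ((i0, true), v); rewrite -kw eqxx.
exists (a, k (weval x w)) => _ /=; split; last first.
  by move=> g Cg e; rewrite -kw; apply: kM.
apply/eqP; rewrite eqn_leq -{2}sw ltnS dist_le andbT.
have [w' sw' kw'] := dist_word (k (weval x w)).
by have := dist_le (a :: w'); rewrite /= (kM a (Cw w') (Cw w) kw') kw sw'.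
Qed.

(** Breadth-first search: the distance of a coset is the least length of a word
    reaching it, and removing the first letter of such a word gives the parent. *)
Lemma schreier_tree : exists (t : Om -> G) (par : Om -> I * Om) (rk : Om -> nat),
  [/\ forall v, C (t v), forall v, k (t v) = v, t (k 1) = 1 &
  forall v, v != k 1 ->
  (edge_end x k t (par v) = v /\ t v = x (par v).1 * t (par v).2
     /\ (rk (par v).2 < rk v)%N) \/
  ((par v).2 = v /\ t v = (x (par v).1)^-1 * t (edge_end x k t (par v))
     /\ (rk (edge_end x k t (par v)) < rk v)%N)].
Proof.
have [p pP] := choice dist_step.
pose T := fix T n v {struct n} := if n is n'.+1 then leval x (p v).1 * T n' (p v).2 else 1.
pose t v := T (dist v) v.
have d1 : dist (k 1) = 0%N by apply/eqP; rewrite -leqn0; exact: (dist_le [::]).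
have t1 : t (k 1) = 1 by rewrite /t d1.
have tE v : v != k 1 -> t v = leval x (p v).1 * t (p v).2.
  by move=> /pP [dv _]; rewrite /t dv.
have tP v : C (t v) /\ k (t v) = v.
  have [n] := ubnP (dist v); elim: n v => // n IH v dv.
  have [->|nv] := eqVneq v (k 1); first by rewrite t1; split=> //; apply: sg1.
  have [dvE kv] := pP v nv; rewrite tE //.
  have [Cu ku] : C (t (p v).2) /\ k (t (p v).2) = (p v).2 by apply: IH; rewrite -ltnS -dvE.
  by split; [apply: sgM | apply: kv].
exists t, (fun v => ((p v).1.1, if (p v).1.2 then (p v).2 else v)), dist.
split=> // [v|v|v nv]; [exact: (tP v).1|exact: (tP v).2|].
have [dv kv] := pP v nv; have [Cu ku] := tP (p v).2; have [Cv kv'] := tP v.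
rewrite /edge_end /=; have := tE v nv; have := kv _ Cu ku.
case: (p v) dv Cu ku kv => [[i []] u] /= dv Cu ku kv kv2 tv.
  by left; rewrite dv.
by right; rewrite tv /leval /= mulVKg ku dv.
Qed.

End SchreierTree.

(** Nielsen--Schreier for finite index, with the part of the rank formula that
    is used: passing to a proper subgroup strictly increases the rank. *)
Lemma finite_index_basis (G : groupType) (C A : subgroup G) (I : finType) (x : I -> G) :
  sbasis C x -> (A : set G) `<=` C -> finite_index A -> (1 < #|I|)%N ->
  exists (J : finType) (y : J -> G), [/\ sbasis A y, (#|I| <= #|J|)%N &
    (exists2 g, C g & ~ A g) -> (#|I| < #|J|)%N].
Proof.
move=> xb AC /finite_indexP [T [f fP]] I2.
have [k kP] := coset_label AC (fun g h _ _ => @fP g h).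
pose Om : finType := {v : T | `[< exists2 g, C g & k g = v >]}.
have kC g : C g -> `[< exists2 h, C h & k h = k g >] by move=> Cg; apply/asboolP; exists g.
pose k' g : Om := insubd (exist _ (k 1) (kC 1 (sg1 C)) : Om) (k g).
have k'E g : C g -> val (k' g) = k g by move=> Cg; rewrite val_insubd (kC g Cg).
have k'P g h : C g -> C h -> (k' g = k' h <-> A (g^-1 * h)).
  move=> Cg Ch; rewrite -kP //; split=> [e|e]; first by rewrite -!k'E // e.
  by apply: val_inj; rewrite !k'E.
have k's v : exists2 g, C g & k' g = v.
  by have /asboolP [g Cg kg] := valP v; exists g => //; apply: val_inj; rewrite k'E.
have i0 : I by case: (pickP (mem I)) => // I0; rewrite eq_card0 in I2.
have [t [par [rk [tC tK t1 tP]]]] := schreier_tree i0 xb k'P k's.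
exists (cotree k' par), (@cotree_elt _ _ _ x k' t par).
have cc := card_cotree k' par.
have Om1 : (0 < #|Om|)%N by apply/card_gt0P; exists (k' 1).
split; first exact: (schreier xb AC k'P tC tK t1 tP).
  by nia.
case=> g Cg nAg; suff : (1 < #|Om|)%N by nia.
apply/card_gt1P; exists (k' 1), (k' g); split=> //.
apply/eqP => /k'P; rewrite invg1 mul1g => /(_ (sg1 C) Cg) //.
Qed.
Lemma finite_index_trans (G : groupType) (H A : subgroup G) (T : finType) (f : G -> T) :
  finite_index H -> (forall g h, H g -> H h -> f g = f h -> A (g^-1 * h)) ->
  finite_index A.
Proof.
move=> /finite_indexP [U [b bP]] fP.
pose r u := xget 1 [set x | b x = u].
have br x : b (r (b x)) = b x.
  by rewrite /r; case: xgetP => [y _ //|/(_ x)]; rewrite /= => /(_ erefl).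
apply/finite_indexP; exists (U * T)%type, (fun x => (b x, f ((r (b x))^-1 * x))).
move=> g h [e]; have Hg := bP _ _ (br g); have Hh := bP _ _ (br h).
move=> /(fP _ _ Hg Hh); rewrite -e; gsimp; exact.
Qed.

(** The kernel of the map to a group of order two that sends [x t] to the generator
    and the other [x i] to [1], with tree consisting of the edge [(t, false)]. The
    edges [(i, false)] and [(i, true)] are named [jl i] and [jr i]; the value
    of [jl] at [t] is arbitrary. *)
Lemma index_two_basis (G : groupType) (C : subgroup G) (I : finType) (x : I -> G) (t : I) :
  sbasis C x -> exists (D : subgroup G) (J : finType) (b : J -> G) (jl jr : I -> J),
  [/\ sbasis D b, (D : set G) `<=` C & ~ D (x t)] /\
  (exists k : G -> bool, forall g h, C g -> C h -> k g = k h -> D (g^-1 * h)) /\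
  [/\ forall i, i != t -> b (jl i) = x i,
      forall i, i != t -> b (jr i) = (x t)^-1 * x i * x t,
      b (jr t) = x t * x t &
      [/\ forall i i', i != t -> i' != t -> jl i = jl i' -> i = i', injective jr, forall i i', i != t -> jl i != jr i' &
          forall j, (exists2 i, i != t & j = jl i) \/ (exists i, j = jr i)]].
Proof.
move=> xb; have Cx := sb_in xb.
pose s2 : Sym bool := MkSym negbK negbK.
have [f fM fx] := sb_ext xb (fun i => if i == t then s2 else 1).
pose k g := f g false.
have kE g b : C g -> f g b = b (+) k g.
  move=> Cg; have : f g (~~ false) != f g false.
    by rewrite (inj_eq (can_inj (sfunK (f g)))).
  by rewrite /k; case: b => /=; case: (f g true); case: (f g false).
have kM g h : C g -> C h -> k (g * h) = k g (+) k h.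
  by move=> Cg Ch; rewrite /k fM // symM kE // addbC.
have k1 : k 1 = false by rewrite /k (mult_on1 fM).
have kV g : C g -> k g^-1 = k g.
  move=> Cg; have := kM _ _ (sgV Cg) Cg; rewrite mulVg k1.
  by case: (k _^-1); case: (k g).
pose D0 := @Subgroup G [set g | C g /\ k g = false].
have D1 : C 1 /\ k 1 = false by split=> //; apply: sg1.
have DF g h : C g /\ k g = false -> C h /\ k h = false -> C (g * h^-1) /\ k (g * h^-1) = false.
  move=> [Cg kg] [Ch kh]; split; first exact: sgF.
  by rewrite kM ?kV ?kg ?kh //; apply: sgV.
pose D := D0 D1 DF.
have DC : (D : set G) `<=` C by move=> g [].
have kP g h : C g -> C h -> (k g = k h <-> D (g^-1 * h)).
  move=> Cg Ch; split=> [e|[_]].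
    split; first by apply: sgM => //; apply: sgV.
    by rewrite kM ?kV ?e ?addbb //; apply: sgV.
  by rewrite kM ?kV //; [case: (k g); case: (k h) | apply: sgV].
have kx i : k (x i) = (i == t) by rewrite /k fx; case: ifP.
pose tr b := if b then x t else 1.
pose par (v : bool) := (t, false).
have tC b : C (tr b) by case: b => //=; apply: sg1.
have tK b : k (tr b) = b by case: b => //=; rewrite kx eqxx.
have t1 : tr (k 1) = 1 by rewrite k1.
have tP v : v != k 1 -> (edge_end x k tr (par v) = v /\ tr v = x (par v).1 * tr (par v).2
     /\ (nat_of_bool (par v).2 < nat_of_bool v)%N) \/
  ((par v).2 = v /\ tr v = (x (par v).1)^-1 * tr (edge_end x k tr (par v))
     /\ (nat_of_bool (edge_end x k tr (par v)) < nat_of_bool v)%N).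
  by rewrite k1 => /negbTE; case: v => //= _; left; rewrite /edge_end /= mulg1 kx eqxx.
have Db := schreier xb DC kP tC tK t1 tP.
have teE e : (e \in tree_edges k par) = (e == (t, false)).
  apply/imsetP/eqP => [[v _ ->] //|->]; exists true => //.
  by rewrite inE k1.
have nt i b : ((i, b) \notin tree_edges k par) = (i != t) || b.
  by rewrite teE xpair_eqE negb_and; case: b; rewrite ?orbT.
have jt : (t, true) \notin tree_edges k par by rewrite nt orbT.
pose J := cotree k par; pose jt' : J := exist _ (t, true) jt.
have JP (i : I) : (i, true) \notin tree_edges k par by rewrite nt orbT.
pose jr i : J := exist _ (i, true) (JP i).
have [jl jlP] : exists jl : I -> J, forall i, i != t -> sval (jl i) = (i, false).
  exists (fun i => if insub (i, false) is Some e then e else jt') => i it.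
  by case: insubP => [e _ //|]; rewrite nt it.
exists D, J, (@cotree_elt _ _ _ x k tr par), jl, jr; split; first split=> //.
  by move=> [_]; rewrite kx eqxx.
split; first by exists k => g h Cg Ch /kP; apply.
rewrite /cotree_elt /edge_elt /edge_end; split; last split.
- move=> i it; rewrite jlP //= !mulg1 kx (negbTE it) invg1 mul1g //.
- by move=> i it; rewrite /= kM // !kx eqxx (negbTE it).
- by rewrite /= kM // !kx eqxx invg1 mul1g.
- by move=> i i' it it' /(congr1 sval); rewrite !jlP // => -[].
- by move=> i i' [].
- by move=> i i' it; apply/eqP => /(congr1 sval); rewrite jlP.
- move=> j; case E: (sval j) => [i [|]]; last first.
    have := svalP j; rewrite E nt orbF => it; left; exists i => //.
    by apply: val_inj => /=; rewrite jlP.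
  by right; exists i; apply: val_inj.
Qed.

(** One value at a time, correcting by a transposition that fixes the previous ones. *)
Lemma perm_extend (Om : finType) (J : eqType) (s : seq J) (a b : J -> Om) :
  uniq s -> {in s &, injective a} -> {in s &, injective b} ->
  exists p : {perm Om}, forall j, j \in s -> p (a j) = b j.
Proof.
elim: s => [|j s IH] /=; first by exists (1 : {perm Om}).
case/andP=> js us aI bI.
have sub i : i \in s -> i \in j :: s by rewrite inE orbC => ->.
have [||p pP] := IH us.
- by move=> i i' /sub si /sub si'; apply: aI.
- by move=> i i' /sub si /sub si'; apply: bI.
exists (p * tperm (p (a j)) (b j))%g => i; rewrite inE permM => /orP [/eqP ->|si].
  by rewrite tpermL.
have ij : i != j by apply: contraNneq js => <-.
rewrite tpermD; [exact: pP| |]; apply: contraNneq ij.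
  by move/perm_inj/aI => -> //; rewrite !inE ?eqxx ?si ?orbT.
by rewrite pP // => /bI -> //; rewrite !inE ?eqxx ?si ?orbT.
Qed.

Section MarshallHall.
Variables (G : groupType) (C : subgroup G) (I : finType) (x : I -> G).
Hypothesis xb : sbasis C x.
Variables (n : nat) (b : 'I_n.+1 -> letter I).
Hypothesis b_cyc : forall j, b (ordS j) != linv (b j).

Fixpoint cycword m : G := if m is m'.+1 then leval x (b (inord m')) * cycword m' else 1.

(** The letters of a cyclically reduced word move the points of a cycle of length [n.+1]
    one step forward; absence of cancellation makes these partial maps injective,
    so that each basis element acts by a permutation. In the stabiliser of a
    point, with the path of the first [n] steps as tree, the last step
    contributes the whole word or its inverse. *)
Lemma cyclic_word_primitive : exists (A : subgroup G) (J : finType) (y : J -> G) (j : J),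
  [/\ sbasis A y, (A : set G) `<=` C,
   exists k : G -> 'I_n.+1, forall g h, C g -> C h -> k g = k h -> A (g^-1 * h) &
   y j = cycword n.+1 \/ y j = (cycword n.+1)^-1].
Proof.
have Cx := sb_in xb.
pose src j := if (b j).2 then j else ordS j.
pose dst j := if (b j).2 then ordS j else j.
have inv_cyc j j' : b j = linv (b j') -> j <> ordS j'.
  by move=> e e'; have := b_cyc j'; rewrite -e' e eqxx.
have [s sP] : exists s : I -> {perm 'I_n.+1}, forall j, s (b j).1 (src j) = dst j.
  suff /choice [s sP] : forall i, exists s : {perm 'I_n.+1},
      forall j, (b j).1 = i -> s (src j) = dst j.
    by exists s => j; apply: sP.
  move=> i; pose l := [seq j <- enum 'I_n.+1 | (b j).1 == i].
  have lP j : (j \in l) = ((b j).1 == i) by rewrite mem_filter mem_enum andbT.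
  have [|||p pP] := @perm_extend 'I_n.+1 _ l src dst; last first.
  - by exists p => j e; apply: pP; rewrite lP e.
  - move=> j j'; rewrite !lP => /eqP bj /eqP bj'; rewrite /dst.
    case E: (b j) bj => [i1 e] /= bj; case E': (b j') bj' => [i2 e'] /= bj'; subst i1 i2.
    case: e E; case: e' E' => E' E //.
    + exact: (can_inj (@ordSK _)).
    + by move/esym/inv_cyc => []; rewrite E E'.
    + by move/inv_cyc => []; rewrite E E'.
  - move=> j j'; rewrite !lP => /eqP bj /eqP bj'; rewrite /src.
    case E: (b j) bj => [i1 e] /= bj; case E': (b j') bj' => [i2 e'] /= bj'; subst i1 i2.
    case: e E; case: e' E' => E' E //.
    + by move/inv_cyc => []; rewrite E E'.
    + by move/esym/inv_cyc => []; rewrite E E'.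
    + exact: (can_inj (@ordSK _)).
  - exact/filter_uniq/enum_uniq.
pose sS i : Sym 'I_n.+1 := MkSym (permK (s i)) (permKV (s i)).
have [f fM fx] := sb_ext xb sS.
pose k g := f g ord0.
pose A0 := @Subgroup G [set g | C g /\ k g = ord0].
have A1 : C 1 /\ k 1 = ord0 by rewrite /k (mult_on1 fM); split=> //; apply: sg1.
have kV g : C g -> k g = ord0 -> k g^-1 = ord0.
  by move=> Cg kg; rewrite /k (mult_onV fM) // -[in LHS]kg; apply: sfunK.
have AF g h : C g /\ k g = ord0 -> C h /\ k h = ord0 -> C (g * h^-1) /\ k (g * h^-1) = ord0.
  move=> [Cg kg] [Ch kh]; have Ch' := sgV Ch; split; first exact: sgF.
  by rewrite /k fM // symM -/(k _) kV.
pose A := A0 A1 AF.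
have AC : (A : set G) `<=` C by move=> g [].
have kP g h : C g -> C h -> (k g = k h <-> A (g^-1 * h)).
  move=> Cg Ch; have Cg' := sgV Cg.
  have E : k (g^-1 * h) = f g^-1 (k h) by rewrite /k fM // symM.
  split=> [e|[_]].
    split; first exact: sgM.
    by rewrite E -e /k (mult_onV fM) //; apply: sfunK.
  rewrite E (mult_onV fM) // => e.
  by rewrite -[LHS]/(f g ord0) -e; apply: sbwdK.
have fb j : f (leval x (b j)) j = ordS j.
  have := sP j; rewrite /src /dst /leval; case: (b j) => i [] /= e.
    by rewrite fx.
  by rewrite (mult_onV fM) // fx -[in LHS]e; apply: (sfunK (sS i)).
have Cl a : C (leval x a) by case: a => i []; rewrite /leval /= ?Cx //; apply/sgV/Cx.
have Ct m : C (cycword m) by elim: m => [|m IH]; [apply: sg1 | apply: sgM].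
pose t (j : 'I_n.+1) := cycword j.
have tK j : k (t j) = j.
  apply: val_inj; rewrite /t; case: j => /= m; elim: m => [|m IH] mn.
    by rewrite /k (mult_on1 fM).
  rewrite /= /k fM // symM -/(k _).
  have -> : k (cycword m) = inord m.
    by apply: val_inj; rewrite [LHS](IH (ltnW mn)) /= inordK // ltnW.
  by rewrite fb /= inordK ?modn_small // ltnW.
have k1 : k 1 = ord0 by rewrite /k (mult_on1 fM).
have t1 : t (k 1) = 1 by rewrite k1.
pose edge j : I * 'I_n.+1 := ((b j).1, src j).
pose par v := edge (ord_pred v).
have edge_to j : edge_end x k t (edge j) = dst j.
  by rewrite /edge_end /= /k fM //; [rewrite symM -/(k _) tK fx; apply: sP|apply: Ct].
have parP v : v != k 1 -> (edge_end x k t (par v) = v /\ t v = x (par v).1 * t (par v).2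
     /\ ((par v).2 < v)%N) \/
  ((par v).2 = v /\ t v = (x (par v).1)^-1 * t (edge_end x k t (par v))
     /\ (edge_end x k t (par v) < v)%N).
  rewrite k1 => v0; pose u := ord_pred v.
  have uv : ordS u = v by rewrite /u ord_predK.
  have vu : (v : nat) = u.+1.
    have v1 : (0 < v)%N by rewrite lt0n; apply: contraNneq v0 => e; apply/eqP/val_inj.
    rewrite /u /=; case: (v) v1 => -[|m] //= mn _.
    by rewrite ?addSn /= modnDr modn_small // ltnW.
  rewrite edge_to /par -/u; clearbody u.
  have tv : t v = leval x (b u) * t u by rewrite /t vu /= inord_val.
  rewrite /edge /=; rewrite /leval in tv.
  rewrite /src /dst uv; case: (b u) tv => i [] /= tv; [left|right];
    by rewrite tv vu ltnS.
exists A, (cotree k par), (@cotree_elt _ _ _ x k t par).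
have eN : edge ord_max \notin tree_edges k par.
  apply/imsetP => -[v]; rewrite inE k1 => v0.
  have : ordS (ord_pred v) = v by rewrite ord_predK.
  rewrite /par; move: (ord_pred v) => u uv [eb es].
  have nu : u != ord_max.
    by apply: contraNneq v0 => eu; rewrite -uv eu; apply/eqP/val_inj; rewrite /= modnn.
  move: es; rewrite /src; case E: (b ord_max) eb => [i e]; case E': (b u) => [i' e'] /= ei.
  subst i'; case: e E; case: e' E' => E' E.
  - by move/esym/eqP; rewrite (negbTE nu).
  - by move/inv_cyc => []; rewrite E E'.
  - by move/esym/inv_cyc => []; rewrite E E'.
  - by move/(can_inj (@ordSK _))/esym/eqP; rewrite (negbTE nu).
exists (exist (fun e => e \notin tree_edges k par) (edge ord_max) eN); split=> //; first exact: (schreier xb AC kP Ct tK t1 parP).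
  by exists k => g h Cg Ch /kP; apply.
have oS : ordS (@ord_max n) = ord0 by apply: val_inj; rewrite /= modnn.
have im : inord n = @ord_max n by apply: val_inj; rewrite /= inordK.
rewrite /cotree_elt /edge_elt /= edge_to /src /dst im oS /leval /t.
case: (b _) => i [] /=; [left|right]; rewrite ?invg1 ?mul1g ?mulg1 // invgM invgK //.
Qed.

End MarshallHall.
(** * Nielsen moves *)

Section Moves.
Variables (G : groupType) (I : eqType).
Implicit Types (u v w : I -> G) (i j : I).

Definition upd u i (g : G) : I -> G := fun k => if k == i then g else u k.

(** Only right multiplications and inversions are primitive; left multiplications and
    permutations are derived from them. *)
Inductive nielsen u : (I -> G) -> Prop :=
| nl_refl : nielsen u u
| nl_mul v i j : i != j -> nielsen u v -> nielsen u (upd v i (v i * v j))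
| nl_inv v i : nielsen u v -> nielsen u (upd v i (v i)^-1).

Lemma nl_trans u v w : nielsen u v -> nielsen v w -> nielsen u w.
Proof. by move=> uv; elim=> // *; [apply: nl_mul|apply: nl_inv]. Qed.

Lemma nl_inv1 u i : nielsen u (upd u i (u i)^-1).
Proof. exact/nl_inv/nl_refl. Qed.

Lemma nl_mul1 u i j : i != j -> nielsen u (upd u i (u i * u j)).
Proof. by move=> ij; apply: nl_mul ij (nl_refl _). Qed.

Lemma nl_eq u v w : nielsen u v -> v =1 w -> nielsen u w.
Proof. by move=> uv /funext <-. Qed.

Lemma nl_mulV u i j : i != j -> nielsen u (upd u i (u i * (u j)^-1)).
Proof.
move=> ij; apply: nl_eq (nl_inv j (nl_mul ij (nl_inv1 u j))) _ => k.
have ji : (j == i) = false by rewrite eq_sym (negbTE ij).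
rewrite /upd !eqxx ?(negbTE ij) ji invgK.
by have [->|] := eqVneq k j; rewrite ?ji.
Qed.

Lemma nl_sym u v : nielsen u v -> nielsen v u.
Proof.
elim=> [|{}v i j ij _ vu|{}v i _ vu]; first exact: nl_refl.
  apply: nl_trans vu; apply: nl_eq (nl_mulV _ ij) _ => k.
  rewrite /upd eqxx [j == i]eq_sym (negbTE ij) mulgK.
  by case: eqP => [->|].
apply: nl_trans vu; apply: nl_eq (nl_inv1 _ i) _ => k.
by rewrite /upd eqxx invgK; case: eqP => [->|].
Qed.

Lemma nl_lmul u i j : i != j -> nielsen u (upd u i (u j * u i)).
Proof.
move=> ij; have ji : (j == i) = false by rewrite eq_sym (negbTE ij).
apply: nl_eq (nl_inv i (nl_trans (nl_inv1 u i) (nl_mulV _ ij))) _ => k.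
by rewrite /upd !eqxx ji invgM !invgK; case: eqP.
Qed.

Lemma nl_lmulV u i j : i != j -> nielsen u (upd u i ((u j)^-1 * u i)).
Proof.
move=> ij; have ji : (j == i) = false by rewrite eq_sym (negbTE ij).
apply: nl_eq (nl_inv i (nl_trans (nl_inv1 u i) (nl_mul1 _ ij))) _ => k.
by rewrite /upd !eqxx ji invgM !invgK; case: eqP.
Qed.

Lemma nl_swap u i j : i != j -> nielsen u (upd (upd u i (u j)) j (u i)).
Proof.
move=> ij; have ji : (j == i) = false by rewrite eq_sym (negbTE ij).
have ji' : j != i by rewrite ji.
apply: nl_eq (nl_inv j (nl_trans (nl_trans (nl_mul1 u ij) (nl_mulV _ ji')) (nl_lmul _ ij))) _ => k.
rewrite /upd !eqxx ji (negbTE ij).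
have [_|kj] := eqVneq k j; first by gsimp.
by case: eqP => // _; gsimp.
Qed.

(** The form needed for Nielsen reduction, where entries are considered up to inversion. *)
Lemma nl_letter u (a b : letter I) : a.1 != b.1 -> exists v,
  [/\ nielsen u v, forall k, k != b.1 -> v k = u k &
      leval v b = (leval u a)^-1 * leval u b].
Proof.
case: a b => i e [j d] /= ij; have ji : j != i by rewrite eq_sym.
rewrite /leval /=; case: d; case: e.
- exists (upd u j ((u i)^-1 * u j)); split; [exact: nl_lmulV|move=> k /negbTE kj|];
    by rewrite /upd ?kj ?eqxx.
- exists (upd u j (u i * u j)); split; [exact: nl_lmul|move=> k /negbTE kj|];
    by rewrite /upd ?kj ?eqxx ?invgK.
- exists (upd u j (u j * u i)); split; [exact: nl_mul1|move=> k /negbTE kj|];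
    by rewrite /upd ?kj ?eqxx ?invgM.
- exists (upd u j (u j * (u i)^-1)); split; [exact: nl_mulV|move=> k /negbTE kj|];
    by rewrite /upd ?kj ?eqxx ?invgM.
Qed.

Lemma nl_signs u (e : I -> bool) (s : seq I) : uniq s ->
  nielsen u (fun i => if (i \in s) && e i then (u i)^-1 else u i).
Proof.
elim: s => [|i s IH] /=; first by move=> _; apply: nl_eq (nl_refl u) _ => i.
case/andP=> /negbTE si /IH {}IH; case E: (e i); last first.
  apply: nl_eq IH _ => k; rewrite inE; have [->|] //= := eqVneq k i.
  by rewrite E andbF.
apply: nl_eq (nl_inv i IH) _ => k; rewrite /upd si inE.
by have [->|] //= := eqVneq k i; rewrite E.
Qed.

Lemma nl_in (A : subgroup G) u v : (forall i, A (u i)) -> nielsen u v -> forall i, A (v i).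
Proof.
move=> Au; elim=> // [{}v i j _ _ Av|{}v i _ Av] k; rewrite /upd; case: ifP => // _.
  exact: sgM.
exact: sgV.
Qed.

Lemma nl_gens (A : set G) u v : gens A u -> nielsen u v -> gens A v.
Proof.
by move=> gu /nl_sym vu K Kv; apply: gu; apply: nl_in vu.
Qed.

End Moves.

Section MovesMaps.
Variables (G H : groupType) (I : eqType) (A : subgroup G) (p : G -> H).
Hypothesis pM : mult_on A p.
Implicit Types (x y : I -> G) (s : I -> H).

Lemma nl_lift x s : (forall i, A (x i)) -> nielsen (p \o x) s ->
  exists2 y, nielsen x y & p \o y = s.
Proof.
move=> Ax; elim=> [|s' i j ij _ [y xy <-]|s' i _ [y xy <-]].
- by exists x => //; apply: nl_refl.
- exists (upd y i (y i * y j)); first exact: nl_mul.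
  apply: funext => k; rewrite /upd /=; case: ifP => // _.
  by rewrite pM //; apply: nl_in xy _.
- exists (upd y i (y i)^-1); first exact: nl_inv.
  apply: funext => k; rewrite /upd /=; case: ifP => // _.
  by rewrite (mult_onV pM) //; apply: nl_in xy _.
Qed.

End MovesMaps.

(** Undoing the moves on the prescribed values reduces the extension property
    for the new tuple to the one for the old tuple. *)
Lemma nl_sbasis (G : groupType) (I : eqType) (A : subgroup G) (x y : I -> G) :
  sbasis A x -> nielsen x y -> sbasis A y.
Proof.
move=> xb; elim=> // [{}y i j ij xy yb|{}y i xy yb].
  have xy' := nl_mul1 y ij.
  split=> [k||H h]; [exact: nl_in (sb_in yb) xy' k|exact: nl_gens (sb_gen yb) xy'|].
  have [f fM fy] := sb_ext yb (upd h i (h i * (h j)^-1)).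
  exists f => // k; rewrite /upd; case: ifP => [/eqP ->|ki]; last by rewrite fy /upd ki.
  rewrite fM; [|exact: (sb_in yb)|exact: (sb_in yb)].
  by rewrite !fy /upd eqxx eq_sym (negbTE ij) mulgVK.
have xy' := nl_inv1 y i.
split=> [k||H h]; [exact: nl_in (sb_in yb) xy' k|exact: nl_gens (sb_gen yb) xy'|].
have [f fM fy] := sb_ext yb (upd h i (h i)^-1).
exists f => // k; rewrite /upd; case: ifP => [/eqP ->|ki]; last by rewrite fy /upd ki.
rewrite (mult_onV fM); last exact: (sb_in yb).
by rewrite fy /upd eqxx invgK.
Qed.

Lemma nl_perm (G : groupType) (I : finType) (u : I -> G) (p : {perm I}) : nielsen u (u \o p).
Proof.
have [ts -> tsP] := prod_tpermP p; move: u.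
elim: ts tsP => [|t ts IH] /= tsP u.
  by rewrite big_nil; apply: nl_eq (nl_refl u) _ => i /=; rewrite perm1.
case/andP: tsP => t12 /IH {}IH; rewrite big_cons.
apply: nl_eq (nl_trans (IH u) (nl_swap _ t12)) _ => k; rewrite /upd /= permM.
have [->|k2] := eqVneq k t.2; first by rewrite tpermR.
by have [->|k1] := eqVneq k t.1; rewrite ?tpermL // tpermD // eq_sym.
Qed.

(** ** Transitivity on generating tuples of a finite group *)

(** If the entries indexed by [J] generate, any other entry can be multiplied by an
    arbitrary element, one generator at a time. *)
Lemma nl_fill (H : groupType) (I : finType) (J : {set I}) (u v : I -> H) :
  (forall K : subgroup H, (forall j, j \in J -> K (u j)) -> forall h, K h) ->
  (forall j, j \in J -> u j = v j) -> nielsen u v.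
Proof.
move=> Jgen uv.
have one i h w : i \notin J -> (forall j, j \in J -> w j = u j) ->
    nielsen w (upd w i (w i * h)).
  move=> iJ; pose P h := forall w, (forall j, j \in J -> w j = u j) ->
    nielsen w (upd w i (w i * h)).
  have P1 : P 1 by move=> z _; apply: nl_eq (nl_refl z) _ => k; rewrite /upd mulg1; case: eqP => [->|].
  have upJ z g : (forall j, j \in J -> z j = u j) -> forall j, j \in J -> upd z i g j = u j.
    by move=> zu j jJ; rewrite /upd; case: eqP => [ji|_]; [rewrite -ji jJ in iJ | apply: zu].
  have PM g g' : P g -> P g' -> P (g * g').
    move=> Pg Pg' z zu; apply: nl_eq (nl_trans (Pg z zu) (Pg' _ (upJ _ _ zu))) _ => k.
    by rewrite /upd eqxx mulgA; case: eqP.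
  have PV g : P g -> P g^-1.
    move=> Pg z zu; apply: nl_sym; apply: nl_eq (Pg _ (upJ _ _ zu)) _ => k.
    by rewrite /upd eqxx mulgVK; case: eqP => [->|].
  pose K := @Subgroup H [set g | P g] P1 (fun a b Pa Pb => PM _ _ Pa (PV _ Pb)).
  suff Kh : K h by apply: Kh.
  apply: Jgen => j jJ z zu; rewrite -(zu j jJ).
  by apply: nl_mul1; apply: contraNneq iJ => ->.
have uvs (s : seq I) : nielsen u (fun k => if k \in s then v k else u k).
  elim: s => [|i s IH]; first by apply: nl_eq (nl_refl u) _ => k.
  have [iJ|iJ] := boolP (i \in J).
    apply: nl_eq IH _ => k; rewrite inE; have [->|] //= := eqVneq k i.
    by rewrite uv //; case: ifP.
  set w := fun k => _ in IH; apply: nl_eq (nl_trans IH (one i ((w i)^-1 * v i) w iJ _)) _.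
    by move=> j jJ; rewrite /w; case: ifP => // _; rewrite uv.
  by move=> k; rewrite /upd mulKVg inE; have [->|] := eqVneq k i.
apply: nl_eq (uvs (enum I)) _ => k; by rewrite mem_enum.
Qed.

(** At most [#|S|] entries suffice to represent all values of a generating tuple.
    With [3 * #|S|] entries there is room for [#|S|] places outside the ones
    chosen for [u] and for [v]: there one writes the list of all elements of [S],
    after which all the other entries can be erased. *)
Lemma nl_transitive (S : finGroupType) (I : finType) (u v : I -> S) :
  (3 * #|S| <= #|I|)%N -> gens [set: S] u -> gens [set: S] v -> nielsen u v.
Proof.
move=> cI gu gv.
pose Jof (w : I -> S) : {set I} := [set i | [pick j | w j == w i] == Some i]%SET.
have JofP (w : I -> S) i : exists2 j, j \in Jof w & w j = w i.
  case E: [pick j | w j == w i] => [j|]; last first.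
    by move: E; case: pickP => // /(_ i); rewrite eqxx.
  have /eqP wj : w j == w i by move: E; case: pickP => // k wk [<-].
  exists j => //; rewrite finset.in_set; apply/eqP; rewrite -E; apply: eq_pick => z /=; rewrite wj //.
have cJ w : (#|Jof w| <= #|S|)%N.
  rewrite -(card_in_imset (f := w)) ?max_card // => i i'; rewrite !inE => /eqP ei /eqP ei' e.
  by rewrite e ei' in ei; case: ei.
have gJ w : gens [set: S] w -> forall K : subgroup S, (forall j, j \in Jof w -> K (w j)) -> forall h, K h.
  move=> gw K KJ h; apply: (gw K) => // i; have [j jJ <-] := JofP w i; exact: KJ.
pose free := ~: (Jof u :|: Jof v); pose l := take #|S| (enum free).
have sl : size l = #|S|.
  rewrite size_take_min -cardE; apply/minn_idPl.
  have [H1 _] := leq_card_setU (Jof u) (Jof v).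
  have := cardsC (Jof u :|: Jof v); have := cJ u; have := cJ v; rewrite -/free.
  by move: H1; move: #|_ :|: _| #|free| #|Jof u| #|Jof v| cI; lia.
have lfree i : i \in l -> i \in free by move=> /mem_take; rewrite mem_enum.
have ul : uniq l by apply/take_uniq/enum_uniq.
pose L : {set I} := [set i in l]%SET.
pose tgt i := if i \in l then nth 1 (enum S) (index i l) else 1.
have gL : forall K : subgroup S, (forall j, j \in L -> K (tgt j)) -> forall h, K h.
  move=> K KL h; have hS : (index h (enum S) < #|S|)%N by rewrite cardE index_mem mem_enum.
  have i0 : I by case: l sl {lfree ul L tgt KL} => [|i //] /esym s0; rewrite s0 in hS.
  pose i := nth i0 l (index h (enum S)).
  have il : i \in l by rewrite mem_nth ?sl.
  have := KL i; rewrite inE il /tgt il index_uniq ?sl // nth_index ?mem_enum //.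
  exact.
have toT w : gens [set: S] w -> (forall i, i \in l -> i \notin Jof w) -> nielsen w tgt.
  move=> gw lw.
  apply: (nl_trans (v := fun i => if i \in l then tgt i else w i)).
    by apply: (nl_fill (gJ w gw)) => j jJ; case: ifP => // /lw; rewrite jJ.
  apply: (nl_fill (J := L)) => [K KL|j]; last by rewrite inE => ->.
  by apply: gL => j jL; have := KL j jL; move: jL; rewrite inE => ->.
have [lu lv] : (forall i, i \in l -> i \notin Jof u) /\ (forall i, i \in l -> i \notin Jof v).
  by split=> i /lfree; rewrite finset.in_setC finset.in_setU negb_or => /andP [].
exact: nl_trans (toT u gu lu) (nl_sym (toT v gv lv)).
Qed.
(** * Nielsen's theorem *)

Section CommonPrefix.
Variable T : eqType.
Implicit Types s t : seq T.

Fixpoint lcp s t := match s, t with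
  | a :: s', b :: t' => if a == b then (lcp s' t').+1 else 0%N
  | _, _ => 0%N
  end.

Lemma lcpC s t : lcp s t = lcp t s.
Proof. by elim: s t => [|a s IH] [|b t] //=; rewrite eq_sym IH. Qed.

Lemma lcpp s : lcp s s = size s.
Proof. by elim: s => //= a s ->; rewrite eqxx. Qed.

Lemma leq_lcp m s t : (m <= lcp s t)%N =
  [&& (m <= size s)%N, (m <= size t)%N & take m s == take m t].
Proof.
elim: s t m => [|a s IH] [|b t] [|m] //=; first by rewrite andbF.
have [<-|ab] := eqVneq a b; first by rewrite !ltnS IH eqseq_cons eqxx.
by rewrite eqseq_cons (negbTE ab) /= !andbF.
Qed.

Lemma lcp_le s t : (lcp s t <= size s)%N /\ (lcp s t <= size t)%N.
Proof. by have := leqnn (lcp s t); rewrite {1}leq_lcp => /and3P []. Qed.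

Lemma take_lcp s t : take (lcp s t) s = take (lcp s t) t.
Proof. by have := leqnn (lcp s t); rewrite {1}leq_lcp => /and3P [_ _ /eqP]. Qed.

Lemma lcp_heads s t a b s' t' :
  drop (lcp s t) s = a :: s' -> drop (lcp s t) t = b :: t' -> a != b.
Proof.
elim: s t => [|c s IH] [|d t] //=; have [<-|cd] := eqVneq c d; first exact: IH.
by rewrite !drop0 => -[<- _] [<- _].
Qed.

(** Words form a tree, and two of the three branching points of a triple coincide. *)
Lemma lcp_ultra s t r : (lcp s t < lcp t r)%N -> lcp s r = lcp s t.
Proof.
move=> lt; apply/eqP; rewrite eqn_leq; apply/andP; split; last first.
  move: (leqnn (lcp s t)) (ltnW lt); rewrite {1}leq_lcp => /and3P [h1 h2 /eqP e].
  by rewrite !leq_lcp => /and3P [_ h3 /eqP <-]; rewrite h1 h3 e eqxx.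
rewrite leqNgt; apply/negP => gt.
suff : ((lcp s t).+1 <= lcp s t)%N by rewrite ltnn.
move: gt lt; rewrite !leq_lcp => /and3P [h1 h2 /eqP e] /and3P [h3 h4 /eqP e'].
by rewrite h1 h3 e e' eqxx.
Qed.

End CommonPrefix.

Lemma reduced_nth (I : eqType) (w : seq (letter I)) a i : reduced w -> (i.+1 < size w)%N ->
  nth a w i.+1 != linv (nth a w i).
Proof.
elim: w i => [|b w IH] //= [|i] /andP [bw rw] iw; last exact: IH.
by case: w bw {rw IH} iw.
Qed.

Ltac slia w := repeat match goal with H : is_true _ |- _ => move: H end;
  move: (size w) (lcp w (winv w)) => ? ?; lia.

(** The middle of a reduced word is neither a letter equal to its own inverse
    nor a pair of mutually inverse letters. *)
Lemma lcp_winv (I : eqType) (w : seq (letter I)) :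
  reduced w -> w != [::] -> ((lcp w (winv w)).*2 < size w)%N.
Proof.
move=> rw; rewrite -size_eq0 ltnNge => w0; apply/negP => le.
have sw : size (winv w) = size w by rewrite /winv size_rev size_map.
have := leqnn (lcp w (winv w)); rewrite {1}leq_lcp => /and3P [_ _ /eqP e].
have [a _] : exists a : letter I, True by case: w w0 {le rw sw e} => // a; exists a.
pose k := (size w).-1./2; have kl : (k < lcp w (winv w))%N by rewrite /k; slia w.
have kw : (k < size w)%N by rewrite /k; slia w.
have := congr1 (fun s => nth a s k) e; rewrite !nth_take // nth_rev ?size_map //.
rewrite (nth_map a); last by slia w.
have [od|ev] := boolP (odd (size w)).
  have -> : (size w - k.+1)%N = k by rewrite /k; slia w.
  by move/esym/eqP; rewrite (negbTE (linv_neq _)).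
have -> : (size w - k.+1)%N = k.+1 by rewrite /k; slia w.
move/(congr1 (@linv _)); rewrite linvK => /esym/eqP; apply/negP.
by apply: reduced_nth => //; rewrite /k; slia w.
Qed.

Section NielsenLength.
Variables (G : groupType) (C : subgroup G) (I : finType) (x : I -> G).
Hypothesis xb : sbasis C x.
Implicit Types (g h : G) (w : seq (letter I)).

Local Notation nf := (nf C x).

Definition wlen g := size (nf g).
Definition wlcp g h := lcp (nf g) (nf h).

Lemma winv_cat w w' : winv (w ++ w') = winv w' ++ winv w.
Proof. by rewrite /winv map_cat rev_cat. Qed.

Lemma size_winv w : size (winv w) = size w.
Proof. by rewrite /winv size_rev size_map. Qed.

Lemma wlenV g : C g -> wlen g^-1 = wlen g.
Proof. by move=> Cg; rewrite /wlen (nfV xb) // size_winv. Qed.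

Lemma nf_div g h : C g -> C h ->
  nf (g^-1 * h) = winv (drop (wlcp g h) (nf g)) ++ drop (wlcp g h) (nf h).
Proof.
move=> Cg Ch; set m := wlcp g h.
have e : g^-1 * h = weval x (winv (drop m (nf g)) ++ drop m (nf h)).
  rewrite weval_cat weval_inv.
  rewrite -{1}(nfK xb Cg) -{1}(nfK xb Ch) -{1}(cat_take_drop m (nf g)) -{1}(cat_take_drop m (nf h)).
  by rewrite !weval_cat /m /wlcp take_lcp; gsimp.
rewrite e (nf_weval xb) // reduced_catE reduced_inv !reduced_drop ?nf_reduced //=.
case E: (drop m (nf g)) => [|a s] //; case E': (drop m (nf h)) => [|b t] //=.
  by case: (winv _).
have ab := lcp_heads E E'.
rewrite /winv /= rev_cons; case E2: (rcons _ _) => [|d v] //.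
have -> : last d v = linv a by rewrite -[LHS]/(last d (d :: v)) -E2 last_rcons.
by rewrite linvK eq_sym.
Qed.

Lemma wlen_div g h : C g -> C h ->
  (wlen (g^-1 * h) + (wlcp g h).*2 = wlen g + wlen h)%N.
Proof.
move=> Cg Ch; rewrite /wlen nf_div // size_cat size_winv !size_drop.
have [] := lcp_le (nf g) (nf h); rewrite -/(wlcp g h) -addnn.
move: (wlcp g h) (size (nf g)) (size (nf h)) => a b c; lia.
Qed.

(** The part of [g^-1] that does not cancel against [h] is a common prefix. *)
Lemma wlcp_div g h : C g -> C h -> (wlen g <= wlcp (g^-1 * h) g^-1 + wlcp g h)%N.
Proof.
move=> Cg Ch; have [le _] := lcp_le (nf g) (nf h); rewrite -/(wlcp g h) in le.
rewrite addnC -leq_subLR; set m := wlcp g h.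
have sd : size (winv (drop m (nf g))) = (wlen g - m)%N by rewrite size_winv size_drop.
rewrite leq_lcp (nf_div Cg Ch) -/m (nfV xb) // size_cat sd leq_addr /=.
rewrite size_winv leq_subr -[X in take _ (winv X)](cat_take_drop m) winv_cat.
by rewrite !take_cat sd ltnn subnn !take0 !cats0 eqxx.
Qed.

Lemma wlcp_self g : C g -> g != 1 -> ((wlcp g g^-1).*2 < wlen g)%N.
Proof.
move=> Cg g1; rewrite /wlcp (nfV xb) // /wlen lcp_winv ?nf_reduced //.
by apply: contraNneq g1 => w0; rewrite -(nfK xb Cg) w0.
Qed.

Lemma wlen_leval (y : I -> G) a : (forall i, C (y i)) -> wlen (leval y a) = wlen (y a.1).
Proof. by move=> Cy; case: a => i []; rewrite /leval //= wlenV. Qed.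

Section Reduced.
Variable y : I -> G.
Hypothesis Cy : forall i, C (y i).
Local Notation ev := (leval y).

(** In no product of three signed entries without formal cancellation does the middle
    one disappear; this is the condition usually called (N2). *)
Definition nielsen_reduced := forall a b c : letter I, b != a -> c != linv a ->
  (wlcp (ev a) (ev b) + wlcp (ev (linv a)) (ev c) < wlen (ev a))%N.

Hypothesis yr : nielsen_reduced.

Let Ce a : C (ev a).
Proof. by case: a => i []; rewrite /leval /=; [|apply: sgV]. Qed.

(** The longest part of a signed entry that can cancel against one on its left. *)
Definition overlap (a : letter I) := \max_(b | b != a) wlcp (ev a) (ev b).

Lemma overlap_ge a b : b != a -> (wlcp (ev a) (ev b) <= overlap a)%N.
Proof. by move=> ba; apply: (leq_bigmax_cond (F := fun b => wlcp (ev a) (ev b))). Qed.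

Lemma overlap_lt a : (overlap a + overlap (linv a) < wlen (ev a))%N.
Proof.
rewrite /overlap.
have [|b ba ->] := @eq_bigmax_cond _ [pred b | b != a] (fun b => wlcp (ev a) (ev b)).
  by apply/card_gt0P; exists (linv a); rewrite inE linv_neq.
have [|c ca ->] := @eq_bigmax_cond _ [pred b | b != linv a] (fun b => wlcp (ev (linv a)) (ev b)).
  by apply/card_gt0P; exists a; rewrite inE eq_sym linv_neq.
exact: yr.
Qed.

(** In a product of entries without formal cancellation, each factor keeps at
    least one letter: what is left of the first factor survives as a prefix. *)
Lemma reduced_product a w : reduced (a :: w) ->
  (wlen (ev a) <= wlcp (weval y (a :: w)) (ev a) + overlap (linv a))%N /\
  (wlen (ev a) + size w <= wlen (weval y (a :: w)) + overlap (linv a))%N.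
Proof.
elim: w a => [|b w IH] a.
  move=> _; rewrite /= mulg1 addn0 leq_addr; split=> //.
  by rewrite /wlcp lcpp leq_addr.
move=> /= /andP [ba rbw]; have [IH1 IH2] := IH b rbw.
set h := weval y (b :: w) in IH1 IH2 *.
have Ch : C h by apply: weval_in.
have ole := overlap_lt b.
have bo : (wlcp (ev (linv a)) (ev b) <= overlap b)%N.
  by rewrite /wlcp lcpC; apply: overlap_ge; rewrite eq_sym.
have bo' := overlap_ge ba.
have ch : wlcp (ev (linv a)) h = wlcp (ev (linv a)) (ev b).
  by apply: lcp_ultra; rewrite [lcp (nf (ev b)) _]lcpC; move: IH1 ole bo; rewrite /wlcp; lia.
have Ca := Ce (linv a).
have wd := wlen_div Ca Ch; have wl := wlcp_div Ca Ch.
rewrite leval_inv invgK wlenV // -leval_inv in wd; rewrite leval_inv invgK wlenV // -leval_inv in wl.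
rewrite -[leval y b * weval y w]/h; rewrite ch in wd wl.
split; move: wd wl IH1 IH2 ole bo bo' => /=; move: (wlen (ev a * h)) (wlen (ev a))
  (wlen (ev b)) (wlen h) (overlap b) (overlap _) (overlap _) (wlcp (ev a * h) _) (wlcp h _)
  (wlcp _ _) (size w) => *; lia.
Qed.

End Reduced.

(** Position of a word among those of its length, in lexicographic order. *)
Definition code w : nat := foldl (fun n a => n * #|{: letter I}| + enum_rank a)%N 0%N w.

Lemma code_rcons w a : code (rcons w a) = (code w * #|{: letter I}| + enum_rank a)%N.
Proof. by rewrite /code -cats1 foldl_cat. Qed.

Lemma code_inj v w : size v = size w -> code v = code w -> v = w.
Proof.
elim/last_ind: v w => [|v a IH] w; first by move/esym/size0nil ->.
case/lastP: w => [|w b]; rewrite ?size_rcons // => -[sz].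
have lt (c : letter I) : (enum_rank c < #|{: letter I}|)%N by apply: ltn_ord.
rewrite !code_rcons => e; have := congr1 (modn^~ #|{: letter I}|) e.
rewrite !modnMDl !modn_small // => /val_inj/enum_rank_inj ab.
move: e; rewrite ab => /eqP; rewrite eqn_add2r eqn_pmul2r; last by apply: leq_trans (lt a).
by move/eqP/(IH _ sz) ->.
Qed.

Lemma code_cat v w z : size v = size w -> (code (v ++ z) <= code (w ++ z))%N ->
  (code v <= code w)%N.
Proof.
move=> _; elim/last_ind: z => [|z a IH]; first by rewrite !cats0.
have lt : (0 < #|{: letter I}|)%N by apply/card_gt0P; exists a.
by rewrite -!rcons_cat !code_rcons leq_add2r leq_pmul2r.
Qed.

Definition half_code g := code (take (uphalf (wlen g)) (nf g)).
(** The tie-break of Nielsen's method: total length alone does not exclude entries both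
    halves of which cancel against others. *)
Definition weight g := (half_code g + half_code g^-1)%N.

Lemma weightV g : weight g^-1 = weight g.
Proof. by rewrite /weight invgK addnC. Qed.

(** If [p] and [q] share exactly the first half of [p], then [p^-1 * q] arises
    from [q] by exchanging that half with the initial half of [p^-1]; it has
    the length of [q], and the two weights compare as the two halves of [p]. *)
Lemma half_exchange p q : C p -> C q -> (wlcp p q).*2 = wlen p -> (wlen p <= wlen q)%N ->
  wlen (p^-1 * q) = wlen q /\ ((weight q <= weight (p^-1 * q))%N ->
  (code (take (wlcp p q) (nf p)) <= code (take (wlcp p q) (nf p^-1)))%N).
Proof.
move=> Cp Cq hp hq; have Cpq : C (p^-1 * q) by apply: sgM => //; apply: sgV.
have wl : wlen (p^-1 * q) = wlen q.
  by have := wlen_div Cp Cq; rewrite hp => /eqP; rewrite addnC eqn_add2l => /eqP.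
split=> //; rewrite /weight /half_code (nfV xb Cpq) (nfV xb Cq) wlenV // wlenV // wl.
rewrite nf_div //; set m := wlcp p q in hp *; set n := wlen q in hq wl *.
have sq : size (nf q) = n by []. have sp : size (nf p) = m.*2 by rewrite hp.
set b := drop m (nf q); have sb : size b = (n - m)%N by rewrite size_drop sq.
have Eq : nf q = take m (nf p) ++ b.
  by rewrite /m /wlcp take_lcp cat_take_drop.
set s := take m (nf p) in Eq *; set t := drop m (nf p).
have ss : size s = m by rewrite size_take_min sp; apply/minn_idPl; rewrite -addnn leq_addr.
have st : size (winv t) = m by rewrite size_winv size_drop sp -addnn addnK.
have -> : take m (nf p^-1) = winv t.
  by rewrite (nfV xb Cp) -[nf p](cat_take_drop m) winv_cat take_cat st ltnn subnn take0 cats0.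
have um : (m <= uphalf n)%N by move: hq; rewrite -hp; clearbody m n; clear; lia.
have ub : (uphalf n <= size (winv b))%N.
  by rewrite size_winv sb; move: hq; rewrite -hp; clearbody m n; clear; lia.
have tk (r : seq (letter I)) : size r = m -> take (uphalf n) (r ++ b) = r ++ take (uphalf n - m) b.
  by move=> sr; rewrite take_cat sr ltnNge um.
rewrite Eq !tk // !winv_cat !takel_cat // leq_add2r.
by apply: code_cat; rewrite ss st.
Qed.

Lemma sbasis_neq1 i : x i != 1.
Proof.
apply/eqP => xi; have := nf_weval xb (w := [:: (i, true)]) isT.
by rewrite /= mulg1 /leval /= xi (nf1 xb).
Qed.

End NielsenLength.

Section NielsenTheorem.
Variables (G : groupType) (C : subgroup G) (I : finType) (x y : I -> G).
Hypotheses (xb : sbasis C x) (yb : sbasis C y).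

Local Notation wlen := (wlen C x).
Local Notation wlcp := (wlcp C x).
Local Notation weight := (weight C x).
Local Notation ev := (leval y).

Let Cy := sb_in yb.
Let Ce a : C (ev a).
Proof. by case: a => i []; rewrite /leval /=; [|apply: sgV]. Qed.

(** By minimality of length each side of an entry cancels at most up to its middle.
    If both halves cancel, exchanging one of them for the other in a neighbour
    preserves the length; minimality of the weight forces
    the two halves to be equal, and then the entry is not reduced. *)
Lemma minimal_nielsen_reduced :
  (forall a b, a.1 != b.1 -> (wlen (ev b) <= wlen ((ev a)^-1 * ev b))%N /\
    (wlen ((ev a)^-1 * ev b) = wlen (ev b) ->
     weight (ev b) <= weight ((ev a)^-1 * ev b))%N) ->
  nielsen_reduced C x y.
Proof.
move=> ymin; have nt a : ((wlcp (ev a) (ev (linv a))).*2 < wlen (ev a))%N.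
  rewrite leval_inv; apply: wlcp_self => //; have := sbasis_neq1 yb a.1.
  by case: a => i [] //; rewrite /leval /= -{1}[y i]invgK; apply: contraNneq => ->; rewrite invg1.
have sgn (a b : letter I) : b != a -> b != linv a -> a.1 != b.1.
  case: a b => i e [j d] /=; rewrite /linv /= => n1 n2; apply: contraTneq isT => ij.
  by move: n1 n2; rewrite ij !xpair_eqE eqxx /=; case: e; case: d.
have le a b : b != a -> ((wlcp (ev a) (ev b)).*2 <= wlen (ev a))%N.
  have [->|nb] := eqVneq b (linv a); first by move=> _; apply/ltnW/nt.
  move=> ba; have [le _] := ymin a b (sgn a b ba nb).
  by have := wlen_div xb (Ce a) (Ce b); move: le; move: (wlen (_ * _)) (wlen (ev a)) (wlen (ev b)) (wlcp _ _) => *; lia.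
have key a b : b != a -> (wlcp (ev a) (ev b)).*2 = wlen (ev a) ->
    (code (take (wlcp (ev a) (ev b)) (nf C x (ev a))) <=
     code (take (wlcp (ev a) (ev b)) (nf C x (ev a)^-1)))%N.
  move=> ba h; have nb : b != linv a.
    by apply/eqP => e; have := nt a; rewrite -e h ltnn.
  have le2 : (wlen (ev a) <= wlen (ev b))%N.
    by rewrite -h /wlcp lcpC; apply: le; rewrite eq_sym.
  have [wl] := half_exchange xb (Ce a) (Ce b) h le2.
  by apply; apply: (ymin a b (sgn a b ba nb)).2.
move=> a b c ba ca; rewrite ltnNge; apply/negP => bad.
have lb := le a b ba; have lc := le _ _ ca.
have wa : wlen (ev (linv a)) = wlen (ev a) by rewrite leval_inv wlenV.
rewrite wa in lc.
have hb : (wlcp (ev a) (ev b)).*2 = wlen (ev a).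
  by move: bad lb lc; move: (wlcp _ _) (wlcp _ _) (wlen _) => *; lia.
have hc : (wlcp (ev (linv a)) (ev c)).*2 = wlen (ev a).
  by move: bad lb lc; move: (wlcp _ _) (wlcp _ _) (wlen _) => *; lia.
have kb := key a b ba hb; have kc := key (linv a) c ca; rewrite wa in kc.
have {kc} := kc hc; rewrite leval_inv invgK -leval_inv.
have -> : wlcp (ev (linv a)) (ev c) = wlcp (ev a) (ev b) by apply: double_inj; rewrite hc.
move=> kc; have [le1 _] := lcp_le (nf C x (ev a)) (nf C x (ev b)).
set m := wlcp (ev a) (ev b) in hb kb kc; rewrite -/(wlcp _ _) -/m in le1.
have sa : size (nf C x (ev (linv a))) = size (nf C x (ev a)) by exact: wa.
have e : take m (nf C x (ev a)) = take m (nf C x (ev (linv a))).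
  apply: code_inj; first by rewrite !size_take_min sa.
  by apply/eqP; rewrite eqn_leq -{1}leval_inv in kb kc *; rewrite kc kb.
have : (m <= wlcp (ev a) (ev (linv a)))%N by rewrite leq_lcp sa le1 e eqxx.
by rewrite -leq_double hb leqNgt nt.
Qed.

(** A product of [k] entries of a reduced basis has length at least [k]; hence every
    [x i], of length one, is a signed entry of [y]. *)
Lemma nielsen_reduced_basis : nielsen_reduced C x y -> nielsen y x.
Proof.
move=> yr.
have lx i : wlen (x i) = 1%N.
  by have := nf_weval xb (w := [:: (i, true)]) isT; rewrite /wlen /= mulg1 => ->.
have [s sP] : exists s : I -> letter I, forall i, x i = ev (s i).
  suff /choice [s sP] : forall i, exists a : letter I, x i = ev a by exists s.
  move=> i.
  have Cxi := sb_in xb i; have rw := nf_reduced C y (x i).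
  have := nfK yb Cxi; case: (nf C y (x i)) rw => [|a [|b w]] rw /= e.
  - by have := sbasis_neq1 xb i; rewrite -e eqxx.
  - by exists a; rewrite -e mulg1.
  - have [_] := reduced_product xb Cy yr rw; rewrite /= e lx.
    have := overlap_lt yr a; move: (wlen _) (overlap _ _ _ _) (overlap _ _ _ _) (size w) => *; lia.
have nfx i e : nf C x (leval x (i, e)) = [:: (i, e)].
  by have := nf_weval xb (w := [:: (i, e)]) isT; rewrite /= mulg1.
have sI : injective (fun i => (s i).1).
  move=> i j /= e; have := sP i; have := sP j.
  case: (s i) (s j) e => k b [l d] /= <-.
  case: b; case: d; rewrite /leval /= => ej ei.
  - have := nfx j true; by rewrite /leval /= ej -ei -[x i]/(leval x (i, true)) nfx => -[].
  - have := nfx j true; by rewrite /leval /= ej -ei -[(x i)^-1]/(leval x (i, false)) nfx.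
  - have := nfx j true; rewrite /leval /= ej -[y k]invgK -ei.
    by rewrite -[(x i)^-1]/(leval x (i, false)) nfx.
  - have := nfx j true; by rewrite /leval /= ej -ei -[x i]/(leval x (i, true)) nfx => -[].
have := nl_trans (nl_perm y (perm sI)) (nl_signs _ (fun i => ~~ (s i).2) (enum_uniq I)).
move=> yx; apply: nl_eq yx _ => i; rewrite mem_enum /= permE sP /leval.
by case: (s i) => j [].
Qed.

End NielsenTheorem.

(** Nielsen's theorem. Among the tuples reachable from [y], one of minimal total length
    and, for that length, of minimal total weight, is reduced. *)
Theorem nielsen_bases (G : groupType) (C : subgroup G) (I : finType) (x y : I -> G) :
  sbasis C x -> sbasis C y -> nielsen x y.
Proof.
move=> xb yb; apply: nl_sym.
pose M1 (z : I -> G) := (\sum_i wlen C x (z i))%N.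
pose M2 (z : I -> G) := (\sum_i weight C x (z i))%N.
pose Q n := `[< exists2 z, nielsen y z & M1 z = n >].
have exQ : exists n, Q n by exists (M1 y); apply/asboolP; exists y => //; apply: nl_refl.
case: (ex_minnP exQ) => n1 /asboolP [z1 yz1 e1] min1.
pose Q2 n := `[< exists z, [/\ nielsen y z, M1 z = n1 & M2 z = n] >].
have exQ2 : exists n, Q2 n by exists (M2 z1); apply/asboolP; exists z1.
case: (ex_minnP exQ2) => n2 /asboolP [z [yz ez1 ez2]] min2.
have zb := nl_sbasis yb yz; have Cz := sb_in zb.
apply: (nl_trans yz); apply: (nielsen_reduced_basis xb zb).
apply: (minimal_nielsen_reduced xb zb) => a b ab.
have [v [zv vz vb]] := nl_letter z ab.
have yv := nl_trans yz zv; have Cv := nl_in Cz zv.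
have lE (u : I -> G) (Cu : forall i, C (u i)) : wlen C x (leval u b) = wlen C x (u b.1).
  exact: wlen_leval.
have wE (u : I -> G) : weight C x (leval u b) = weight C x (u b.1).
  by case: (b) => i []; rewrite /leval //= weightV.
have sumE (f : G -> nat) : (\sum_i f (v i) + f (z b.1) = \sum_i f (z i) + f (v b.1))%N.
  rewrite (bigD1 b.1) //= [in RHS](bigD1 b.1) //=.
  rewrite (eq_bigr (fun i => f (z i))); last by move=> i ib; rewrite vz.
  by move: (f (v b.1)) (f (z b.1)) (\sum_(i | _) _)%N => *; lia.
rewrite -vb !lE // !wE.
have s1 := sumE (wlen C x); have s2 := sumE (weight C x).
rewrite -!/(M1 _) -!/(M2 _) in s1 s2.
have m1 : (n1 <= M1 v)%N by apply: min1; apply/asboolP; exists v.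
split=> [|e]; first by move: s1 m1; rewrite ez1; move: (wlen _ _ _) (wlen _ _ _) (M1 v) => *; lia.
have ev1 : M1 v = n1 by apply/eqP; rewrite -ez1 -(eqn_add2r (wlen C x (z b.1))) s1 e.
have : (n2 <= M2 v)%N by apply: min2; apply/asboolP; exists v.
by move: s2; rewrite ez2; move: (weight _ _ _) (weight _ _ _) (M2 v) => *; lia.
Qed.
(** * Composition series *)

(** [p] presents [T] as the quotient of [H] by [N]. Quotient groups are handled only
    through such maps, which restrict and transport without changing type. *)
Record epi (G T : groupType) (H N : subgroup G) (p : G -> T) : Prop := Epi {
  epi_mult : mult_on H p;
  epi_surj : forall s, exists2 h, H h & p h = s;
  epi_sub : (N : set G) `<=` H;
  epi_ker : forall h, H h -> (p h = 1 <-> N h)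
}.

Section EpiTheory.
Variables (G T : groupType) (H N : subgroup G) (p : G -> T).
Hypothesis pE : epi H N p.

Lemma epi_eq g h : H g -> H h -> (p g = p h <-> N (g^-1 * h)).
Proof.
move=> Hg Hh; have Hg' := sgV Hg; rewrite -(epi_ker pE); last exact: sgM.
rewrite (epi_mult pE) // (mult_onV (epi_mult pE)) //; split=> [->|]; first exact: mulVg.
by move/(congr1 (mulg (p g))); rewrite mulVKg mulg1.
Qed.

Lemma epi_normal : normal_in N H.
Proof.
split=> [|x h Nx Hh]; first exact: (epi_sub pE).
have Hx := epi_sub pE Nx; have Hh' := sgV Hh.
have Hxh : H (x ^ h) by rewrite conjgE; apply: sgM => //; apply: sgM.
rewrite -(epi_ker pE) // conjgE !(epi_mult pE) //; last exact: sgM.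
have -> : p x = 1 by apply/(epi_ker pE).
by rewrite mul1g (mult_onV (epi_mult pE)) // mulVg.
Qed.

End EpiTheory.

Local Notation fquo nNH := (quotient_group (NormalSubgroup (sg_restrict_normal nNH))).

Lemma factor_isP (G : groupType) (H N : subgroup G) S :
  factor_is H N S <-> exists p : G -> FS_group S, epi H N p.
Proof.
split=> [[nNH [f fb]]|[p pE]].
  pose u g : sgtype H := insubd 1 g.
  have uK g : H g -> val (u g) = g.
    by move=> Hg; rewrite val_insubd mem_set.
  pose p g := f (\pi_(fquo nNH) (u g)).
  have piM a b : \pi_(fquo nNH) (a * b) = \pi_(fquo nNH) a * \pi_(fquo nNH) b.
    by rewrite -pi_quoM.
  have Hv (a : sgtype H) : H (val a) by have := valP a; rewrite inE.
  have uM g h : H g -> H h -> u (g * h) = u g * u h.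
    by move=> Hg Hh; apply: val_inj; rewrite uK; [rewrite -[RHS]/(val (u g) * val (u h)) !uK | apply: sgM].
  exists p; split.
  - by move=> g h Hg Hh; rewrite /p uM // piM gmulfM.
  - move=> s; have [f' _ f'K] := fb.
    exists (val (repr (f' s))); first exact: Hv.
    rewrite /p -[RHS]f'K; congr (f _); rewrite -[RHS]reprK; congr (\pi_(_) _).
    by apply: val_inj; rewrite uK.
  - by case: (nNH).
  - move=> h Hh; rewrite /p; have f1 : f 1 = 1 by apply: (mulgI (f 1)); rewrite -gmulfM !mulg1.
    rewrite -f1; split=> [/(bij_inj fb)/esym/eqP/quoP|Nh].
      by rewrite invg1 mul1g /= uK.
    by congr (f _); apply/esym/eqP/quoP; rewrite invg1 mul1g /= uK.
exists (epi_normal pE).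
set nNH := epi_normal pE.
pose f (a : Defs.factor nNH) := p (val (repr a)).
have Hv (a : sgtype H) : H (val a) by have := valP a; rewrite inE.
have fpi a : f (\pi_(fquo nNH) a) = p (val a).
  by apply/(epi_eq pE) => //; apply: (@pi_repr_quo _ (NormalSubgroup (sg_restrict_normal nNH)) a).
have fM : {morph f : a b / a * b}.
  move=> a b; rewrite -[a * b]/(\pi_(fquo nNH) (repr a * repr b)) fpi.
  by rewrite -[val _]/(val (repr a) * val (repr b)) (epi_mult pE).
pose fmul := isMultiplicative.Build _ _ f fM.
pose F : {multiplicative Defs.factor nNH -> FS_group S} := HB.pack f fmul.
exists F; pose g s : Defs.factor nNH := \pi_(fquo nNH) (insubd 1 (xget 1 [set h | H h /\ p h = s])).
have gP s : f (g s) = s.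
  rewrite fpi val_insubd; case: xgetP => [h -> [Hh ph]|/(_ _)] /=.
    by rewrite mem_set.
  by have [h Hh ph] := epi_surj pE s; move/(_ h); case.
exists g => // a; rewrite -[LHS]reprK -[RHS]reprK; apply/eqP/quoP.
by apply/(epi_eq pE); [exact: Hv|exact: Hv|exact: gP (f a)].
Qed.

Section SimpleFactors.
Implicit Type S : FS.

Let Sgrp S := tagged (val (repr S)).
Let Sgrp_simple S : simple (Sgrp S). Proof. exact: (valP (repr S)). Qed.

Lemma FS_neq1 S : exists s : FS_group S, s != 1.
Proof.
have [/trivgPn [x xS x1] _] := simpleP _ (Sgrp_simple S).
exists (subg (Sgrp S) x); apply: contraNneq x1 => e.
by rewrite -(subgK _ xS) e.
Qed.

Lemma FS_simple S (K : subgroup (FS_group S)) : is_normal K ->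
  (forall s, K s -> s = 1) \/ (forall s, K s).
Proof.
move=> nK; have [_ simS] := simpleP _ (Sgrp_simple S).
pose Q : {set _} := [set x in Sgrp S | `[< K (subg (Sgrp S) x) >]]%SET.
have QP x : reflect (x \in Sgrp S /\ K (subg (Sgrp S) x)) (x \in Q).
  by rewrite inE; apply: (iffP andP) => -[xS /asboolP].
have gQ : group_set Q.
  apply/group_setP; split=> [|x y /QP [xS Kx] /QP [yS Ky]]; apply/QP; split.
  - exact: group1.
  - by rewrite morph1; apply: sg1.
  - exact: groupM.
  - by rewrite morphM //; apply: sgM.
have nQ : Group gQ <| Sgrp S.
  apply/andP; split; first by apply/fintype.subsetP => x /QP [].
  apply/fintype.subsetP => y yS; rewrite inE; apply/fintype.subsetP => _ /imsetP [x /QP [xS Kx] ->].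
  by apply/QP; split; [apply: groupJ | rewrite morphJ //; apply: nK].
have mem s : sgval s \in Q <-> K s.
  split=> [/QP [_]|Ks]; rewrite ?sgvalK //.
  by apply/QP; rewrite sgvalK; split=> //; apply: subgP.
case: (simS _ nQ) => /= e; [left|right] => s.
  move/mem; rewrite e => /set1P s1; apply: val_inj; exact: s1.
by apply/mem; rewrite e subgP.
Qed.

Lemma FS_of_simple n (P : {group 'S_n}) : simple P ->
  exists (S : FS) (f : 'S_n -> FS_group S), [/\ mult_on [set x | x \in P] f,
   forall s, exists2 x, x \in P & f x = s & forall x, x \in P -> f x = 1 -> x = 1].
Proof.
move=> simP; pose T : simple_perm_group := exist _ (existT _ n P) simP.
pose S : FS := \pi_FS T.
have /isogP [f fI fP] : P \isog Sgrp S.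
  have : T == repr S %[mod FS] by rewrite reprK.
  by rewrite eqmodE.
exists S, (fun x => subg (Sgrp S) (f x)).
have fS x : x \in P -> f x \in Sgrp S by move=> Px; rewrite -fP; apply: mem_morphim.
split.
- by move=> x y /= Px Py; rewrite morphM // morphM //; apply: fS.
- move=> s; have : sgval s \in f @* P by rewrite fP; apply: subgP.
  by case/morphimP => x Px _ e; exists x => //; rewrite -e sgvalK.
- move=> x Px e; apply/eqP; rewrite -(morph_injm_eq1 fI) //.
  by apply/eqP; rewrite -(subgK _ (fS x Px)) e.
Qed.

End SimpleFactors.

(** A maximal normal subgroup of finite index is the kernel of the action on
    its cosets, whose image is a finite simple group of permutations. *)
Lemma maximal_factor (G : groupType) (H N : subgroup G) m (f : G -> 'I_m) :
  normal_in N H -> (forall g h, H g -> H h -> f g = f h -> N (g^-1 * h)) ->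
  (exists2 h, H h & ~ N h) ->
  (forall M : subgroup G, normal_in M H -> (N : set G) `<=` M ->
     (M : set G) `<=` N \/ (H : set G) `<=` M) ->
  exists (S : FS) (p : G -> FS_group S), epi H N p.
Proof.
move=> [NH nN] fP [h0 Hh0 Nh0] maxN.
have [k kP] := coset_label NH fP.
have NJ x h : N x -> H h -> N (h^-1 * x * h).
  by move=> Nx Hh; have := nN x h Nx Hh; rewrite conjgE mulgA.
pose rep v := xget 1 [set h | H h /\ k h = v].
have repP h : H h -> H (rep (k h)) /\ k (rep (k h)) = k h.
  by move=> Hh; rewrite /rep; case: xgetP => [z _ //|/(_ h) []].
pose a g (v : 'I_m) := if `[< exists2 h, H h & k h = v >] then k (g * rep v) else v.
have aE g h : H g -> H h -> a g (k h) = k (g * h).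
  move=> Hg Hh; rewrite /a asboolT; last by exists h.
  have [Hr kr] := repP h Hh; apply/kP; [exact: sgM|exact: sgM|].
  have -> : (g * rep (k h))^-1 * (g * h) = (rep (k h))^-1 * h by gsimp.
  by apply/kP.
have aN g v : ~ (exists2 h, H h & k h = v) -> a g v = v by move=> nv; rewrite /a asboolF.
have aM g h v : H g -> H h -> a (g * h) v = a g (a h v).
  move=> Hg Hh; have [[z Hz <-]|nv] := pselect (exists2 z, H z & k z = v).
    by rewrite !aE ?mulgA //; apply: sgM.
  by rewrite !aN.
have a1 v : a 1 v = v.
  have [[z Hz <-]|nv] := pselect (exists2 z, H z & k z = v); last exact: aN.
  by rewrite aE ?mul1g //; apply: sg1.
have aI g : H g -> injective (a g).
  move=> Hg u v /(congr1 (a g^-1)); rewrite -!aM ?mulVg ?a1 //; exact: sgV.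
pose q g : 'S_m := if pselect (H g) is left Hg then (perm (aI g Hg)) else 1.
have qE g : H g -> q g =1 a g.
  by move=> Hg v; rewrite /q; case: pselect => // Hg'; rewrite permE.
(* Permutations compose on the right, hence the inverse. *)
pose p g := q g^-1.
have pM : mult_on H p.
  move=> g h Hg Hh; apply/permP => v; have Hg' := sgV Hg; have Hh' := sgV Hh.
  by rewrite permM !qE ?invgM ?aM //; apply: sgM.
have pker h : H h -> (p h = 1 <-> N h).
  move=> Hh; have Hh' := sgV Hh; split=> [ph|Nh].
    have : p h (k 1) = k 1 by rewrite ph perm1.
    rewrite qE // aE ?mulg1 //; last exact: sg1.
    by move/kP; rewrite invgK mulg1; apply => //; apply: sg1.
  apply/permP => v; rewrite perm1 qE //.
  have [[z Hz <-]|nv] := pselect (exists2 z, H z & k z = v); last exact: aN.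
  rewrite aE //; apply/kP => //; first exact: sgM.
  by rewrite invgM invgK; apply: NJ.
pose P : {set 'S_m} := [set s | `[< exists2 h, H h & p h = s >]]%SET.
have PP s : reflect (exists2 h, H h & p h = s) (s \in P) by rewrite inE; apply: asboolP.
have gP : group_set P.
  apply/group_setP; split; first by apply/PP; exists 1; [apply: sg1 | apply: mult_on1 pM].
  move=> _ _ /PP [g Hg <-] /PP [h Hh <-]; apply/PP; exists (g * h); last exact: pM.
  exact: sgM.
have simP : simple (Group gP).
  apply/simpleP; split.
    apply/trivgPn; exists (p h0); first by apply/PP; exists h0.
    by apply/eqP => /(pker _ Hh0).
  move=> Q /andP [sQP nQP].
  pose M0 := sgpreim pM (@Subgroup _ [set s | s \in Q] (group1 Q)
     (fun x y Qx Qy => groupM Qx (groupVr Qy))).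
  have nM : normal_in M0 H.
    split=> [z [] //|z h [Hz Qz] Hh]; have Hh' := sgV Hh.
    split; first by rewrite conjgE; apply: sgM => //; apply: sgM.
    rewrite /= conjgE !pM ?(mult_onV pM) //; last exact: sgM.
    rewrite -conjgE memJ_norm //; apply: (fintype.subsetP nQP).
    by apply/PP; exists h.
  have NM : (N : set G) `<=` M0.
    move=> z Nz; have Hz := NH z Nz; split=> //=.
    by have /(pker _ Hz) -> := Nz; apply: group1.
  have [MN|HM] := maxN _ nM NM; [left|right]; apply/setP => s.
    rewrite inE; apply/idP/eqP => [Qs|->]; last exact: group1.
    have /PP [h Hh ps] : s \in P by apply: (fintype.subsetP sQP).
    by rewrite -ps; apply/pker => //; apply: MN; split=> //=; rewrite ps.
  apply/idP/idP; first exact: (fintype.subsetP sQP).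
  by move/PP => [h /HM [_ /= Qh] <-].
have [S [c [cM cS cK]]] := FS_of_simple simP.
have pP h : H h -> p h \in P by move=> Hh; apply/PP; exists h.
exists S, (c \o p); split=> //.
- by move=> g h Hg Hh; rewrite /= pM // cM //; apply: pP.
- by move=> s; have [_ /PP [h Hh <-] <-] := cS s; exists h.
- move=> h Hh; split=> [/= e|/(pker _ Hh) e].
    by apply/pker => //; apply: cK e; apply: pP.
  rewrite /= e; apply: (mulgI (c 1)); by rewrite -cM ?mulg1 //=; apply: (group1 (Group gP)).
Qed.
Definition FS_fin (S : FS) : finGroupType := subg_of (tagged (val (repr S))).
Definition FS_card (S : FS) : nat := #|FS_fin S|.

(** Composition series from [H] down to [K], remembered by the list of their factors. *)
Inductive factors (G : groupType) : subgroup G -> subgroup G -> seq FS -> Prop :=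
| comp_nil H : factors H H [::]
| comp_cons H N K S (p : G -> FS_group S) l :
    epi H N p -> factors N K l -> factors H K (S :: l).

Definition index_le (G : groupType) m (H K : subgroup G) :=
  exists f : G -> 'I_m, forall g h, H g -> H h -> f g = f h -> K (g^-1 * h).

(** Since the orders of the factors are all that matters at first, this weaker notion is
    used to intersect and transport series. *)
Definition bcomp (G : groupType) m (H K : subgroup G) :=
  exists2 l, factors H K l & all (fun S => FS_card S <= m)%N l.

Section Comp.
Variable G : groupType.
Implicit Types (H K N M A : subgroup G) (l : seq FS).

Lemma comp_sub H K l : factors H K l -> (K : set G) `<=` H.
Proof. by elim=> [? x //|{}H N {}K S p {}l pE _ KN x /KN]; apply: (epi_sub pE). Qed.

Lemma comp_cat H K M l l' : factors H K l -> factors K M l' -> factors H M (l ++ l').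
Proof. by elim=> [//|{}H N {}K S p {}l pE _ IH /IH]; apply: comp_cons pE. Qed.

Lemma sub_eq H K : (H : set G) `<=` K -> (K : set G) `<=` H -> H = K.
Proof. by move=> HK KH; apply: subgroup_eq; apply/seteqP. Qed.

Lemma epi_neq H N S (p : G -> FS_group S) : epi H N p -> exists2 h, H h & ~ N h.
Proof.
move=> pE; have [s /eqP s1] := FS_neq1 S; have [h Hh ph] := epi_surj pE s.
by exists h => // /(epi_ker pE Hh); rewrite ph.
Qed.

Lemma comp_id H l : factors H H l -> l = [::].
Proof.
move e: {2}H => K c; case: c e => // {}H N {}K S p {}l pE /comp_sub KN eH.
by have [h Hh []] := epi_neq pE; apply: KN; rewrite -eH.
Qed.

Lemma epi_card H N S (p : G -> FS_group S) m :
  epi H N p -> index_le m H N -> (FS_card S <= m)%N.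
Proof.
move=> pE [f fP].
have [r rP] : exists r : FS_fin S -> G, forall s, H (r s) /\ p (r s) = s.
  suff /choice [r rP] : forall s : FS_fin S, exists g, H g /\ p g = s by exists r.
  by move=> s; have [h Hh ph] := epi_surj pE s; exists h.
rewrite -[m]card_ord; apply: (@leq_card _ _ (f \o r)) => s s' /= e.
have [Hs ps] := rP s; have [Hs' ps'] := rP s'.
by rewrite -ps -ps'; apply/(epi_eq pE) => //; apply: fP.
Qed.

Lemma epi_index H N S (p : G -> FS_group S) m :
  epi H N p -> (FS_card S <= m)%N -> index_le m H N.
Proof.
move=> pE Sm; exists (fun g => widen_ord Sm (enum_rank (p g : FS_fin S))) => g h Hg Hh e.
by apply/(epi_eq pE) => //; apply: enum_rank_inj; apply: val_inj; apply: (congr1 val e).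
Qed.

Lemma label_skip H m (f : G -> 'I_m.+1) j : (forall g, H g -> j != f g) ->
  exists f' : G -> 'I_m, forall g h, H g -> H h -> f' g = f' h -> f g = f h.
Proof.
move=> fj; have [d _ _] := unlift_some (fj 1 (sg1 H)).
exists (fun g => odflt d (unlift j (f g))) => g h Hg Hh.
have [a -> ->] := unlift_some (fj g Hg); have [b -> ->] := unlift_some (fj h Hh).
by move=> /= ->.
Qed.

(** The induction step for refining a normal subgroup into a composition series:
    an intermediate subgroup has smaller index on both sides. *)
Lemma index_le_between m H K M (z h : G) : (K : set G) `<=` M -> (M : set G) `<=` H ->
  M z -> ~ K z -> H h -> ~ M h -> index_le m.+1 H K -> index_le m H M /\ index_le m M K.
Proof.
move=> KM MH Mz Kz Hh Mh [f fP].
have KH : (K : set G) `<=` H by move=> x /KM /MH.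
have [k kP] := coset_label KH fP.
split.
  have [c cP] : exists c : G -> G, forall g, H g -> [/\ H (c g), M (g^-1 * c g) &
      forall g', H g' -> M (g^-1 * g') -> c g = c g'].
    exists (fun g => xget 1 [set x | H x /\ M (g^-1 * x)]) => g Hg.
    have [] : [set x | H x /\ M (g^-1 * x)] (xget 1 [set x | H x /\ M (g^-1 * x)]).
      by apply: xgetPex; exists g; split=> //; rewrite mulVg; apply: sg1.
    move=> h1 h2; split=> // g' Hg' gg'; congr xget; apply/seteqP; split=> x [Hx Mx]; split=> //.
      by have := sgM (sgV gg') Mx; gsimp.
    by have := sgM gg' Mx; gsimp.
  have [H1 M1 _] := cP 1 (sg1 H); rewrite invg1 mul1g in M1.
  have Hz := MH z Mz; pose j := k (c 1 * z).
  have jn g : H g -> j != k (c g).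
    move=> Hg; apply/eqP => /kP e; have [Hc Mc eqc] := cP g Hg.
    have Mg : M (c g).
      have := sgM M1 (sgM Mz (KM _ (e (sgM H1 Hz) Hc))).
      by gsimp.
    have e1 : c g = c 1.
      apply: eqc (sg1 H) _; rewrite mulg1.
      by have := sgM Mc (sgV Mg); gsimp.
    have := e (sgM H1 Hz) Hc; rewrite e1 invgM mulgVK => /sgV; rewrite invgK.
    exact: Kz.
  have [f' f'P] := label_skip (f := k \o c) jn.
  exists f' => g g' Hg Hg' /(f'P _ _ Hg Hg') /= /kP e.
  have [Hc Mc _] := cP g Hg; have [Hc' Mc' _] := cP g' Hg'.
  by have := sgM (sgM Mc (KM _ (e Hc Hc'))) (sgV Mc'); gsimp.
have jn g : M g -> k h != k g.
  move=> Mg; apply/eqP => e; have {}e := KM _ ((kP _ _ Hh (MH g Mg)).1 e); apply: Mh.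
  by have := sgV (sgM e (sgV Mg)); gsimp.
have [f' f'P] := label_skip jn.
exists f' => g g' Mg Mg' /(f'P _ _ Mg Mg') /kP; apply; exact: MH.
Qed.

(** Induction on the index: either there is an intermediate normal subgroup, which has
    smaller index on both sides, or the quotient is simple. *)
Lemma comp_of_index m H K : normal_in K H -> index_le m H K -> bcomp m H K.
Proof.
elim: m H K => [|m IH] H K nK iK; first by case: iK => f _; case: (f 1).
have bcompS A B : bcomp m A B -> bcomp m.+1 A B.
  by case=> l cl al; exists l => //; apply: sub_all al => S; apply: leqW.
have [HK|nHK] := pselect ((H : set G) `<=` K).
  by have [KH _] := nK; rewrite (sub_eq HK KH); exists [::] => //; apply: comp_nil.
have [h0 Hh0 Kh0] : exists2 h, H h & ~ K h.
  by apply: contrapT => nh; apply: nHK => h Hh; apply: contrapT => Kh; apply: nh; exists h.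
have [|nM] := pselect (exists M : subgroup G, [/\ normal_in M H, (K : set G) `<=` M,
    ~ ((M : set G) `<=` K) & ~ ((H : set G) `<=` M)]).
  case=> M [nMH KM nMK nHM].
  have [z Mz Kz] : exists2 z, M z & ~ K z.
    by apply: contrapT => nh; apply: nMK => h Mh; apply: contrapT => Kh; apply: nh; exists h.
  have [h Hh Mh] : exists2 h, H h & ~ M h.
    by apply: contrapT => nh; apply: nHM => h Hh; apply: contrapT => Kh; apply: nh; exists h.
  have [i1 i2] := index_le_between KM nMH.1 Mz Kz Hh Mh iK.
  have nKM : normal_in K M by split=> // x y Kx My; apply: nK.2 => //; apply: nMH.1.
  have [l1 c1 a1] := bcompS _ _ (IH _ _ nMH i1); have [l2 c2 a2] := bcompS _ _ (IH _ _ nKM i2).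
  by exists (l1 ++ l2); [apply: comp_cat c2 | rewrite all_cat a1].
have [f fP] := iK.
have [|S [p pE]] := maximal_factor nK fP (ex_intro2 _ _ h0 Hh0 Kh0).
  move=> M nMH KM; apply: contrapT => nor; apply: nM; exists M; split=> // ?; apply: nor; [by left|by right].
exists [:: S]; first by apply: comp_cons pE (comp_nil _).
by rewrite /= andbT (epi_card pE iK).
Qed.

Lemma bcomp_trans m H K M : bcomp m H K -> bcomp m K M -> bcomp m H M.
Proof.
case=> l c a [l' c' a']; exists (l ++ l'); first exact: comp_cat c'.
by rewrite all_cat a.
Qed.

Lemma bcomp_le m n H K : (m <= n)%N -> bcomp m H K -> bcomp n H K.
Proof. by move=> mn [l c a]; exists l => //; apply: sub_all a => S Sm; apply: leq_trans mn. Qed.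

Lemma comp_bounded H K l : factors H K l -> exists m, bcomp m H K.
Proof.
move=> c; exists (\max_(S <- l) FS_card S)%N; exists l => //.
by apply/allP => S Sl; apply: leq_bigmax_seq.
Qed.

(** A step of index at most [m] intersects in a normal step of index at most [m],
    which can be refined again. *)
Lemma bcomp_cap m H K A : bcomp m H K -> bcomp m (sgcap H A) (sgcap K A).
Proof.
case=> l c; elim: c => [{}H _|{}H N {}K S p {}l pE _ IH /= /andP [Sm al]].
  by exists [::] => //; apply: comp_nil.
apply: bcomp_trans (IH al); apply: comp_of_index.
  split=> [x [Nx Ax]|x h [Nx Ax] [Hh Ah]]; first by split=> //; apply: (epi_sub pE).
  split; first exact: (epi_normal pE).2.
  by rewrite conjgE; apply: sgM; [apply: sgV | apply: sgM].
have [f fP] := epi_index pE Sm.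
exists f => g h [Hg Ag] [Hh Ah] e; split; first exact: fP.
by apply: sgM => //; apply: sgV.
Qed.

Lemma finite_index_sub H K : (H : set G) `<=` K -> finite_index H -> finite_index K.
Proof.
move=> HK /finite_indexP [T [f fP]]; apply/finite_indexP.
by exists T, f => x y /fP /HK.
Qed.

Lemma finite_index_le H A : finite_index A -> exists m, index_le m H A.
Proof.
move=> /finite_indexP [T [f fP]]; exists #|T|, (enum_rank \o f) => g h _ _.
by move/enum_rank_inj/fP.
Qed.

Lemma subnormal_comp A : subnormal A -> finite_index A -> exists l, factors sgtop A l.
Proof.
elim=> [|H N sH IH nN] fi; first by exists [::]; apply: comp_nil.
have [l cl] := IH (finite_index_sub nN.1 fi).
have [m im] := finite_index_le H fi.
have [l' cl' _] := comp_of_index nN im.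
by exists (l ++ l'); apply: comp_cat cl'.
Qed.

Lemma comp_finite_index H K l : factors H K l -> finite_index H -> finite_index K.
Proof.
elim=> [//|{}H N {}K S p {}l pE _ IH] fH; apply: IH.
have [f fP] := epi_index pE (leqnn _).
exact: finite_index_trans fH fP.
Qed.

Lemma comp_subnormal A l : factors sgtop A l -> subnormal A.
Proof.
move=> c; have : subnormal (@sgtop G) by apply: subnormal_top.
elim: c => // H N K S p {}l pE _ IH sH; apply: IH.
exact: subnormal_step sH (epi_normal pE).
Qed.

(** ** The Jordan--Hoelder theorem *)

(** The image of [N'] in the simple quotient by [N] is normal and non-trivial. *)
Lemma epi_cap H N N' S S' (p : G -> FS_group S) (p' : G -> FS_group S') :
  epi H N p -> epi H N' p' -> ~ ((N' : set G) `<=` N) -> epi N' (sgcap N N') p.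
Proof.
move=> pE pE' nN; have N'H := epi_sub pE'.
have pM : mult_on N' p by apply: mult_on_sub (epi_mult pE).
have nI : is_normal (sgimage pM).
  move=> _ g [x Nx <-]; have [h Hh <-] := epi_surj pE g.
  exists (x ^ h); first exact: (epi_normal pE').2.
  have Hx := N'H x Nx; have Hh' := sgV Hh.
  rewrite !conjgE !(epi_mult pE) //; last exact: sgM.
  by rewrite (mult_onV (epi_mult pE)).
have [p1|pS] := FS_simple nI.
  case: nN => x Nx; apply/(epi_ker pE) => //; first exact: N'H.
  by apply: p1; exists x.
split=> //.
- by move=> x [].
- by move=> h Nh; rewrite (epi_ker pE) //; [split=> [|[]] | apply: N'H].
Qed.

(** Kernels of maps onto simple groups are maximal normal subgroups. *)
Lemma epi_incomparable H N N' S S' (p : G -> FS_group S) (p' : G -> FS_group S') :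
  epi H N p -> epi H N' p' -> (N' : set G) `<=` N -> N = N'.
Proof.
move=> pE pE' N'N; have [NN'|nN] := pselect ((N : set G) `<=` N'); first exact: sub_eq.
have cE := epi_cap pE' pE nN; have [h Hh Nh] := epi_neq pE.
have [x Nx ex] := epi_surj cE (p' h); case: Nh.
have Hx := epi_sub pE Nx.
have := sgM Nx (N'N _ (proj1 (epi_eq pE' Hx Hh) ex)).
by gsimp.
Qed.

Lemma epi_eq_FS H N S S' (p : G -> FS_group S) (p' : G -> FS_group S') :
  epi H N p -> epi H N p' -> S = S'.
Proof.
by move=> pE pE'; apply: (@factor_is_inj G H N); apply/factor_isP; [exists p|exists p'].
Qed.

Lemma comp_inv H K l : factors H K l -> (l = [::] /\ H = K) \/
  exists N S (p : G -> FS_group S) l', [/\ l = S :: l', epi H N p & factors N K l'].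
Proof. by case=> [?|H' N K' S p l' ? ?]; [left|right; exists N, S, p, l']. Qed.

(** If the first terms [N] and [N'] of the two series differ, both are compared with
    series through their intersection, where the first two factors occur in
    either order. *)
Theorem comp_unique H K l l' : factors H K l -> factors H K l' -> perm_eq l l'.
Proof.
have [n] := ubnP (size l); elim: n H l l' => // n IH H l l' sl c c'.
have [[-> e]|[N [S [p [l1 [el pE c1]]]]]] := comp_inv c.
  by move: c'; rewrite e => /comp_id ->.
have [[_ e]|[N' [S' [p' [l1' [el' pE' c1']]]]]] := comp_inv c'.
  by move: c; rewrite e el => /comp_id.
move: sl; rewrite el el' /= ltnS => sl.
have [eN|nN] := pselect (N = N').
  rewrite -eN in pE' c1'; rewrite (epi_eq_FS pE pE') perm_cons; exact: IH c1'.
have cE : epi N' (sgcap N N') p by apply: (epi_cap pE pE') => /(epi_incomparable pE pE').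
have cE' : epi N (sgcap N N') p'.
  have -> : sgcap N N' = sgcap N' N by apply: sub_eq => x [].
  by apply: (epi_cap pE' pE) => /(epi_incomparable pE' pE)/esym.
have [l2 c2 _] : exists2 l2, factors (sgcap N N') K l2 & True.
  have [m b] := comp_bounded c1; have [l2 c2 _] := bcomp_cap N' b.
  exists l2 => //; suff eK : sgcap K N' = K by rewrite -[X in factors _ X]eK.
  by apply: sub_eq => x; [case | move=> Kx; split=> //; apply: (comp_sub c1')].
have p1 := IH _ _ _ sl c1 (comp_cons cE' c2).
have sl2 : (size (S :: l2) < n)%N by move: sl; rewrite (perm_size p1).
have p2 := IH _ _ _ sl2 (comp_cons cE c2) c1'.
rewrite -(perm_cons S) in p1; rewrite -(perm_cons S') in p2.
apply: (perm_trans p1); apply: (perm_trans _ p2).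
by apply/seq.permP => a /=; rewrite addnCA.
Qed.

End Comp.

(** By uniqueness the series chosen to define the multiplicities can be replaced by any list. *)
Section Multiplicity.
Variable G : groupType.
Implicit Types (H A : subgroup G) (l : seq FS) (s : seq (subgroup G)).

Let chain s := forall i, (i.+1 < size s)%N ->
  exists S, factor_is (nth sgtop s i) (nth sgtop s i.+1) S.

Lemma chain_comp H s : chain (H :: s) -> exists2 l, factors H (last H s) l &
  forall S, series_mult (H :: s) S = count_mem S l.
Proof.
elim: s H => [|N s IH] H cs.
  by exists [::]; [apply: comp_nil | move=> S; rewrite /series_mult /= big_ord0].
have [|l cl el] := IH N; first by move=> i; apply: (cs i.+1).
have [T fT] := cs 0%N isT; have [p pE] := (factor_isP _ _ _).1 fT.
exists (T :: l); first exact: comp_cons pE cl.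
move=> S; rewrite /= -el /series_mult /= big_ord_recl /=; congr (_ + _)%N.
congr nat_of_bool; apply/asboolP/eqP => [fS|<-] //; exact: factor_is_inj fT fS.
Qed.

Lemma comp_chain H A l : factors H A l -> exists s, chain (H :: s) /\ last H s = A.
Proof.
elim=> [{}H|{}H N {}A S p {}l pE _ [s [cs ls]]]; first by exists [::].
exists (N :: s); split=> // -[|i] /=; last exact: cs.
by move=> _; exists S; apply/factor_isP; exists p.
Qed.

Lemma nmult_comp A l S : factors sgtop A l -> nmult A S = count_mem S l.
Proof.
move=> cl; rewrite /nmult; case: xgetP => [s _ cs|none].
  case: cs => s0 h0 hl ch; case: s s0 h0 hl ch => // H s _ /= eH hl ch.
  have [l' cl' ->] := chain_comp ch; apply/seq.permP; apply: comp_unique cl.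
  by move: cl' hl; rewrite -eH nth_last => + <-.
have [s [cs ls]] := comp_chain cl; case: (none (sgtop :: s)); split=> //.
by rewrite /= nth_last.
Qed.

End Multiplicity.
(** * Virtual isomorphisms and the homomorphism d *)

Section Transport.
Variable G : groupType.
Implicit Types (f : virtual_iso G) (H K M A : subgroup G) (l : seq FS).

Lemma vdom_comp f (g : virtual_iso G) x : vdom (vcomp g f) x <-> vdom f x /\ vdom g (f x).
Proof. by split=> [[Dx [_ Dy]]|[Dx Dy]] //; do !split => //; apply: vmap_cod. Qed.

Lemma vimage_dom f : vimage f (vdom f) = vcod f.
Proof.
apply: sub_eq => [_ [x [Dx _] <-]|y Cy]; first exact: vmap_cod.
by have [x Dx <-] := vmap_surj Cy; exists x.
Qed.

Lemma vimage_inv f H : (H : set G) `<=` vdom f -> vimage (vinv f) (vimage f H) = H.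
Proof.
move=> Hf; apply: sub_eq => [_ [_ [_ [x [Dx Hx] <-]] <-]|x Hx]; first by rewrite /= vinv_mapK.
have Dx := Hf x Hx; exists (f x); last by rewrite /= vinv_mapK.
by split; [apply: vmap_cod | exists x].
Qed.

Lemma vimage_invK f K : (K : set G) `<=` vcod f -> vimage f (vimage (vinv f) K) = K.
Proof.
move=> Kf; apply: sub_eq => [_ [_ [_ [y [Cy Ky] <-]] <-]|y Ky].
  by have [_ ->] := vinv_mapP Cy.
have Cy := Kf y Ky; have [Dx fx] := vinv_mapP Cy.
by exists (vinv_map f y) => //; split=> //; exists y.
Qed.

Lemma vimage_sub f H K : (H : set G) `<=` K -> (vimage f H : set G) `<=` vimage f K.
Proof. by move=> HK _ [x [Dx /HK Kx] <-]; exists x. Qed.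

Lemma vimage_comp f (g : virtual_iso G) H : (H : set G) `<=` vdom f -> (vimage f H : set G) `<=` vdom g ->
  vimage (vcomp g f) H = vimage g (vimage f H).
Proof.
move=> Hf Hg; apply: sub_eq => [_ [x [_ Hx] <-]|_ [y [Dy [x [Dx Hx] e]] <-]]; last subst y.
  have Dx := Hf x Hx; exists (f x) => //; split; last by exists x.
  by apply: Hg; exists x.
by exists x => //; do !split => //; apply: vmap_cod.
Qed.

Lemma comp_vimage f H K l : factors H K l -> (H : set G) `<=` vdom f ->
  factors (vimage f H) (vimage f K) l.
Proof.
elim=> [{}H _|{}H N {}K S p {}l pE _ IH Hf]; first exact: comp_nil.
have Nf : (N : set G) `<=` vdom f by move=> x /(epi_sub pE) /Hf.
apply: (comp_cons (p := p \o vinv_map f)) (IH Nf); split.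
- move=> _ _ [x [Dx Hx] <-] [y [Dy Hy] <-] /=.
  by rewrite -vmapM // !vinv_mapK ?(epi_mult pE) //; apply: sgM.
- move=> s; have [h Hh <-] := epi_surj pE s; have Dh := Hf h Hh.
  by exists (f h); rewrite /= ?vinv_mapK //; exists h.
- exact/vimage_sub/(epi_sub pE).
- move=> _ [x [Dx Hx] <-]; rewrite /= vinv_mapK // (epi_ker pE) //.
  split=> [Nx|[y [Dy Ny] /vmap_inj e]]; first by exists x.
  by rewrite -e.
Qed.

Lemma bcomp_vimage m f H K : bcomp m H K -> (H : set G) `<=` vdom f ->
  bcomp m (vimage f H) (vimage f K).
Proof. by case=> l c a Hf; exists l => //; apply: comp_vimage. Qed.

Program Definition core A : subgroup G := @Subgroup G [set x | forall g, A (x ^ g)] _ _.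
Next Obligation. by move=> A g; rewrite conj1g; apply: sg1. Qed.
Next Obligation. by move=> A x y Ax Ay g; rewrite conjMg conjVg; apply: sgF. Qed.

Lemma core_sub A : (core A : set G) `<=` A.
Proof. by move=> x /(_ 1); rewrite conjg1. Qed.

Lemma core_normal A : is_normal (core A).
Proof. by move=> x g Ax h; rewrite -conjgM. Qed.

Lemma core_normal_in A H : (core A : set G) `<=` H -> normal_in (core A) H.
Proof. by move=> AH; split=> // x h Ax _; apply: core_normal. Qed.

Lemma core_fi A : finite_index A -> finite_index (core A).
Proof.
move=> /finite_indexP [T [a aP]]; apply/finite_indexP.
pose r u := xget 1 [set x | a x = u].
have ar x : a (r (a x)) = a x.
  by rewrite /r; case: xgetP => [y _ //|/(_ x)]; rewrite /= => /(_ erefl).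
exists {ffun T -> T}, (fun x => [ffun v => a (x * r v)]) => x y /ffunP e g.
have := e (a g); rewrite !ffunE => /aP Axy.
have Ag := aP _ _ (ar g).
have := sgM (sgM (sgV Ag) Axy) Ag.
by rewrite conjgE; gsimp.
Qed.

Lemma comp_core A H : finite_index A -> (core A : set G) `<=` H -> exists l, factors H (core A) l.
Proof.
move=> /core_fi fA AH; have [m im] := finite_index_le H fA.
by have [l c _] := comp_of_index (core_normal_in AH) im; exists l.
Qed.

(** Restriction to [A], which need not be contained in the domain. *)
Program Definition vres f A (Af : finite_index A) : virtual_iso G :=
  @VirtualIso G (sgcap (vdom f) A) (vimage f A) f _ _ _ _.
Next Obligation. by move=> f A Af; apply: finite_index_cap => //; apply: vdom_fi. Qed.
Next Obligation. by move=> f A Af; apply: vimage_fi. Qed.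
Next Obligation. by move=> f A Af x y [Dx _] [Dy _]; apply: vmapM. Qed.
Next Obligation.
move=> f A Af; split.
- by move=> x [Dx Ax]; exists x.
- by move=> x y; rewrite !inE => -[Dx _] [Dy _]; apply: vmap_inj.
- by move=> _ [x [Dx Ax] <-]; exists x.
Qed.

Lemma vequiv_res f A (Af : finite_index A) : vequiv (vres f Af) f.
Proof.
apply/vequivP; exists (sgcap (vdom f) A); first by apply: finite_index_cap => //; apply: vdom_fi.
by move=> x [Dx Ax].
Qed.

(** A subnormal representative together with lists of the factors above its domain
    and its codomain; [d] is the difference of their multiplicities. *)
Definition jump f (a b : seq FS) := factors sgtop (vdom f) a /\ factors sgtop (vcod f) b.

(** Both representatives restrict to the same map on a common subgroup, and
    restriction adds the same factors to the domain and to the codomain. *)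
Lemma jump_vequiv f f' a b a' b' S : vequiv f f' -> jump f a b -> jump f' a' b' ->
  (count_mem S b + count_mem S a' = count_mem S b' + count_mem S a)%N.
Proof.
move=> /vequivP [D Df DP] [ca cb] [ca' cb'].
have MD := @core_sub D; set M := core D in MD.
have Mf : (M : set G) `<=` vdom f by move=> x /MD /DP [].
have Mf' : (M : set G) `<=` vdom f' by move=> x /MD /DP [].
have [k ck] := comp_core Df Mf; have [k' ck'] := comp_core Df Mf'.
have eM : vimage f M = vimage f' M.
  by apply: sub_eq => _ [x [Dx Mx] <-]; have [h1 h2 h3] := DP x (MD x Mx); exists x => //; rewrite h3.
have ik := comp_vimage ck (fun x => id); have ik' := comp_vimage ck' (fun x => id).
rewrite vimage_dom -/M in ik; rewrite vimage_dom -/M -eM in ik'.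
have /seq.permP/(_ (pred1 S)) := comp_unique (comp_cat ca ck) (comp_cat ca' ck').
have /seq.permP/(_ (pred1 S)) := comp_unique (comp_cat cb ik) (comp_cat cb' ik').
rewrite !count_cat.
move: (count _ a) (count _ b) (count _ a') (count _ b') (count _ k) (count _ k') => *; lia.
Qed.

(** First the domain and then the codomain is replaced by a core; a normal subgroup of
    the normal domain is still subnormal. *)
Lemma subnormal_repr_exists c : exists f, subnormal_repr c f.
Proof.
pose f0 := repr c; pose A := core (vdom f0).
have fA : finite_index A by apply/core_fi/vdom_fi.
have Af : (A : set G) `<=` vdom f0 by apply: core_sub.
pose B := vimage f0 A; have fB : finite_index B by apply: vimage_fi.
pose B1 := core B; have fB1 : finite_index B1 by apply: core_fi.
have B1B : (B1 : set G) `<=` B by apply: core_sub.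
have BC : (B : set G) `<=` vcod f0 by rewrite -vimage_dom; apply: vimage_sub.
pose A1 := vimage (vinv f0) B1; have fA1 : finite_index A1 by apply: vimage_fi.
have A1A : (A1 : set G) `<=` A by rewrite -[A](vimage_inv Af); apply: vimage_sub.
pose f := vres f0 fA1; exists f; split.
- by rewrite -[RHS]reprK; apply/commP/vequiv_res.
- have -> : vdom f = A1 by apply: sub_eq => x; [case | move=> Ax; split=> //; apply/Af/A1A].
  have [k ck] := comp_core fB B1B.
  have ik : factors A A1 k by have := @comp_vimage (vinv f0) _ _ _ ck BC; rewrite vimage_inv.
  have [l cl] := comp_core (vdom_fi f0) (H := sgtop) (fun _ _ => I).
  exact: comp_subnormal (comp_cat cl ik).
- have -> : vcod f = B1.
    by rewrite -[RHS](@vimage_invK f0) // => x /B1B /BC.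
  have [l cl] := comp_core fB (H := sgtop) (fun _ _ => I).
  exact: comp_subnormal cl.
Qed.

Lemma coeff_jump c f a b S : \pi_(Comm G) f = c -> jump f a b ->
  coeff S (dcomm c) = ((count_mem S b)%:Z - (count_mem S a)%:Z)%R.
Proof.
move=> fc fj; rewrite coeff_dcomm.
case: xgetP => [f0 _ [f0c sd sc]|none]; last by have [g /none] := subnormal_repr_exists c.
have [a0 ca0] := subnormal_comp sd (vdom_fi f0).
have [b0 cb0] := subnormal_comp sc (vcod_fi f0).
rewrite (nmult_comp S ca0) (nmult_comp S cb0).
have ff0 : vequiv f f0 by apply/commP; rewrite fc.
have := jump_vequiv S ff0 fj (conj ca0 cb0).
move: (count _ b) (count _ a0) (count _ b0) (count _ a) => *; lia.
Qed.

Lemma jump_exists c : exists f a b, \pi_(Comm G) f = c /\ jump f a b.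
Proof.
have [f [fc sd sc]] := subnormal_repr_exists c.
have [a ca] := subnormal_comp sd (vdom_fi f).
have [b cb] := subnormal_comp sc (vcod_fi f).
by exists f, a, b.
Qed.

(** Restrict both factors so that the codomain of one is the domain of the other:
    the factors above this middle subgroup cancel. *)
Lemma dcommM (c c' : Comm G) : dcomm (c * c') = (dcomm c + dcomm c')%R.
Proof.
apply/eqP/freeg_eqP => S; rewrite coeffD.
have [f [a [b [fc [ca cb]]]]] := jump_exists c.
have [f' [a' [b' [fc' [ca' cb']]]]] := jump_exists c'.
rewrite (coeff_jump S fc (conj ca cb)) (coeff_jump S fc' (conj ca' cb')).
have fM := finite_index_cap (vcod_fi f') (vdom_fi f).
pose M := core (sgcap (vcod f') (vdom f)).
have Mc : (M : set G) `<=` vcod f' by move=> x /core_sub [].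
have Md : (M : set G) `<=` vdom f by move=> x /core_sub [].
pose P := vimage (vinv f') M; have fP : finite_index P by apply/vimage_fi/core_fi.
have eP : vimage f' P = M by apply: vimage_invK.
have Pd : (P : set G) `<=` vdom f' by move=> _ [x [Cx _] <-]; apply: (vinv_mapP Cx).1.
have Pd2 : (P : set G) `<=` vdom (vcomp f f').
  move=> x Px; have Dx := Pd x Px; have Mx : M (f' x) by rewrite -eP; exists x.
  by split=> //; split; [apply: Mc | apply: Md].
have hc : \pi_(Comm G) (vres (vcomp f f') fP) = c * c'.
  rewrite -fc -fc' -[RHS]/(comm_mul _ _) pi_commM; exact/commP/vequiv_res.
have [k ck] := comp_core fM Md; have [k' ck'] := comp_core fM Mc.
have cP : factors (vdom f') P k'.
  have := @comp_vimage (vinv f') _ _ _ ck' (fun x => id).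
  by rewrite -[vcod f']/(vdom (vinv f')) vimage_dom.
have cM := comp_vimage ck (fun x => id); rewrite vimage_dom in cM.
have hj : jump (vres (vcomp f f') fP) (a' ++ k') (b ++ k).
  split; first by rewrite (_ : vdom _ = P); [apply: comp_cat cP | apply: sub_eq => [x []|x Px] //; split=> //; apply: Pd2].
  rewrite /= vimage_comp // ?eP //; exact: comp_cat cM.
rewrite (coeff_jump S hc hj).
have /seq.permP/(_ (pred1 S)) := comp_unique (comp_cat ca ck) (comp_cat cb' ck').
rewrite !count_cat.
move: (count _ a) (count _ b) (count _ a') (count _ b') (count _ k) (count _ k') => *; lia.
Qed.

Lemma dcomm1 : dcomm (1 : Comm G) = 0%R.
Proof. by apply: (GRing.addIr (dcomm (1 : Comm G))); rewrite -dcommM mulg1 GRing.add0r. Qed.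

Lemma dcommV (c : Comm G) : dcomm c^-1 = (- dcomm c)%R.
Proof.
by apply: (GRing.addIr (dcomm c)); rewrite -dcommM mulVg dcomm1 GRing.addNr.
Qed.

Program Definition ker_d : normal_subgroup (Comm G) :=
  @NormalSubgroup _ (@Subgroup (Comm G) [set c | dcomm c = 0%R] dcomm1 _) _.
Next Obligation. by move=> x y /= dx dy; rewrite dcommM dcommV dx dy GRing.subr0. Qed.
Next Obligation.
by move=> x g /= dx; rewrite /= conjgE !dcommM dcommV dx GRing.add0r GRing.addNr.
Qed.

Program Definition vconj (g : G) : virtual_iso G :=
  @VirtualIso G sgtop sgtop (fun x => g * x * g^-1) (@finite_index_top G) (@finite_index_top G) _ _.
Next Obligation. by move=> g x y _ _; gsimp. Qed.
Next Obligation.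
move=> g; split=> // [x y _ _ /mulIg/mulgI //|y _].
by exists (g^-1 * y * g) => //; gsimp.
Qed.

Lemma dcomm_vconj g : dcomm (\pi_(Comm G) (vconj g)) = 0%R.
Proof.
apply/eqP/freeg_eqP => S; rewrite coeff0 (@coeff_jump _ (vconj g) [::] [::]) //.
by split; apply: comp_nil.
Qed.

End Transport.
(** * Normal subgroups of the commensurator *)

Section NormalInComm.
Variables (G : groupType) (N : normal_subgroup (Comm G)).
Implicit Types (f : virtual_iso G) (A B C D H : subgroup G).

Definition inN f : Prop := N (\pi_(Comm G) f).

Lemma inN_vequiv f f' : vequiv f f' -> inN f -> inN f'.
Proof. by move=> /commP e; rewrite /inN e. Qed.

Lemma inN_id : inN (vid G).
Proof. exact: (sg1 N). Qed.

Lemma inN_inv f : inN f -> inN (vinv f).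
Proof. by move=> Nf; have := sgV Nf; rewrite -[_^-1]/(comm_inv _) pi_commV. Qed.

Lemma inN_comp f f' : inN f -> inN f' -> inN (vcomp f f').
Proof. by move=> Nf Nf'; have := sgM Nf Nf'; rewrite -[_ * _]/(comm_mul _ _) pi_commM. Qed.

Lemma inN_conj f (h : virtual_iso G) : inN f -> inN (vcomp h (vcomp f (vinv h))).
Proof.
move=> Nf; have := nsgP (\pi_(Comm G) (vinv h)) Nf.
rewrite conjgE -[_ * _]/(comm_mul _ (comm_mul _ _)) -[_^-1]/(comm_inv _).
rewrite pi_commV !pi_commM; apply: inN_vequiv.
apply: vequiv_comp; last exact: vequiv_refl.
apply/vequivP; exists (vdom h) => [|x Dx]; first exact: vdom_fi.
have Cx := vmap_cod Dx; split=> //=.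
by apply: (@vmap_inj _ (vinv h)) => //=; have [D1 e1] := @vinv_mapP _ (vinv h) x Dx; rewrite ?vinv_mapK // e1.
Qed.

(** Some element of [N] maps [u] to [v]. For bases of finite-index subgroups this says that
    the isomorphism matching them is in [N]; tuples make it possible to compute
    with such isomorphisms. *)
Definition nrel I (u v : I -> G) : Prop :=
  exists2 f, inN f & forall i, vdom f (u i) /\ f (u i) = v i.

Section Nrel.
Variable I : eqType.
Implicit Types (u v w : I -> G).

Lemma nrel_refl u : nrel u u.
Proof. by exists (vid G) => //; apply: inN_id. Qed.

Lemma nrel_sym u v : nrel u v -> nrel v u.
Proof.
case=> f Nf fu; exists (vinv f) => [|i]; first exact: inN_inv.
have [D <-] := fu i; split; first exact: vmap_cod.
exact: vinv_mapK.
Qed.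

Lemma nrel_trans u v w : nrel u v -> nrel v w -> nrel u w.
Proof.
case=> f Nf fu [f' Nf' fv]; exists (vcomp f' f) => [|i]; first exact: inN_comp.
have [D e] := fu i; have [D' e'] := fv i.
by split; [apply/vdom_comp; rewrite e | rewrite /= e].
Qed.

Lemma nrel_eq u v u' v' : u =1 u' -> v =1 v' -> nrel u v -> nrel u' v'.
Proof. by move=> /funext -> /funext ->. Qed.

(** Normality of [N]. *)
Lemma nrel_post (h : virtual_iso G) u v : (forall i, vdom h (u i)) -> (forall i, vdom h (v i)) ->
  nrel u v -> nrel (h \o u) (h \o v).
Proof.
move=> hu hv [f Nf fu]; exists (vcomp h (vcomp f (vinv h))) => [|i]; first exact: inN_conj.
have [D e] := fu i; have Ch := vmap_cod (hu i).
split; last by rewrite /= vinv_mapK ?e.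
apply/vdom_comp; split; last by rewrite /= vinv_mapK ?e.
by apply/vdom_comp; split=> //; rewrite /= vinv_mapK.
Qed.

Lemma nrel_mul u v i j : nrel u v -> nrel (upd u i (u i * u j)) (upd v i (v i * v j)).
Proof.
case=> f Nf fu; exists f => // k; have [Di ei] := fu i; have [Dj ej] := fu j.
by rewrite /upd; case: ifP => _ //; rewrite vmapM // ei ej; split=> //; apply: sgM.
Qed.

Lemma nrel_inv u v i : nrel u v -> nrel (upd u i (u i)^-1) (upd v i (v i)^-1).
Proof.
case=> f Nf fu; exists f => // k; have [Di ei] := fu i.
by rewrite /upd; case: ifP => _ //; rewrite vmapV // ei; split=> //; apply: sgV.
Qed.

Lemma nrel_mulV u v i j : nrel u v -> nrel (upd u i (u i * (u j)^-1)) (upd v i (v i * (v j)^-1)).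
Proof.
case=> f Nf fu; exists f => // k; have [Di ei] := fu i; have [Dj ej] := fu j.
by rewrite /upd; case: ifP => _ //; rewrite vmapF // ei ej; split=> //; apply: sgF.
Qed.

Lemma nrel_reindex (J : eqType) (s : J -> I) u v : nrel u v -> nrel (u \o s) (v \o s).
Proof. by case=> f Nf fu; exists f => // j; apply: fu. Qed.

(** On [A] the map [h] agrees with an element of [N], since it does so on generators. *)
Lemma inN_of_nrel A (b : I -> G) (h : virtual_iso G) : finite_index A -> gens A b ->
  (A : set G) `<=` vdom h -> (forall i, A (b i)) -> nrel b (h \o b) -> inN h.
Proof.
move=> fA gb Ah Ab [f Nf fb]; apply: inN_vequiv Nf; apply/vequivP; exists A => // x Ax.
pose K := @Subgroup G [set x | [/\ vdom f x, vdom h x & f x = h x]].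
have K1 : [/\ vdom f 1, vdom h 1 & f 1 = h 1] by rewrite !vmap1; split=> //; apply: sg1.
have KF a c : [/\ vdom f a, vdom h a & f a = h a] -> [/\ vdom f c, vdom h c & f c = h c] ->
    [/\ vdom f (a * c^-1), vdom h (a * c^-1) & f (a * c^-1) = h (a * c^-1)].
  by move=> [? ? e] [? ? e']; rewrite !vmapF // e e'; split=> //; apply: sgF.
apply: (gb (K K1 KF)) => // i; have [D e] := fb i; split=> //; exact/Ah/Ab.
Qed.

Lemma nrel_image A B u v : gens A u -> (forall i, A (u i)) -> gens B v -> (forall i, B (v i)) ->
  nrel u v -> exists f, [/\ inN f, (A : set G) `<=` vdom f, vimage f A = B & forall i, f (u i) = v i].
Proof.
move=> gu Au gv Bv [f Nf fu].
have Af : (A : set G) `<=` vdom f by apply: gu => i; case: (fu i).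
exists f; split=> // [|i]; last by case: (fu i).
apply: sub_eq.
  suff AB : (A : set G) `<=` vpreim f B by move=> _ [x [_ /AB [_ Bx]] <-].
  by apply: gu => i; have [D e] := fu i; split=> //=; rewrite e.
by apply: gv => i; have [D e] := fu i; exists (u i).
Qed.

End Nrel.

(** An isomorphism between finite-index subgroups, as an element of the commensurator. *)
Lemma basis_iso A B (I : Type) (u v : I -> G) : finite_index A -> finite_index B ->
  sbasis A u -> sbasis B v ->
  exists h : virtual_iso G, [/\ vdom h = A, vcod h = B & forall i, h (u i) = v i].
Proof.
move=> fA fB ub vb; have Au := sb_in ub; have Bv := sb_in vb.
have [f fM fu] := sb_ext ub v; have [g gM gv] := sb_ext vb u.
have fAB x : A x -> B (f x).
  suff AB : (A : set G) `<=` sgpreim fM B by move=> /AB [].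
  by apply: (sb_gen ub) => i; split=> //=; rewrite fu.
have gBA x : B x -> A (g x).
  suff AB : (B : set G) `<=` sgpreim gM A by move=> /AB [].
  by apply: (sb_gen vb) => i; split=> //=; rewrite gv.
have gfM : mult_on A (g \o f).
  by move=> x y Ax Ay /=; rewrite fM // gM //; apply: fAB.
have fgM : mult_on B (f \o g).
  by move=> x y Ax Ay /=; rewrite gM // fM //; apply: gBA.
have fK x : A x -> g (f x) = x.
  apply: (mult_on_eq (f := g \o f) (g := id) (sb_gen ub) Au) => // i.
  by rewrite /= fu gv.
have gK x : B x -> f (g x) = x.
  apply: (mult_on_eq (f := f \o g) (g := id) (sb_gen vb) Bv) => // i.
  by rewrite /= gv fu.
have fB' : set_bij A B f.
  split=> //; first by move=> x y; rewrite !inE => Ax Ay /(congr1 g); rewrite !fK.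
  by move=> y By; exists (g y); [apply: gBA | apply: gK].
by exists (VirtualIso fA fB fM fB').
Qed.

Lemma sbasis_vimage A (I : Type) (u : I -> G) f : (A : set G) `<=` vdom f ->
  sbasis A u -> sbasis (vimage f A) (f \o u).
Proof.
move=> Af ub; have Au := sb_in ub; split.
- by move=> i; exists (u i) => //; split=> //; apply: Af.
- move=> K Ku _ [x [Dx Ax] <-]; suff : vpreim f K x by case.
  by apply: (sb_gen ub) Ax => i; split; [apply: Af; apply: Au | apply: Ku].
- move=> H h; have [p pM pu] := sb_ext ub h.
  exists (p \o vinv_map f) => [_ _ [x [Dx Ax] <-] [y [Dy Ay] <-]|i] /=.
    by rewrite -vmapM // !vinv_mapK ?pM //; apply: sgM. 
  by rewrite vinv_mapK ?pu //; apply: Af; apply: Au.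
Qed.

(** ** Inner elements *)

Definition inNg (g : G) : Prop := inN (vconj g).

Lemma vconjM (g h : G) : vequiv (vcomp (vconj g) (vconj h)) (vconj (g * h)).
Proof. by apply/vequivP; exists sgtop => [|x _]; [apply: finite_index_top | split=> //=; gsimp]. Qed.

(** The intersection of [N] with the image of the group in its commensurator. *)
Program Definition innN : subgroup G := @Subgroup G [set g | inNg g] _ _.
Next Obligation.
apply: inN_vequiv inN_id; apply/vequivP; exists sgtop => [|x _]; first exact: finite_index_top.
by split=> //=; gsimp.
Qed.
Next Obligation.
move=> g h /= Ng Nh; apply: inN_vequiv (vconjM g h^-1) _; apply: inN_comp => //.
apply: inN_vequiv (inN_inv Nh); apply/vequivP; exists sgtop => [|x _]; first exact: finite_index_top.
split=> //=; apply: (@vmap_inj _ (vconj h)) => //=.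
by have [_ /= ->] := @vinv_mapP _ (vconj h) x I; gsimp.
Qed.

Lemma vconj_vmap f (g : G) : vdom f g ->
  vequiv (vcomp f (vcomp (vconj g) (vinv f))) (vconj (f g)).
Proof.
move=> Dg; apply/vequivP; exists (vcod f) => [|x Cx]; first exact: vcod_fi.
have [D e] := vinv_mapP Cx; have Dg' := sgV Dg.
split=> //; last by rewrite /= !vmapM ?vmapV ?e //; apply: sgM.
apply/vdom_comp; split; first by apply/vdom_comp.
by apply: sgM => //; apply: sgM.
Qed.

Lemma innN_vmap f (g : G) : vdom f g -> innN g -> innN (f g).
Proof. by move=> Dg /= /(inN_conj f); apply: inN_vequiv; apply: vconj_vmap. Qed.

Lemma nrel_conj (I : eqType) (g : G) (u : I -> G) : innN g -> nrel u (fun i => g * u i * g^-1).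
Proof. by move=> Ng; exists (vconj g). Qed.

End NormalInComm.
(** * Nielsen moves in a normal subgroup *)

Section Transvections.
Variables (G : groupType) (N : normal_subgroup (Comm G)).

Definition tv (I : eqType) (b : I -> G) i j := upd b i (b i * b j).

Lemma tv_map (h : virtual_iso G) (I : eqType) (b : I -> G) i j :
  (forall k, vdom h (b k)) -> h \o tv b i j =1 tv (h \o b) i j.
Proof. by move=> hb k; rewrite /tv /upd /=; case: ifP => // _; rewrite vmapM. Qed.

Lemma tv_in (A : subgroup G) (I : eqType) (b : I -> G) i j :
  (forall k, A (b k)) -> forall k, A (tv b i j k).
Proof. by move=> Ab k; rewrite /tv /upd; case: ifP => // _; apply: sgM. Qed.

Section SameIndex.
Variables (D : subgroup G) (J : finType).
Hypothesis fD : finite_index D.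

(** Conjugate by the automorphism of [D] that maps [b] to [b']. *)
Lemma tv_transport (b b' : J -> G) i j l m : sbasis D b -> sbasis D b' ->
  nrel N (tv b i j) (tv b l m) -> nrel N (tv b' i j) (tv b' l m).
Proof.
move=> bb bb'; have [h [hD _ hb]] := basis_iso fD fD bb bb'.
have Db k : vdom h (b k) by rewrite hD; apply: (sb_in bb).
have eb : h \o b =1 b' by move=> k; apply: hb.
move=> /(@nrel_post _ N _ h) => /(_ (tv_in _ _ Db) (tv_in _ _ Db)).
by apply: nrel_eq => k; rewrite tv_map // (funext eb).
Qed.

Lemma tv_perm (b : J -> G) (s : {perm J}) i j l m :
  nrel N (tv (b \o s) i j) (tv (b \o s) l m) -> nrel N (tv b (s i) (s j)) (tv b (s l) (s m)).
Proof.
move=> /(nrel_reindex (s^-1)%g); apply: nrel_eq => k;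
  by rewrite /tv /upd /= permKV -(inj_eq (@perm_inj _ s)) permKV.
Qed.

Variables (b0 : J -> G) (a1 a2 c1 c2 : J).
Hypotheses (b0b : sbasis D b0) (u0 : uniq [:: a1; a2; c1; c2]).
Hypothesis r0 : nrel N (tv b0 a1 a2) (tv b0 c1 c2).

(** Permuting the basis, the hypothesis [r0] holds for any four distinct indices. *)
Let tv4 (b : J -> G) i j l m : sbasis D b -> uniq [:: i; j; l; m] ->
  nrel N (tv b i j) (tv b l m).
Proof.
move=> bb u1.
pose src := tnth [tuple a1; a2; c1; c2]; pose dst := tnth [tuple i; j; l; m].
have inj4 (t : 4.-tuple J) : uniq t -> injective (tnth t).
  by move=> ut; apply/tuple_uniqP.
have [s sP] := @perm_extend J _ (enum 'I_4) src dst (enum_uniq _)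
  (in2W (inj4 [tuple a1; a2; c1; c2] u0)) (in2W (inj4 [tuple i; j; l; m] u1)).
have E (n : 'I_4) : s (src n) = dst n by apply: sP; rewrite mem_enum.
have [e1 e2] := (E (@Ordinal 4 0 isT), E (@Ordinal 4 1 isT)).
have [e3 e4] := (E (@Ordinal 4 2 isT), E (@Ordinal 4 3 isT)).
rewrite /src /dst !(tnth_nth a1) /= in e1 e2 e3 e4.
rewrite -e1 -e2 -e3 -e4; apply: tv_perm; apply: tv_transport b0b _ r0.
exact: nl_sbasis bb (nl_perm b s).
Qed.

(** Modulo [N] the transvection along [(i, j)] equals the one along [(l, m)],
    which commutes with the transvection along [(k, i)]; the commutator of the
    first with the latter is the transvection along [(k, j)]. *)
Let tv5 (b : J -> G) i j k l m : sbasis D b -> uniq [:: i; j; k; l; m] -> nrel N b (tv b k j).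
Proof.
move=> bb; rewrite /= !inE !negb_or -!andbA => /and5P [ij ik il im /and5P [jk jl jm kl /and3P [km lm _]]].
have [ki ji kj li mi] : [/\ k != i, j != i, k != j, l != i & m != i] by rewrite ![_ == i]eq_sym [k == j]eq_sym.
have [lk mk mj lj ml] : [/\ l != k, m != k, m != j, l != j & m != l] by rewrite ![_ == k]eq_sym ![_ == j]eq_sym [m == l]eq_sym.
pose ne := (negbTE ij, negbTE ik, negbTE il, negbTE jk, negbTE kl, negbTE ki, negbTE ji,
  negbTE kj, negbTE li, negbTE mi, negbTE lk, negbTE mk).
have step (c : J -> G) : sbasis D c ->
    nrel N (upd c k (c k * (c i * c j))) (upd c k (c k * c i)).
  move=> cb.
  have r1 : nrel N (tv c i j) (tv c l m) by apply: tv4 => //; rewrite /= !inE !negb_or ij il im jl jm lm.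
  have r2 : nrel N (tv (tv c k i) i j) (tv (tv c k i) l m).
    apply: tv4; last by rewrite /= !inE !negb_or ij il im jl jm lm.
    exact: nl_sbasis cb (nl_mul1 c ki).
  have r2' : nrel N (tv (tv c k i) i j) (upd (tv c l m) k (tv c l m k * tv c l m i)).
    apply: nrel_eq r2 => // n; rewrite /tv /upd ?eqxx ?ne.
    by have [->|nk] := eqVneq n k; rewrite ?ne.
  have r3 := nrel_mulV i j (nrel_trans (nrel_mul k i r1) (nrel_sym r2')).
  apply: nrel_eq r3 => n; rewrite /tv /upd !eqxx !ne ?eqxx.
    have [->|nk] := eqVneq n k; rewrite ?ne //.
    by have [->|] // := eqVneq n i; rewrite mulgK.
  have [->|nk] := eqVneq n k; rewrite ?ne //.
  by have [->|] // := eqVneq n i; rewrite mulgK.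
have bb' : sbasis D (upd b k (b k * (b i)^-1)) := nl_sbasis bb (nl_mulV b ki).
apply: nrel_sym; apply: nrel_eq (step _ bb') => n; rewrite /tv /upd !eqxx !ne.
  by case: eqP => // _; rewrite mulgA mulgVK.
by case: eqP => [->|//]; rewrite mulgVK.
Qed.

Hypothesis J5 : (5 <= #|J|)%N.

Lemma nrel_tv (b : J -> G) k j : sbasis D b -> k != j -> nrel N b (tv b k j).
Proof.
move=> bb kj; have : (2 < #|~: [set k; j]%SET|)%N.
  by have := cardsC [set k; j]%SET; rewrite cards2 kj; move: #|~: _| J5 => *; lia.
case/card_gt2P => i [l [m [[]]]]; rewrite !inE !negb_or.
move=> /andP [ik ij] /andP [lk lj] /andP [mk mj] [il lm mi].
apply: (@tv5 b i j k l m) => //; rewrite /= !inE !negb_or ij ik il [i == m]eq_sym mi.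
by rewrite [j == k]eq_sym kj [j == l]eq_sym lj [j == m]eq_sym mj [k == l]eq_sym lk [k == m]eq_sym mk lm.
Qed.

(** A right multiplication becomes a left one in the basis where the entry is inverted;
    alternating both kinds turns [(a, b)] into [(b, a^-1)], whose square inverts
    both entries. *)
Lemma nrel_inv2 (b : J -> G) i j : sbasis D b -> i != j ->
  nrel N b (upd (upd b i (b i)^-1) j (b j)^-1).
Proof.
move=> bb ij; have ji : j != i by rewrite eq_sym.
have right (c : J -> G) k l : sbasis D c -> k != l -> nrel N c (upd c k (c k * (c l)^-1)).
  move=> cb kl; have lk : (l == k) = false by rewrite eq_sym (negbTE kl).
  apply: nrel_sym; apply: nrel_eq (nrel_tv (nl_sbasis cb (nl_mulV c kl)) kl) => // n.
  by rewrite /tv /upd eqxx lk mulgVK; case: eqP => [->|].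
have left (c : J -> G) k l : sbasis D c -> k != l -> nrel N c (upd c k (c l * c k)).
  move=> cb kl; have lk : (l == k) = false by rewrite eq_sym (negbTE kl).
  apply: nrel_eq (nrel_inv k (right _ k l (nl_sbasis cb (nl_inv1 c k)) kl)) => n.
    by rewrite /upd eqxx invgK; case: eqP => [->|].
  by rewrite /upd !eqxx lk invgM !invgK; case: eqP.
have rot (c : J -> G) : sbasis D c -> nrel N c (upd (upd c i (c j)) j (c i)^-1) /\
    sbasis D (upd (upd c i (c j)) j (c i)^-1).
  move=> cb; have b1 := nl_sbasis cb (nl_mul1 c ij).
  have b2 := nl_sbasis b1 (nl_mulV _ ji).
  have r := nrel_trans (nrel_trans (nrel_tv cb ij) (right _ j i b1 ji)) (left _ i j b2 ij).
  have b3 := nl_sbasis b2 (nl_lmul _ ij).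
  set d := upd _ i _ in r b3.
  suff <- : d = upd (upd c i (c j)) j (c i)^-1 by [].
  apply: funext => n; rewrite /d /tv /upd !eqxx (negbTE ij) (negbTE ji).
  have [->|nj] := eqVneq n j; first by rewrite (negbTE ji); gsimp.
  by case: eqP => // _; gsimp.
have [r1 b1] := rot b bb; have [r2 _] := rot _ b1.
apply: nrel_eq (nrel_trans r1 r2) => // n.
rewrite /upd !eqxx (negbTE ij); case: eqP => // _; by case: eqP.
Qed.

End SameIndex.

(** The conjugation by the inverse of [x t] sends, in the subgroup of index two, the
    entries coming from [C] to their conjugates. Comparing it with its conjugate by a
    transvection identifies, modulo [N], that transvection with its mirror image. *)
Lemma mirror_transvections (C : subgroup G) (I : finType) (x : I -> G) t i j :
  sbasis C x -> finite_index C -> innN N (x t) -> i != j -> i != t -> j != t ->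
  exists (D : subgroup G) (J : finType) (b : J -> G) (jl jr : I -> J),
  [/\ sbasis D b, (D : set G) `<=` C, finite_index D, (5 <= #|J|)%N &
    nrel N (tv b (jl i) (jl j)) (tv b (jr i) (jr j))] /\
  [/\ forall i, i != t -> b (jl i) = x i,
      forall i, i != t -> b (jr i) = (x t)^-1 * x i * x t,
      b (jr t) = x t * x t &
      [/\ forall i i', i != t -> i' != t -> jl i = jl i' -> i = i', injective jr,
          forall i i', i != t -> jl i != jr i' &
          forall j, (exists2 i, i != t & j = jl i) \/ (exists i, j = jr i)]].
Proof.
move=> xb fC Nt ij it jt.
have [D [J [b [jl [jr [[bb DC _] [[k kP] [bl br bt [jlI jrI jlr jsurj]]]]]]]]] := index_two_basis t xb.
have fD := finite_index_trans fC kP.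
exists D, J, b, jl, jr; split=> //.
have Db := sb_in bb.
have u4 : uniq [:: jl i; jl j; jr i; jr j].
  rewrite /= !inE !negb_or !jlr //= (inj_eq jrI) ij !andbT.
  by apply: contraNneq ij => /jlI ->.
split=> //.
  have : uniq [:: jr t; jl i; jl j; jr i; jr j].
    by rewrite cons_uniq u4 !inE !negb_or ![jr t == jl _]eq_sym !jlr //= !(inj_eq jrI) eq_sym it eq_sym jt.
  by move/card_uniqP => /= <-; apply: max_card.
have Nt' : innN N (x t)^-1 by apply: sgV.
pose p := tv b (jl i) (jl j); pose q := tv b (jr i) (jr j).
have qb : sbasis D q.
  by apply: nl_sbasis bb (nl_mul1 b _); rewrite (inj_eq jrI).
have [h [hD _ hb]] := basis_iso fD fD bb qb.
have hDb k' : vdom h (b k') by rewrite hD.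
pose ga (u : J -> G) k' := (x t)^-1 * u k' * ((x t)^-1)^-1.
have gal i' : i' != t -> ga b (jl i') = b (jr i') by move=> i't; rewrite /ga bl // br // invgK.
have gar i' : i' != t -> ga b (jr i') = (b (jr t))^-1 * b (jl i') * b (jr t).
  by move=> i't; rewrite /ga br // bl // bt; gsimp.
have gat : ga b (jr t) = b (jr t) by rewrite /ga bt; gsimp.
have gaD k' : D (ga b k').
  have [[i' i't ->]|[i' ->]] := jsurj k'; first by rewrite gal.
  have [->|i't] := eqVneq i' t; first by rewrite gat.
  by rewrite gar //; apply: sgM => //; apply: sgM => //; apply: sgV.
have hga k' : h (ga b k') = ga p k'.
  have jrt : jr t != jr i by rewrite (inj_eq jrI) eq_sym.
  have gp k2 : k2 != jl i -> ga p k2 = ga b k2 by move=> k2i; rewrite /ga /p /tv /upd (negbTE k2i).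
  have hq k2 : k2 != jr i -> h (b k2) = b k2 by move=> k2i; rewrite hb /q /tv /upd (negbTE k2i).
  have [[i' i't ->]|[i' ->]] := jsurj k'.
    rewrite gal // hb /q /tv /upd (inj_eq jrI); have [->|ii'] := eqVneq i' i.
      by rewrite -!gal // /ga /p /tv /upd eqxx; gsimp.
    rewrite gp ?gal //; apply: contraNneq ii' => /jlI -> //.
  rewrite gp; last by rewrite eq_sym jlr.
  have [->|i't] := eqVneq i' t; first by rewrite gat hq.
  by rewrite gar // !vmapM ?vmapV //; [rewrite !hq ?jlr | apply: sgV | apply: sgM => //; apply: sgV].
have r1 : nrel N p (ga p) := nrel_conj p Nt'.
have r2 : nrel N (h \o b) (h \o ga b).
  by apply: nrel_post (nrel_conj b Nt') => // k'; rewrite hD; apply: gaD.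
apply: nrel_trans r1 (nrel_sym _); apply: nrel_eq r2 => // k'; exact: hb.
Qed.

Section NielsenInN.
Variables (C : subgroup G) (I : finType).
Hypotheses (fC : finite_index C) (CN : (C : set G) `<=` innN N) (I3 : (3 <= #|I|)%N).
Implicit Type x : I -> G.

Let third (i j : I) : exists2 t, i != t & j != t.
Proof.
have : (0 < #|~: [set i; j]%SET|)%N.
  have := cardsC [set i; j]%SET; rewrite cards2; case: (_ != _); move: #|~: _| I3 => *; lia.
by case/card_gt0P => t; rewrite !inE negb_or ![t == _]eq_sym => /andP [it jt]; exists t.
Qed.

Let restrict x y (D : subgroup G) (J : eqType) (b : J -> G) (h : virtual_iso G) :
  (D : set G) `<=` C -> finite_index D -> sbasis D b -> vdom h = C ->
  (forall i, C (x i)) -> (forall i, h (x i) = y i) -> nrel N b (h \o b) -> nrel N x y.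
Proof.
move=> DC fD bb hC Cx hx r; exists h; last by move=> i; rewrite hC.
apply: inN_of_nrel fD (sb_gen bb) _ (sb_in bb) r.
by rewrite hC.
Qed.

(** The restriction to [D] is the product of a transvection and its mirror image. *)
Lemma nrel_transvection x i j : sbasis C x -> i != j -> nrel N x (tv x i j).
Proof.
move=> xb ij; have [t it jt] := third i j; have Cx := sb_in xb.
have [D [J [b [jl [jr [[bb DC fD J5 r] [bl br bt [jlI jrI jlr jsurj]]]]]]]] :=
  mirror_transvections xb fC (CN (Cx t)) ij it jt.
have [h [hC _ hx]] := basis_iso fC fC xb (nl_sbasis xb (nl_mul1 x ij)).
have ne : jl i != jl j by apply: contraNneq ij => /jlI ->.
have ner : jr i != jr j by rewrite (inj_eq jrI).
have u4 : uniq [:: jl i; jl j; jr i; jr j].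
  by rewrite /= !inE !negb_or !jlr //= ner ne.
have T := nrel_tv fD bb u4 r J5.
apply: (restrict DC fD bb hC Cx hx).
apply: nrel_eq (nrel_trans (T _ _ _ bb ne) (T _ _ _ (nl_sbasis bb (nl_mul1 b ne)) ner)) => // k.
have hxn k2 : k2 != i -> h (x k2) = x k2 by move=> k2i; rewrite hx /upd (negbTE k2i).
have hxi : h (x i) = x i * x j by rewrite hx /upd eqxx.
have ti : t != i by rewrite eq_sym.
have hCx k2 : vdom h (x k2) by rewrite hC.
rewrite /=; have [[i' i't ->]|[i' ->]] := jsurj k.
  rewrite /tv {1}/upd (negbTE (jlr _ _ i't)) /upd (bl i') //.
  have [->|ii'] := eqVneq i' i; first by rewrite eqxx hxi !bl.
  rewrite hxn //; case: eqP => // /jlI e; case/eqP: ii'; exact: e.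
have [->|i't] := eqVneq i' t.
  rewrite /tv /upd (inj_eq jrI) (negbTE ti) eq_sym (negbTE (jlr _ _ it)) bt.
  by rewrite vmapM // !hxn.
rewrite (br i') // !vmapM ?vmapV //; [|exact: sgV|by apply: sgM => //; apply: sgV].
rewrite hxn // /tv /upd (inj_eq jrI) ![jr _ == jl _]eq_sym !(negbTE (jlr _ _ it)).
have [->|ii'] := eqVneq i' i; first by rewrite hxi !br //; gsimp.
by rewrite hxn // br.
Qed.

(** The restriction to [D] inverts two basis elements; a single inversion would not be a
    product of transvections, whereas this one is. *)
Lemma nrel_inversion x i : sbasis C x -> nrel N x (upd x i (x i)^-1).
Proof.
move=> xb; have Cx := sb_in xb; have [t it _] := third i i; have [j ij tj] := third i t.
have jt : j != t by rewrite eq_sym.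
have [D [J [b [jl [jr [[bb DC fD J5 r] [bl br bt [jlI jrI jlr jsurj]]]]]]]] :=
  mirror_transvections xb fC (CN (Cx t)) ij it jt.
have [h [hC _ hx]] := basis_iso fC fC xb (nl_sbasis xb (nl_inv1 x i)).
have ne : jl i != jl j by apply: contraNneq ij => /jlI ->.
have ner : jr i != jr j by rewrite (inj_eq jrI).
have u4 : uniq [:: jl i; jl j; jr i; jr j].
  by rewrite /= !inE !negb_or !jlr //= ner ne.
apply: (restrict DC fD bb hC Cx hx).
apply: nrel_eq (nrel_inv2 fD bb u4 r J5 bb (jlr i i it)) => // k.
have hxn k2 : k2 != i -> h (x k2) = x k2 by move=> k2i; rewrite hx /upd (negbTE k2i).
have hxi : h (x i) = (x i)^-1 by rewrite hx /upd eqxx.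
have ti : t != i by rewrite eq_sym.
have hCx k2 : vdom h (x k2) by rewrite hC.
rewrite /=; have [[i' i't ->]|[i' ->]] := jsurj k.
  rewrite /upd (negbTE (jlr _ _ i't)) (bl i') //.
  have [->|ii'] := eqVneq i' i; first by rewrite eqxx hxi bl.
  rewrite hxn //; case: eqP => // /jlI e; case/eqP: ii'; exact: e.
have [->|i't] := eqVneq i' t.
  rewrite /upd (inj_eq jrI) (negbTE ti) eq_sym (negbTE (jlr _ _ it)) bt.
  by rewrite vmapM // !hxn.
rewrite (br i') // !vmapM ?vmapV //; [|exact: sgV|by apply: sgM => //; apply: sgV].
rewrite hxn // /upd (inj_eq jrI) [jr _ == jl _]eq_sym (negbTE (jlr _ _ it)).
have [->|ii'] := eqVneq i' i; first by rewrite hxi br //; gsimp.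
by rewrite hxn // br.
Qed.

Theorem nrel_nielsen x y : sbasis C x -> nielsen x y -> nrel N x y.
Proof.
move=> xb; elim=> [|{}y i j ij xy IH|{}y i xy IH]; first exact: nrel_refl.
  exact: nrel_trans IH (nrel_transvection (nl_sbasis xb xy) ij).
exact: nrel_trans IH (nrel_inversion i (nl_sbasis xb xy)).
Qed.

End NielsenInN.
End Transvections.
(** ** A finite-index subgroup of inner elements *)

Section InnerElements.
Variables (G : groupType) (N : normal_subgroup (Comm G)).

(** The commutator of [f] with the conjugation by [a] is the conjugation by [f a * a^-1]. *)
Lemma innN_nontrivial : (N : set (Comm G)) <> [set 1] -> exists2 g, innN N g & g != 1.
Proof.
move=> N1; have [c Nc c1] : exists2 c, N c & c != 1.
  apply: contrapT => none; apply: N1; apply/seteqP; split=> [c Nc|_ ->]; last exact: sg1.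
  by apply: contrapT => c1; apply: none; exists c => //; apply/eqP.
pose f := repr c; have fc : \pi_(Comm G) f = c by apply: reprK.
have [a Da fa] : exists2 a, vdom f a & f a != a.
  apply: contrapT => none; case/eqP: c1; rewrite -fc; apply/commP/vequivP.
  exists (vdom f) => [|x Dx]; first exact: vdom_fi.
  by split=> //; apply: contrapT => fx; apply: none; exists x => //; apply/eqP.
exists (f a * a^-1); last by apply: contraNneq fa => e; rewrite -[f a](mulgVK a) e mul1g.
pose ca := \pi_(Comm G) (vconj a).
have e1 : \pi_(Comm G) (vconj (f a)) = c * (ca * c^-1).
  rewrite -fc /ca -[_^-1]/(comm_inv _) pi_commV -[_ * _]/(comm_mul _ (comm_mul _ _)) !pi_commM.
  by apply/esym/commP/vconj_vmap.
have e2 : \pi_(Comm G) (vconj (f a * a^-1)) * ca = \pi_(Comm G) (vconj (f a)).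
  rewrite /ca -[LHS]/(comm_mul _ _) pi_commM -[in RHS](mulgVK a (f a)); apply/commP/vconjM.
have e3 : \pi_(Comm G) (vconj (f a * a^-1)) = c * (c^-1 ^ ca^-1).
  by rewrite conjgE invgK -[LHS](mulgK ca) e2 e1; gsimp.
rewrite /innN /= /inNg /inN e3; apply: sgM => //; apply: nsgP; exact: sgV.
Qed.

Variables (I : finType) (x : I -> G).
Hypothesis xb : sbasis sgtop x.

Local Notation nf := (nf sgtop x).

(** An element of minimal length is cyclically reduced, hence part of a basis of
    a finite-index subgroup; permuting that basis gives the other elements. *)
Lemma innN_finite_index : (N : set (Comm G)) <> [set 1] ->
  exists2 A : subgroup G, finite_index A & (A : set G) `<=` innN N.
Proof.
move=> /innN_nontrivial [g0 Ng0 g01].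
pose Q n := `[< exists g, [/\ innN N g, g != 1 & size (nf g) = n] >].
have exQ : exists n, Q n by exists (size (nf g0)); apply/asboolP; exists g0.
case: (ex_minnP exQ) => l /asboolP [g [Ng g1 sg]] minl.
have gE : weval x (nf g) = g by apply: (nfK xb).
have rw := nf_reduced sgtop x g.
case: l sg minl => [|n] sg minl; first by case/eqP: g1; rewrite -gE (size0nil sg).
have [a0 _] : exists a : letter I, True by case: (nf g) sg => // a; exists a.
set w := nf g in gE rw sg.
have wrap : nth a0 w n != linv (nth a0 w 0).
  apply/eqP; clearbody w => e; case: w e sg rw gE => // c [|d v] /= e sg rw gE.
    by case: sg e => <- /= /esym/eqP; rewrite (negbTE (linv_neq _)).
  have en : n = (size v).+1 by case: sg.
  move: e; rewrite en -[LHS]/(nth a0 (d :: v) (size (d :: v)).-1) nth_last /= => e.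
  have ev : d :: v = belast d v ++ [:: linv c] by rewrite cats1 -e -lastI.
  have h : weval x (belast d v) = (leval x c)^-1 * g * ((leval x c)^-1)^-1.
    rewrite -gE -[leval x d * weval x v]/(weval x (d :: v)) ev weval_cat /= mulg1 leval_inv.
    by gsimp.
  have : (n.+1 <= size (belast d v))%N.
    apply: minl; apply/asboolP; exists (weval x (belast d v)); split.
    - by rewrite h; apply: (innN_vmap (f := vconj (leval x c)^-1)).
    - rewrite h; apply: contraNneq g1 => e1; apply/eqP.
      have -> : g = leval x c * ((leval x c)^-1 * g * ((leval x c)^-1)^-1) * (leval x c)^-1 by gsimp.
      by rewrite e1; gsimp.
    - rewrite (nf_weval xb) //; case/andP: rw => _.
      by rewrite -[_ && _]/(reduced (d :: v)) ev reduced_catE => /and3P [].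
  by rewrite size_belast en; lia.
pose b (j : 'I_n.+1) := nth a0 w (n - j).
have bcyc j : b (ordS j) != linv (b j).
  rewrite /b /=; have jn := ltn_ord j; have [jlt|jeq] : (j < n)%N \/ (j : nat) = n by lia.
    rewrite modn_small ?ltnS // -(inv_eq (@linvK _)) eq_sym.
    have -> : (n - j = (n - j.+1).+1)%N by lia.
    by apply: reduced_nth => //; rewrite sg; lia.
  by rewrite jeq modnn subn0 subnn.
have cw m : (m <= n.+1)%N -> cycword x b m = weval x (drop (n.+1 - m) w).
  elim: m => [|m IH] mn; first by rewrite subn0 -sg drop_size.
  rewrite /= IH; last exact: ltnW.
  rewrite [in RHS](drop_nth a0); last by rewrite sg; lia.
  rewrite /= /b inordK //; congr (leval x (nth _ _ _) * weval x (drop _ _)); lia.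
have [A [J [y [j [yb _ [k kP] yj]]]]] := cyclic_word_primitive xb bcyc.
have fA := finite_index_trans (finite_index_top G) kP.
exists A => //; apply: (sb_gen yb) => j'.
have Nyj : innN N (y j).
  by rewrite cw // subnn drop0 gE in yj; case: yj => ->; [|apply: sgV].
have zb := nl_sbasis yb (nl_perm y (tperm j j')).
have [h [hA _ hy]] := basis_iso fA fA yb zb.
have := @innN_vmap _ N h (y j); rewrite hA hy /= tpermL; apply=> //; exact: (sb_in yb).
Qed.

End InnerElements.

(** * Subnormal subgroups with the same composition factors *)

Section Conjugate.
Variables (G : groupType) (N : normal_subgroup (Comm G)).
Implicit Types (A B C D H : subgroup G).

(** Conjugacy of subgroups under the elements of [N] defined on them. *)
Definition Nconj A B := exists f : virtual_iso G,
  [/\ inN N f, (A : set G) `<=` vdom f & vimage f A = B].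

Lemma Nconj_refl A : Nconj A A.
Proof.
exists (vid G); split=> //; first exact: inN_id.
by apply: sub_eq => [_ [x [_ Ax] <-]|x Ax] //; exists x.
Qed.

Lemma Nconj_sym A B : Nconj A B -> Nconj B A.
Proof.
case=> f [Nf Af <-]; exists (vinv f); split; first exact: inN_inv.
  by move=> _ [x [Dx _] <-]; apply: vmap_cod.
exact: vimage_inv.
Qed.

Lemma Nconj_trans A B C : Nconj A B -> Nconj B C -> Nconj A C.
Proof.
case=> f [Nf Af eB] [f' [Nf' Bf eC]]; exists (vcomp f' f); split; first exact: inN_comp.
  move=> x Ax; apply/vdom_comp; split; first exact: Af.
  by apply: Bf; rewrite -eB; exists x => //; split=> //; apply: Af.
by rewrite vimage_comp ?eB.
Qed.

Definition has_basis m H := exists (I : finType) (x : I -> G), sbasis H x /\ (m <= #|I|)%N.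

Lemma has_basis_sub m H A : (1 < m)%N -> has_basis m H -> (A : set G) `<=` H ->
  finite_index A -> has_basis m A.
Proof.
move=> m1 [I [x [xb mI]]] AH fA.
have [J [y [yb IJ _]]] := finite_index_basis xb AH fA (leq_trans m1 mI).
by exists J, y; split=> //; apply: leq_trans IJ.
Qed.

(** Send basis elements to the elements of the group, each of which is attained. *)
Lemma has_basis_epi m H S : has_basis m H -> (FS_card S <= m)%N ->
  exists A (p : G -> FS_group S), epi H A p.
Proof.
move=> [I [x [xb mI]]] Sm.
have [p pM px] := sb_ext xb (fun i => nth 1 (enum (FS_fin S)) (enum_rank i) : FS_group S).
exists (sgker pM), p; split=> // [s|a [] //|h Hh]; last by rewrite sgkerP; split=> [|[]].
have sI : (index (s : FS_fin S) (enum (FS_fin S)) < #|I|)%N.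
  by apply: leq_trans mI; apply: leq_trans Sm; rewrite /FS_card cardE index_mem mem_enum.
exists (x (enum_val (Ordinal sI))); first exact: (sb_in xb).
by rewrite px enum_valK /= nth_index // mem_enum.
Qed.

Lemma comp_exists m H l : (1 < m)%N -> finite_index H -> has_basis m H ->
  all (fun S => FS_card S <= m)%N l -> exists E, factors H E l.
Proof.
move=> m1; elim: l H => [|S l IH] H fH bH /=; first by exists H; apply: comp_nil.
case/andP=> Sm al; have [A [p pE]] := has_basis_epi bH Sm.
have fA : finite_index A := comp_finite_index (comp_cons pE (comp_nil A)) fH.
have [E cE] := IH A fA (has_basis_sub m1 bH (epi_sub pE) fA) al.
by exists E; exact: comp_cons pE cE.
Qed.

Variable m : nat.
Hypothesis m3 : (3 <= m)%N.

(** The images of a basis under both surjections are Nielsen equivalent, and the moves lift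
    to the basis. *)
Lemma epi_conj H A B S (p q : G -> FS_group S) : finite_index H -> (H : set G) `<=` innN N ->
  has_basis m H -> (3 * FS_card S <= m)%N -> epi H A p -> epi H B q ->
  exists f : virtual_iso G, [/\ inN N f, (H : set G) `<=` vdom f & vimage f B = A].
Proof.
move=> fH HN [I [x [xb mI]]] Sm pE qE; have Hx := sb_in xb.
have gS (r : G -> FS_group S) C : epi H C r -> gens [set: FS_fin S] (r \o x).
  move=> rE K Kr s _; have [h Hh <-] := epi_surj rE s.
  have rM := epi_mult rE; suff HK : (H : set G) `<=` sgpreim rM K by case: (HK h Hh).
  by apply: (sb_gen xb) => i; split; [apply: Hx | apply: Kr].
have nl := nl_transitive (leq_trans Sm mI) (gS p A pE) (gS q B qE).
have [y xy py] := nl_lift (epi_mult pE) Hx nl.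
have yb := nl_sbasis xb xy.
have [f [Nf Hf fH' fx]] := nrel_image (sb_gen xb) Hx (sb_gen yb) (sb_in yb)
  (nrel_nielsen fH HN (leq_trans m3 mI) xb xy).
have fHH h : H h -> H (f h) by move=> Hh; rewrite -fH'; exists h => //; split=> //; apply: Hf.
have pf h : H h -> p (f h) = q h.
  apply: (mult_on_eq (f := p \o f) (sb_gen xb) Hx).
  - by move=> a b Ha Hb /=; rewrite vmapM ?(epi_mult pE) //; try exact: Hf; apply: fHH.
  - exact: (epi_mult qE).
  - by move=> i /=; rewrite fx -[RHS]/((q \o x) i) -py.
exists f; split=> //; apply: sub_eq => [_ [b [_ Bb] <-]|a Aa].
  have Hb := epi_sub qE Bb; apply/(epi_ker pE); first exact: fHH.
  by rewrite pf //; apply/(epi_ker qE).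
have Ha := epi_sub pE Aa; have : vimage f H a by rewrite fH'.
case=> h [Dh Hh] e; exists h => //; split=> //.
by apply/(epi_ker qE) => //; rewrite -pf // e; apply/(epi_ker pE).
Qed.

(** If the first factors differ, both series are compared with a third subgroup,
    reached through the intersection of the two first terms, with the two first
    factors in either order. *)
Theorem comp_conj H A B l l' : finite_index H -> (H : set G) `<=` innN N -> has_basis m H ->
  all (fun S => 3 * FS_card S <= m)%N l -> factors H A l -> factors H B l' -> perm_eq l l' ->
  Nconj A B.
Proof.
have m1 : (1 < m)%N by apply: leq_trans m3.
have [n] := ubnP (size l); elim: n H A B l l' => // n IH H A B l l' sl fH HN bH al cA cB ll.
have same A' B' S k k' : (size (S :: k) < n.+1)%N -> all (fun S => 3 * FS_card S <= m)%N (S :: k) ->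
    factors H A' (S :: k) -> factors H B' (S :: k') -> perm_eq (S :: k) (S :: k') -> Nconj A' B'.
  rewrite /= ltnS => sk /andP [Sm ak] cA' cB'; rewrite perm_cons => kk.
  have [[] //|[A1 [S1 [p [k1 [[eS ek] pE cA1]]]]]] := comp_inv cA'.
  have [[] //|[B1 [S2 [q [k2 [[eS' ek'] qE cB1]]]]]] := comp_inv cB'.
  subst S1 S2 k1 k2.
  have [f [Nf Hf fB]] := epi_conj fH HN bH Sm pE qE.
  have B1f : (B1 : set G) `<=` vdom f by move=> b /(epi_sub qE) /Hf.
  have BB1 := comp_sub cB1.
  have cfB := comp_vimage cB1 B1f; rewrite fB in cfB.
  have fA1 : finite_index A1 := comp_finite_index (comp_cons pE (comp_nil A1)) fH.
  have A1N : (A1 : set G) `<=` innN N by move=> a /(epi_sub pE) /HN.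
  have bA1 := has_basis_sub m1 bH (epi_sub pE) fA1.
  apply: Nconj_trans (IH _ _ _ _ _ sk fA1 A1N bA1 ak cA1 cfB kk) (Nconj_sym _).
  by exists f; split=> // b /BB1 /B1f.
have [[el eA]|[A1 [S [p [l1 [el pE cA1]]]]]] := comp_inv cA.
  have el' : l' = [::] by apply: size0nil; rewrite -(perm_size ll) el.
  have [[_ eB]|[? [? [? [? [el2]]]]]] := comp_inv cB; last by rewrite el' in el2.
  by rewrite -eA -eB; apply: Nconj_refl.
have [[el' _]|[B1 [S' [q [l1' [el' qE cB1]]]]]] := comp_inv cB.
  by move: ll; rewrite el el' => /perm_size.
have [eS|nS] := eqVneq S S'.
  by move: sl al cA cB ll; rewrite el el' -eS; apply: same.
have cAB : epi A1 (sgcap B1 A1) q.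
  apply: (epi_cap qE pE) => /(epi_incomparable qE pE) e.
  by case/eqP: nS; move: qE; rewrite e => qE; exact: epi_eq_FS pE qE.
have cBA : epi B1 (sgcap A1 B1) p.
  apply: (epi_cap pE qE) => /(epi_incomparable pE qE) e.
  by case/eqP: nS; move: pE; rewrite e => pE; exact: epi_eq_FS pE qE.
have eD : sgcap B1 A1 = sgcap A1 B1 by apply: sub_eq => z [].
rewrite eD in cAB; set D := sgcap A1 B1 in cAB cBA.
have S'l1 : S' \in l1.
  have : S' \in l by rewrite (perm_mem ll) el' inE eqxx.
  by rewrite el inE eq_sym (negbTE nS).
have [l2 p1] : exists l2, perm_eq l1 (S' :: l2) by exists (rem S' l1); exact: perm_to_rem.
have p2 : perm_eq l1' (S :: l2).
  rewrite -(perm_cons S') -el' perm_sym.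
  apply: (perm_trans _ ll); rewrite el.
  apply: (@perm_trans _ (S :: S' :: l2)); last by rewrite perm_cons perm_sym.
  by apply/seq.permP => a /=; rewrite addnCA.
have al2 : all (fun S => FS_card S <= m)%N l2.
  apply/allP => T Tl2.
  have Tl : T \in l.
    rewrite el in_cons; apply/orP; right; rewrite (perm_mem p1) in_cons.
    by apply/orP; right.
  have h : (3 * FS_card T <= m)%N by apply: (allP al).
  exact: (leq_trans (leq_pmull (FS_card T) (isT : (0 < 3)%N)) h).
have fD : finite_index D.
  exact: comp_finite_index (comp_cons pE (comp_cons cAB (comp_nil D))) fH.
have DH : (D : set G) `<=` H by move=> z [/(epi_sub pE)].
have [E cE] := comp_exists m1 fD (has_basis_sub m1 bH DH fD) al2.
have cSS' := comp_cons pE (comp_cons cAB cE).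
have cS'S := comp_cons qE (comp_cons cBA cE).
apply: (@Nconj_trans _ E).
  apply: (same A E S l1 (S' :: l2) _ _ _ cSS'); try by rewrite -el.
  by rewrite perm_cons.
apply: Nconj_sym; apply: (same B E S' l1' (S :: l2) _ _ _ cS'S).
- by rewrite -el' -(perm_size ll).
- by rewrite -el' -(perm_all _ ll).
- by rewrite -el'.
- by rewrite perm_cons.
Qed.

End Conjugate.
(** * The monolith *)

(** A subgroup of index two is normal. *)
Lemma index_two_comp (G : groupType) (C D : subgroup G) (k : G -> bool) : (D : set G) `<=` C ->
  (forall g h, C g -> C h -> k g = k h -> D (g^-1 * h)) -> bcomp 2 C D.
Proof.
move=> DC kP; apply: comp_of_index; last first.
  exists (fun g => inord (k g)) => g h Cg Ch e; apply: kP => //.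
  by have := congr1 val e; rewrite /= !inordK //; case: (k g); case: (k h).
split=> // x h Dx Ch; have Cx := DC x Dx; have C1 := sg1 C.
have Cxh : C (x * h) by apply: sgM.
have [Dh|nDh] := pselect (D h).
  by rewrite conjgE; apply: sgM; [apply: sgV | apply: sgM].
(* Of the values of [k] at [1], [h] and [x * h], two coincide. *)
have k1h : k 1 <> k h by move/(kP 1 h C1 Ch); rewrite invg1 mul1g.
have k1xh : k 1 <> k (x * h).
  by move/(kP 1 _ C1 Cxh); rewrite invg1 mul1g => /(sgM (sgV Dx)); rewrite mulKg.
have : k h = k (x * h) by move: k1h k1xh; case: (k 1); case: (k h); case: (k (x * h)).
by move/(kP _ _ Ch Cxh); rewrite conjgE.
Qed.

(** Each passage to a subgroup of index two increases the rank and adds only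
    a factor of order two. *)
Lemma deep_subgroup (G : groupType) (C : subgroup G) m n : finite_index C -> has_basis 2 C ->
  (2 <= m)%N -> exists H : subgroup G, [/\ finite_index H, has_basis n H & bcomp m C H].
Proof.
move=> fC bC m2; elim: n => [|n [H [fH bH cH]]].
  exists C; split=> //; last by exists [::] => //; apply: comp_nil.
  by have [I [x [xb _]]] := bC; exists I, x.
have HC : (H : set G) `<=` C by case: cH => l /comp_sub.
have [I [x [xb nI]]] : has_basis (maxn 2 n) H.
  have [n2|n2] := leqP n 2; last by [].
  exact: (has_basis_sub _ bC HC fH).
have I2 : (1 < #|I|)%N by apply: leq_trans nI; apply: leq_maxl.
have [t _] : exists t : I, True by have /card_gt0P [t _] := ltnW I2; exists t.
have [D [J [b [jl [jr [[bb DH Dt] [[k kP] _]]]]]]] := index_two_basis t xb.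
have fD := finite_index_trans fH kP; exists D; split=> //.
  have [J' [y [yb _ lt]]] := finite_index_basis xb DH fD I2.
  have IJ := lt (ex_intro2 _ _ (x t) (sb_in xb t) Dt); exists J', y; split=> //; apply: leq_trans IJ.
  by rewrite ltnS; apply: leq_trans nI; apply: leq_maxr.
exact: bcomp_trans cH (bcomp_le m2 (index_two_comp DH kP)).
Qed.

Section Monolith.
Variables (G : groupType) (I : finType) (x : I -> G).
Hypotheses (xb : sbasis sgtop x) (I2 : (2 <= #|I|)%N).

(** The last step of the argument: [C] is the subgroup [H] below, [m] bounds the orders of all
    the factors that occur, and [phi] is the automorphism [g^-1 * f] of [A']. *)
Theorem ker_d_minimal (N : normal_subgroup (Comm G)) : (N : set (Comm G)) <> [set 1] ->
  (ker_d G : set (Comm G)) `<=` N.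
Proof.
move=> /(innN_finite_index xb) [F0 fF0 F0N] c /= dc.
have [f [a [b [fc [ca cb]]]]] := jump_exists c.
have ab : perm_eq a b.
  apply/allP => S _; apply/eqP; have := coeff_jump S fc (conj ca cb).
  by rewrite dc coeff0; move: (count _ _) (count _ _) => *; lia.
set A := vdom f in ca; set B := vcod f in cb.
have fA : finite_index A by apply: vdom_fi. have fB : finite_index B by apply: vcod_fi.
pose F1 := core F0; have fF1 : finite_index F1 by apply: core_fi.
have F1F0 : (F1 : set G) `<=` F0 by apply: core_sub.
have [c1 cF1] := comp_core fF0 (H := sgtop) (fun _ _ => Logic.I).
have [ma bA] := comp_bounded ca; have [mb bB] := comp_bounded cb.
have [m1 bF1] := comp_bounded cF1.
pose m := maxn 2 (maxn ma (maxn mb m1)).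
have {}bA : bcomp m sgtop A by apply: bcomp_le bA; rewrite /m !leq_max leqnn !orbT.
have {}bB : bcomp m sgtop B by apply: bcomp_le bB; rewrite /m !leq_max leqnn !orbT.
have {}bF1 : bcomp m sgtop F1 by apply: bcomp_le bF1; rewrite /m !leq_max leqnn !orbT.
have m2 : (2 <= m)%N by rewrite leq_maxl.
have gF1 : has_basis 2 F1.
  by apply: (has_basis_sub (H := sgtop)) => //; exists I, x.
have [H [fH gH bH1]] := deep_subgroup (3 * m) fF1 gF1 m2.
have HF1 : (H : set G) `<=` F1 by case: bH1 => l /comp_sub.
have bH : bcomp m sgtop H := bcomp_trans bF1 bH1.
have capT (K : subgroup G) : sgcap sgtop K = K by apply: sub_eq => [z []|z Kz].
have bAH : bcomp m A (sgcap H A) by have := bcomp_cap A bH; rewrite capT.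
have bBH : bcomp m B (sgcap H B) by have := bcomp_cap B bH; rewrite capT.
pose P := vimage (vinv f) (sgcap H B).
have bP : bcomp m A P.
  by have := @bcomp_vimage _ m (vinv f) _ _ bBH (fun x => id); rewrite vimage_dom.
pose A' := sgcap P (sgcap H A).
have bA' : bcomp m A A'.
  apply: bcomp_trans bAH _; have := bcomp_cap (sgcap H A) bP.
  by rewrite (_ : sgcap A _ = sgcap H A) //; apply: sub_eq => z; [case | case=> Hz Az; split].
have A'A : (A' : set G) `<=` A by move=> z [_ []].
have A'H : (A' : set G) `<=` H by move=> z [_ []].
pose B' := vimage f A'.
have B'H : (B' : set G) `<=` H.
  by move=> _ [z [_ [[y [Cy [Hy _]] <-] _]] <-]; rewrite /= (vinv_mapP Cy).2.
have [k ck ak] := bA'.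
have ck' : factors B B' k by have := comp_vimage ck (fun z => id); rewrite vimage_dom.
have into (K : subgroup G) : (K : set G) `<=` H -> bcomp m sgtop K -> bcomp m H K.
  move=> KH bK; have := bcomp_cap H bK; rewrite capT (_ : sgcap K H = K) //.
  by apply: sub_eq => z; [case | move=> Kz; split=> //; apply: KH].
have [a' ca' aa'] := into A' A'H (bcomp_trans bA bA').
have bB' : bcomp m sgtop B' by apply: bcomp_trans bB _; exists k.
have [b' cb' _] := into B' B'H bB'.
have [h ch _] := bH.
have ab' : perm_eq a' b'.
  rewrite -(perm_cat2l h); apply: perm_trans (comp_unique (comp_cat ch ca') (comp_cat ca ck)) _.
  rewrite perm_sym; apply: perm_trans (comp_unique (comp_cat ch cb') (comp_cat cb ck')) _.
  by rewrite perm_cat2r perm_sym.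
have HN : (H : set G) `<=` innN N by move=> z /HF1 /F1F0 /F0N.
have a3 : all (fun S => 3 * FS_card S <= 3 * m)%N a'.
  by apply: sub_all aa' => S; rewrite leq_pmul2l.
have m3 : (3 <= 3 * m)%N by rewrite leq_pmulr // ltnW.
have [g [Ng A'g gA']] := comp_conj m3 fH HN gH a3 ca' cb' ab'.
have fA' : finite_index A' := comp_finite_index ca' fH.
have m31 : (1 < 3 * m)%N by apply: leq_trans m3.
have [J [y [yb J3]]] := has_basis_sub m31 gH A'H fA'.
pose phi := vcomp (vinv g) f.
have A'phi : (A' : set G) `<=` vdom phi.
  move=> z A'z; apply/vdom_comp; split; first exact: A'A.
  have : B' (f z) by exists z => //; split=> //; apply: A'A.
  by rewrite -gA' => -[w [Dw _] <-]; apply: vmap_cod.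
have phiA' : vimage phi A' = A'.
  rewrite vimage_comp //; first by rewrite -/B' -gA' vimage_inv.
  by rewrite -/B' -gA' => _ [w [Dw _] <-]; apply: vmap_cod.
have yb' := sbasis_vimage A'phi yb; rewrite phiA' in yb'.
have A'N : (A' : set G) `<=` innN N by move=> z /A'H /HN.
have r := nrel_nielsen fA' A'N (leq_trans m3 J3) yb (nielsen_bases yb yb').
have Nphi := inN_of_nrel fA' (sb_gen yb) A'phi (sb_in yb) r.
have -> : c = \pi_(Comm G) g * \pi_(Comm G) phi.
  rewrite -fc -[RHS]/(comm_mul _ _) pi_commM; apply/commP/vequivP; exists A' => // z A'z.
  have Dz := A'A z A'z; have Bz : B' (f z) by exists z.
  have Cg : vcod g (f z) by move: Bz; rewrite -gA' => -[w [Dw _] <-]; apply: vmap_cod.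
  have [Dw ew] := vinv_mapP Cg; split=> //.
    by apply/vdom_comp; split; [apply: A'phi | ].
exact: sgM.
Qed.

(** Otherwise [x i] would commute with a power of [x j] lying in the subgroup on which the
    conjugation is trivial. *)
Lemma vconj_neq1 i j : i != j -> \pi_(Comm G) (vconj (x i)) != 1.
Proof.
move=> ij; apply/eqP => /commP/vequivP [D /finite_indexP [T [a aP]] DP].
have [k k0 Dk] : exists2 k, (0 < k)%N & D (x j ^+ k).
  have : ~~ injectiveb (fun n : 'I_#|T|.+1 => a (x j ^+ n)).
    apply/negP => /injectiveP /leq_card; by rewrite card_ord ltnn.
  case/injectivePn => n [n' nn' /aP e].
  wlog lt : n n' nn' e / (n < n')%N.
    move=> wl; have [lt|gt|eq] := ltngtP n n'; first exact: (wl n n').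
      apply: (wl n' n) => //; first by rewrite eq_sym.
      by have := sgV e; rewrite invgM invgK.
    by case/eqP: nn'; apply: val_inj.
  exists (n' - n)%N; first by rewrite subn_gt0.
  move: e; rewrite -{1}(subnKC (ltnW lt)) expgnDr mulKg; exact.
have [_ _ /= e] := DP _ Dk.
have c : x i * x j ^+ k = x j ^+ k * x i by rewrite -{2}e mulgVK.
have wp n : weval x (nseq n (j, true)) = x j ^+ n.
  by elim: n => // n IH; rewrite /= IH expgS.
have nred n l : reduced l -> all snd l -> reduced (nseq n (j, true) ++ l).
  move=> rl al; elim: n => //= n ->; rewrite andbT; case: n => [|n] /=; last by rewrite xpair_eqE andbF.
  by case: l rl al => // -[i' e'] l _ /= /andP [-> _]; rewrite xpair_eqE andbF.
pose u := (i, true) :: nseq k (j, true); pose v := nseq k (j, true) ++ [:: (i, true)].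
have uv : weval x u = weval x v by rewrite /u /v weval_cat /= !wp mulg1.
have ru : reduced u.
  have := nred k [::] isT isT; rewrite /u cats0 /= => ->; rewrite andbT.
  by case: (k) => //= n; rewrite xpair_eqE andbF.
have := weval_reduced_inj xb ru (nred k [:: (i, true)] isT isT) uv.
by rewrite /u /v; case: (k) k0 => // n _ [eij]; rewrite eij eqxx in ij.
Qed.

End Monolith.

Theorem corollary3p8 (F : groupType) (r : nat) (x : 'I_r -> F)
    (r_ge2 : (2 <= r)%N) (x_basis : free_basis x) :
  [/\ monolithic (Comm F),
      monolith (Comm F) = [set c : Comm F | dcomm c = 0%R]
    & forall N : normal_subgroup (Comm F),
        (N : set (Comm F)) <> [set 1%g] -> is_abelian (quotient_group N)].
Proof.
have xb := sbasis_free x_basis.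
have I2 : (2 <= #|'I_r|)%N by rewrite card_ord.
have minN := ker_d_minimal xb I2.
have K1 : (ker_d F : set (Comm F)) <> [set 1].
  have [r0 r1] : (0 < r)%N /\ (1 < r)%N by split=> //; apply: ltnW.
  have /eqP neq := @vconj_neq1 _ _ x xb (Ordinal r0) (Ordinal r1) isT.
  move=> eK; apply: neq; suff : [set 1] (\pi_(Comm F) (vconj (x (Ordinal r0)))) by [].
  by rewrite -eK; apply: dcomm_vconj.
have mE : monolith (Comm F) = [set c | dcomm c = 0%R].
  apply/seteqP; split=> [c Mc|c dc N N1]; last exact: minN.
  exact: (Mc (ker_d F)).
split=> //; first by rewrite /monolithic mE.
move=> N N1 a b; rewrite -[a]reprK -[b]reprK.
rewrite -[LHS]/(quo_mul _ _) -[RHS]/(quo_mul _ _) !pi_quoM; apply/eqP/quoP.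
apply: minN => //=; rewrite !dcommM dcommV !dcommM.
by rewrite [X in (_ + X)%R]GRing.addrC GRing.addNr.
Qed.
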